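(* Assume that $T$ is a complete theory over a binary vocabulary. The following are equivalent: (i) $T$ is $\omega$-stable, $\omega$-categorical with SU-rank $1$ and trivial pregeometry. (ii) There is a restricted equivalence relation $\xi$ for $T$ and a set of sets of binary atomic diagrams $\Delta=\{\delta_{i,j}\}$ with $|\delta_{i,j}|=1$ for each $i,j$ such that $T$ satisfies $(\xi,\Delta)$-extension properties. (iii) There is a restricted equivalence relation $\xi$ for $T$ such that if $\mathcal{M}\models T$ then each equivalence class $X$ of $\xi$ is an indiscernible set over $M-X$.
   Context: All vocabularies are finite and relational. A vocabulary is binary if it contains only relation symbols of arity at most $2$. A theory is $\omega$-categorical if it has a unique countable model up to isomorphism. $T$ is $\omega$-stable if for each $\mathcal{M}\models T$ and $A\subseteq M$ with $|A|=\aleph_0$, the number of different types over $A$ is $\aleph_0$. SU-rank is the usual rank of simple theories. $\mathrm{acl}(X)$ is the algebraic closure of $X$; for a simple structure $\mathcal{M}$ with SU-rank $1$, $(M,\mathrm{acl})$ is a pregeometry, and it is trivial if $\mathrm{acl}(X)=X\cup\mathrm{acl}(\emptyset)$ for each $X\subseteq M$. $[n]=\{1,\dots,n\}$; $\mathrm{atDiag}(\bar a)$ denotes the atomic diagram of the tuple $\bar a$; a binary atomic diagram is the atomic diagram of a pair. Restricted equivalence relation: a formula $\xi$ is a restricted equivalence relation for $T$ if for some $k,t\in\mathbb{N}$, $T$ implies that $\xi$ defines an equivalence relation with $k+t$ equivalence classes such that $k$ of the equivalence classes are infinite and $t$ of the equivalence classes have size $1$. Extension properties: assume that for each $k\in\mathbb{Z}^+$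 there are formulas $\theta_{k,1}(x_1,\dots,x_k),\dots,\theta_{k,i_k}(x_1,\dots,x_k)$ such that $T\models\sigma_k$, where $\sigma_k$ is $\forall x_1,\dots,x_k\big((\bigwedge_{1\le i<j\le k}x_i\ne x_j)\rightarrow\bigvee_{n=1}^{i_k}\theta_{k,n}(x_1,\dots,x_k)\big)$. Furthermore assume that for each $i\in\{1,\dots,i_k\}$ there are associated numbers $j_1,\dots,j_m\in\{1,\dots,i_{k+1}\}$, for some $1\le m\le i_{k+1}$, such that $T\models\xi_{k,i}$ and, for each $j\in\{j_1,\dots,j_m\}$, $T\models\tau_{k,i,j}$, where $\tau_{k,i,j}$ is $\forall x_1,\dots,x_k(\theta_{k,i}(x_1,\dots,x_k)\rightarrow\exists z\,\theta_{k+1,j}(x_1,\dots,x_k,z))$, with the special case $\tau_{0,1,j}\equiv\exists z\,\theta_{1,j}(z)$, and $\xi_{k,i}$ is $\forall x_1,\dots,x_k\big(\theta_{k,i}(x_1,\dots,x_k)\rightarrow\forall y(\bigwedge_{n=1}^k y\ne x_n\rightarrow\bigvee_{n=1}^m\theta_{k+1,j_n}(x_1,\dots,x_k,y))\big)$. If all this is true, and for each $k$ and $i\in[i_k]$ we have $T\models\forall x_1,\dots,x_k(\theta_{k,i}(x_1,\dots,x_k)\rightarrow\bigwedge_{1\le\alpha<\beta\le k}x_\alpha\ne x_\beta)$ and there is an atomic diagram $R$ such that $T\models\forall x_1,\dots,x_k(\theta_{k,i}(x_1,\dots,x_k)\rightarrow R(x_1,\dots,x_k))$, then $T$ satisfies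 extension properties, and the formulas $\theta_{k,i}$ are called extension axioms. $(\xi,\Delta)$-extension axioms: let $\xi(x,y)$ be a formula, $l\in\mathbb{N}$ and $\Delta=\{\delta_{i,j}\}_{i,j\in[l]}$ where each $\delta_{i,j}$ is a non-empty set of binary atomic diagrams. For each $k\in\mathbb{N}$ let $i_k\in\mathbb{N}$. The formulas $\{\theta_{k,i}(y_1,\dots,y_k):k\in\mathbb{N},i\in[i_k]\}$ are called $(\xi,\Delta)$-extension axioms if the following holds. There is a formula $\gamma$ equivalent to $\exists x_{1,1},\dots,x_{1,t_1},\dots,x_{l,1},\dots,x_{l,t_l}\,\gamma_0(x_{1,1},\dots,x_{l,t_l})$ such that $\gamma_0$ implies that for each $i,j\in[l]$, $\{\mathrm{atDiag}(x_{i,\alpha},x_{j,\beta}):\alpha\in[t_i],\beta\in[t_j]\}=\delta_{i,j}$ and $\xi(x_{i,\alpha},x_{j,\beta})$ holds if and only if $i=j$. For each $k\in\mathbb{N}$, $j_1,\dots,j_k\in[l]$ and collection $\{\eta_{\alpha,\beta}\}_{\alpha,\beta\in\{j_1,\dots,j_k\}}$ such that $\eta_{\alpha,\beta}\in\delta_{\alpha,\beta}$, there is $j\in[i_k]$ and a formula $\theta'_{k,j}$ such that $\theta'_{k,j}(y_1,\dots,y_k,x_{1,1},\dots,x_{l,t_l})$ implies that for each $r,s\in[k]$, $\mathrm{atDiag}(y_r,y_s)=\eta_{j_r,j_s}$ and $\xi(y_r,x_{j_r,1})$ hold. For each $k$ and $i\in[i_k]$, $\theta_{k,i}(y_1,\dots,y_k)$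 is equivalent to $\exists x_{1,1},\dots,x_{1,t_1},\dots,x_{l,1},\dots,x_{l,t_l}\big(\gamma_0(x_{1,1},\dots,x_{l,t_l})\wedge\theta'_{k,i}(y_1,\dots,y_k,x_{1,1},\dots,x_{l,t_l})\big)$. $T$ satisfies $(\xi,\Delta)$-extension properties if $T$ implies that $\xi$ is a restricted equivalence relation with $l$ equivalence classes and $T$ satisfies extension properties using the $(\xi,\Delta)$-extension axioms as extension axioms, with $\theta_{k,i}$ associated to $\theta_{k+1,j}$ if $\theta'_{k,i}$ is a subformula of $\theta'_{k+1,j}$.
   Formalization: T is assumed to have an infinite model (for finite models (iii) holds but (i) fails); atDiag(x_{i,α},x_{j,β}) and atDiag(y_r,y_s) are taken only for different variables; every θ'_{k,i} must arise from some choice of j_1,…,j_k and η. *)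

(* Defs.v *)
From Stdlib Require List.
From mathcomp Require Import all_boot.
From mathcomp Require Import boolp classical_sets functions cardinality.

Set Implicit Arguments.
Unset Strict Implicit.
Unset Printing Implicit Defensive.

Local Open Scope classical_set_scope.
Local Open Scope card_scope.

Record vocabulary := Vocabulary {
  symbol : finType;
  arity : symbol -> nat }.

Definition binary (L : vocabulary) : Prop := forall r : symbol L, arity r <= 2.

(* Variables are named by natural numbers, so that being a subformula is a
   purely syntactic matter. *)
Inductive formula (L : vocabulary) : Type :=
| FEq of nat & nat
| FRel (r : symbol L) of (arity r).-tuple nat
| FNot of formula L
| FAnd of formula L & formula L
| FEx of nat & formula L.

Arguments FEq {L}.

Section Syntax.
Variable L : vocabulary.
Implicit Types phi psi : formula L.

Fixpoint fv phi : seq nat :=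
  match phi with
  | FEq x y => [:: x; y]
  | FRel r t => t
  | FNot psi => fv psi
  | FAnd psi1 psi2 => fv psi1 ++ fv psi2
  | FEx x psi => [seq y <- fv psi | y != x]
  end.

(* The free variables of phi are among 0, ..., n-1. *)
Definition scoped (n : nat) phi : bool := all (fun x => x < n) (fv phi).

Fixpoint subformula phi psi : Prop :=
  phi = psi \/
  match psi with
  | FNot psi1 => subformula phi psi1
  | FAnd psi1 psi2 => subformula phi psi1 \/ subformula phi psi2
  | FEx _ psi1 => subformula phi psi1
  | _ => False
  end.

Definition atomic phi : Prop :=
  match phi with FEq _ _ | FRel _ _ => True | _ => False end.

Definition literal phi : Prop :=
  match phi with FNot psi => atomic psi | _ => atomic phi end.

Definition exists_vars (xs : seq nat) phi : formula L := foldr (@FEx L) phi xs.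

End Syntax.

Record structure (L : vocabulary) := Structure {
  carrier :> Type;
  carrier_inhabited : inhabited carrier;
  interp : forall r : symbol L, (arity r).-tuple carrier -> Prop }.

Section Semantics.
Variable L : vocabulary.
Implicit Types (M N : structure L) (phi : formula L).

Definition upd M (v : nat -> M) (x : nat) (a : M) : nat -> M :=
  fun y => if y == x then a else v y.

Fixpoint sat M phi (v : nat -> M) : Prop :=
  match phi with
  | FEq x y => v x = v y
  | FRel r t => interp (map_tuple v t)
  | FNot psi => ~ sat psi v
  | FAnd psi1 psi2 => sat psi1 v /\ sat psi2 v
  | FEx x psi => exists a, sat psi (upd v x a)
  end.

(* M |= phi(s_0, ..., s_{n-1}) for n = size s; only used with phi scoped by n,
   so that the values v of the other variables are irrelevant. *)
Definition holds M phi (s : seq M) : Prop :=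
  forall v : nat -> M, sat phi (fun i => nth (v i) s i).

Definition elementary M N (f : M -> N) : Prop :=
  forall phi (s : seq M), scoped (size s) phi ->
    holds phi s <-> holds phi (map f s).

Definition isomorphic M N : Prop :=
  exists f : M -> N, bijective f /\
    forall (r : symbol L) (t : (arity r).-tuple M),
      interp t <-> interp (map_tuple f t).

(* The literals in the variables x_0, ..., x_{n-1} satisfied by s, n = size s;
   equality counts as an atomic formula. *)
Definition atDiag M (s : seq M) : set (formula L) :=
  [set phi | [/\ literal phi, scoped (size s) phi & holds phi s]].

Definition atomic_diagram (n : nat) (d : set (formula L)) : Prop :=
  exists M (s : seq M), size s = n /\ d = atDiag s.

Definition theory : Type := set {phi : formula L | scoped 0 phi}.

Implicit Types T : theory.

Definition models M T : Prop :=
  forall phi : {phi : formula L | scoped 0 phi},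
    T phi -> forall v : nat -> M, sat (sval phi) v.

Definition entails T phi : Prop :=
  forall M, models M T -> forall v : nat -> M, sat phi v.

Definition complete T : Prop :=
  (exists M, models M T) /\
  forall phi, scoped 0 phi -> entails T phi \/ entails T (FNot phi).

Definition has_infinite_model T : Prop :=
  exists M, models M T /\ infinite_set [set: M].

Definition omega_categorical T : Prop :=
  (exists M, models M T /\ countable [set: M]) /\
  forall M N, models M T -> models N T ->
    countable [set: M] -> countable [set: N] -> isomorphic M N.

(* tp(b/A) for A a subset of M and b a tuple of N, where f : M -> N is an
   elementary embedding. The pair (phi, c) stands for the formula
   phi(x_0, ..., x_{n-1}, c) with parameters c in A. *)
Definition tp M N (f : M -> N) (A : set M) (b : seq N) :
    set (formula L * seq M) :=
  [set q | [/\ List.Forall A q.2, scoped (size b + size q.2) q.1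
             & holds q.1 (b ++ map f q.2)]].

Definition types M (A : set M) (n : nat) : set (set (formula L * seq M)) :=
  [set p | exists N (f : M -> N) (b : seq N),
     [/\ elementary f, size b = n & p = tp f A b]].

Definition omega_stable T : Prop :=
  forall M (A : set M), models M T -> A #= [set: nat] ->
    forall n, 0 < n -> types A n #= [set: nat].

Definition same_type M (A : set M) (b b' : seq M) : Prop :=
  size b = size b' /\ tp id A b = tp id A b'.

Definition indiscernible_set M (X A : set M) : Prop :=
  forall (n : nat) (a b : 'I_n -> M), injective a -> injective b ->
    (forall i, X (a i)) -> (forall i, X (b i)) ->
    same_type A (codom a) (codom b).

Definition acl M (X : set M) : set M :=
  [set a | exists phi (c : seq M),
     [/\ List.Forall X c, scoped (size c).+1 phi, holds phi (a :: c)
       & finite_set [set b | holds phi (b :: c)]]].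

Definition trivial_pregeometry T : Prop :=
  forall M, models M T -> forall X : set M, acl X = X `|` acl set0.

Definition divides M (A : set M) phi (b : seq M) : Prop :=
  exists N (f : M -> N) (c : nat -> seq N) (k : nat),
    [/\ elementary f,
        forall i, same_type (f @` A) (c i) (map f b)
      & forall I : seq nat, uniq I -> size I = k ->
          ~ exists a : N, forall i, i \in I -> holds phi (a :: c i)].

(* The parameters c j of the dividing formulas may lie in any elementary
   extension N of M. *)
Definition forks M (A : set M) phi (b : seq M) : Prop :=
  exists N (f : M -> N) (m : nat) (psi : 'I_m -> formula L) (c : 'I_m -> seq N),
    [/\ elementary f,
        forall j, scoped (size (c j)).+1 (psi j),
        forall a : N, holds phi (a :: map f b) ->
          exists j, holds (psi j) (a :: c j)
      & forall j, divides (f @` A) (psi j) (c j)].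

Definition type_forks M (A B : set M) (a : M) : Prop :=
  exists phi (b : seq M),
    [/\ List.Forall B b, scoped (size b).+1 phi, holds phi (a :: b)
      & forks A phi b].

(* SU(a/A) >= n, that is SU(tp(a/A)) >= n. Every forking extension of tp(a/A)
   is realized, up to an automorphism of the monster model fixing A, by a itself;
   hence only the larger set B needs to be looked for in elementary extensions. *)
Fixpoint SU_ge (n : nat) M (A : set M) (a : M) : Prop :=
  if n is n'.+1 then
    exists N (f : M -> N) (B : set N),
      [/\ elementary f, f @` A `<=` B, type_forks (f @` A) B (f a)
        & SU_ge n' B (f a)]
  else True.

(* The SU-rank of T is the supremum of the SU-ranks of the 1-types of T. *)
Definition SU_rank_eq T (n : nat) : Prop :=
  (exists M (A : set M) (a : M), models M T /\ SU_ge n A a) /\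
  (forall M (A : set M) (a : M), models M T -> ~ SU_ge n.+1 A a).

Definition holds2 M (xi : formula L) (a b : M) : Prop := holds xi [:: a; b].

Definition classes M (xi : formula L) : set (set M) :=
  [set X | exists a : M, X = [set b | holds2 xi a b]].

Definition restricted_equiv_with T (xi : formula L) (k t : nat) : Prop :=
  scoped 2 xi /\
  forall M, models M T ->
    [/\ RelationClasses.Equivalence (@holds2 M xi),
        @classes M xi #= `I_(k + t),
        @classes M xi `&` [set X | infinite_set X] #= `I_k
      & @classes M xi `&` [set X | X #= `I_1] #= `I_t].

Definition restricted_equiv T (xi : formula L) : Prop :=
  exists k t, restricted_equiv_with T xi k t.

(* The variables y_0, y_1, ... and x_{i,0}, x_{i,1}, ..., pairwise distinct *)
Definition yvar (r : nat) : nat := r.*2.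
Definition xvar (i alpha : nat) : nat := (pickle (i, alpha)).*2.+1.

Definition yvars (k : nat) : seq nat := [seq yvar r | r <- iota 0 k].
Definition xvars (l : nat) (t : 'I_l -> nat) : seq nat :=
  [seq xvar (val i) alpha | i : 'I_l <- enum 'I_l, alpha : nat <- iota 0 (t i)].

(* The extension axioms are theta k i for i : 'I_(ik k), and J k i is the set of
   indices associated with (k, i). The conjuncts of the last conjunction are,
   in this order, sigma_k, tau_{k,i,j}, xi_{k,i}, and that theta k i forces
   distinctness and a fixed atomic diagram. For k = 0 there is a single formula
   theta_{0,1}, which by sigma_0 is a consequence of T, so that tau_{0,1,j}
   amounts to exists z, theta_{1,j}(z). *)
Definition extension_properties T (ik : nat -> nat)
    (theta : forall k, 'I_(ik k) -> formula L)
    (J : forall k, 'I_(ik k) -> set 'I_(ik k.+1)) : Prop :=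
  [/\ ik 0 = 1,
      forall k i, {subset fv (theta k i) <= yvars k},
      forall k i, J k i !=set0
    & forall k,
      [/\ forall M, models M T -> forall v : nat -> M,
            injective (fun r : 'I_k => v (yvar r)) ->
            exists i, sat (theta k i) v,
          forall M, models M T -> forall (v : nat -> M) i j, J k i j ->
            sat (theta k i) v ->
            exists z, sat (theta k.+1 j) (upd v (yvar k) z),
          forall M, models M T -> forall (v : nat -> M) i,
            sat (theta k i) v ->
            forall z, (forall r : 'I_k, z <> v (yvar r)) ->
            exists2 j, J k i j & sat (theta k.+1 j) (upd v (yvar k) z)
        & forall i, exists2 d, atomic_diagram k d &
            forall M, models M T -> forall v : nat -> M, sat (theta k i) v ->
              injective (fun r : 'I_k => v (yvar r)) /\
              atDiag (map v (yvars k)) = d]].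

Definition diagram_family (l : nat)
    (delta : 'I_l -> 'I_l -> set (set (formula L))) : Prop :=
  forall i j, delta i j !=set0 /\ delta i j `<=` [set d | atomic_diagram 2 d].

(* Here atDiag(x_{i,alpha}, x_{j,beta}) is only considered for two different
   variables: if (i, alpha) = (j, beta) were allowed, delta i i would have to
   contain the diagram of an equal pair, and |delta i i| = 1 would be
   incompatible with infinite classes. Different variables may however take the
   same value, which is what happens in a class of size 1. *)
Definition gamma0_spec (xi : formula L) (l : nat)
    (delta : 'I_l -> 'I_l -> set (set (formula L))) (t : 'I_l -> nat)
    (gamma0 : formula L) : Prop :=
  {subset fv gamma0 <= xvars t} /\
  forall M (v : nat -> M), sat gamma0 v -> forall i j : 'I_l,
    [set d | exists alpha beta,
       [/\ alpha < t i, beta < t j, (i, alpha) != (j, beta)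
         & d = atDiag [:: v (xvar i alpha); v (xvar j beta)]]] = delta i j
    /\ forall alpha beta, alpha < t i -> beta < t j ->
         holds2 xi (v (xvar i alpha)) (v (xvar j beta)) <-> i = j.

(* theta'(y_0, ..., y_{k-1}, x) implies the configuration given by js and eta.
   As for gamma0, only pairs of different variables y_r, y_s are considered. *)
Definition theta'_spec (xi : formula L) (l k : nat)
    (js : 'I_k -> 'I_l) (eta : 'I_l -> 'I_l -> set (formula L))
    (theta' : formula L) : Prop :=
  forall M (v : nat -> M), sat theta' v ->
    (forall r s : 'I_k, r != s ->
       atDiag [:: v (yvar r); v (yvar s)] = eta (js r) (js s)) /\
    (forall r : 'I_k, holds2 xi (v (yvar r)) (v (xvar (js r) 0))).

(* Every (js, eta) gives rise to one of the formulas theta' k i, and conversely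
   every theta' k i arises in this way. *)
Definition extension_axioms (xi : formula L) (l : nat)
    (delta : 'I_l -> 'I_l -> set (set (formula L))) (ik : nat -> nat)
    (theta theta' : forall k, 'I_(ik k) -> formula L) : Prop :=
  exists (t : 'I_l -> nat) (gamma0 : formula L),
    let choice k (js : 'I_k -> 'I_l) (eta : 'I_l -> 'I_l -> set (formula L)) :=
      forall r s : 'I_k, delta (js r) (js s) (eta (js r) (js s)) in
    [/\ gamma0_spec xi delta t gamma0,
        forall k (js : 'I_k -> 'I_l) eta, choice k js eta ->
          exists i, theta'_spec xi js eta (theta' k i),
        forall k i, exists (js : 'I_k -> 'I_l) eta,
          choice k js eta /\ theta'_spec xi js eta (theta' k i)
      & forall k i,
          [/\ {subset fv (theta k i) <= yvars k},
              {subset fv (theta' k i) <= yvars k ++ xvars t}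
            & forall M (v : nat -> M), sat (theta k i) v <->
                sat (exists_vars (xvars t) (FAnd gamma0 (theta' k i))) v]].

Definition xi_extension_properties T (xi : formula L) (l : nat)
    (delta : 'I_l -> 'I_l -> set (set (formula L))) : Prop :=
  (exists k t, (k + t)%N = l /\ restricted_equiv_with T xi k t) /\
  exists (ik : nat -> nat) (theta theta' : forall k, 'I_(ik k) -> formula L),
    extension_axioms xi delta theta theta' /\
    extension_properties T theta
      (fun k i => [set j | subformula (theta' k i) (theta' k.+1 j)]).

End Semantics.

(* Main.v *)
Require Import Defs.
From Stdlib Require List.
From mathcomp Require Import all_boot.
From mathcomp Require Import boolp classical_sets functions cardinality filter.

Set Implicit Arguments.
Unset Strict Implicit.
Unset Printing Implicit Defensive.

Local Open Scope classical_set_scope.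
Local Open Scope card_scope.

(** A partition of a model into finitely many classes is called homogeneous here
    if every class is infinite or a singleton and the atomic diagram of a pair of
    distinct elements only depends on the classes of the two
    ([homogeneous_partition]). Each of the three conditions is equivalent to the
    existence of an infinite model of [T] with a definable homogeneous partition.

    Suppose that there is such a partition. Label the classes. By a back and
    forth argument, tuples with the same labels and the same equalities have the
    same type, even if they live in different structures, as long as the two
    partitions have the same table of diagrams ([labelled_sat]). Representatives
    of the classes satisfy a formula that describes the partition and its table
    ([represents_definable]), so that all models of [T] are labelled in the same
    way ([model_labelling_exists]). Conditions (i) and (iii) are then read off
    from labels: countable models are isomorphic, there are countably many types,
    algebraic closure is trivial, classes are indiscernible over their
    complements, and a type only forks when its realisation becomes a parameter
    ([fork_new], [fork_old]). For (ii), the extension axiom of a sequence of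
    labels says of a tuple that it has these labels with respect to some
    representatives ([partition_extension]).

    Conversely, (ii) and (iii) both say that one element of a pair can be moved
    within its class without changing the diagram of the pair, and two or three
    such moves lead to any other pair with the same labels
    ([homogeneous_of_moves]).

    The main point is that (i) yields a homogeneous partition of the countable
    model. Here there are finitely many types of tuples of each length, all of
    them isolated ([finitely_many_types]), so that the set E of algebraic
    elements is finite. Rank one means that a formula with a solution outside
    its parameters and E does not divide ([not_dividing]). Fix an atom f(x, y).
    By omega-stability, every infinite definable set contains an infinite one
    that no f(x, y) splits into two infinite pieces; its trace is the set of
    those y for which f(x, y) contains almost all of it. Sets with different
    traces are almost disjoint, so a given formula has finitely many traces when
    its parameters range over one type, as it would divide otherwise
    ([finite_traces]). If f(x, a) and f(x, b) differ outside E, a and b, then an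
    unsplit subset of the difference has a trace that separates a from b. There
    are finitely many types of pairs (a, b), hence finitely many traces separate
    all such pairs ([finite_index_generic]). It follows that the relation of being
    twins, that is, of being exchanged by an automorphism that fixes all other
    elements, has finitely many classes ([finite_index_twin]). Outside E this relation is definable, and its classes
    are infinite or singletons because a finite class is algebraic over each of
    its elements ([stable_partition]). *)

(** * Lists *)

Lemma In_mem (T : eqType) (x : T) (s : seq T) : List.In x s <-> x \in s.
Proof.
elim: s => //= a s IH; rewrite inE; split.
  by case=> [->|/IH ->]; rewrite ?eqxx ?orbT.
by case/orP=> [/eqP->|/IH]; [left|right].
Qed.

Lemma ForallP (T : Type) (A : set T) (s : seq T) :
  List.Forall A s <-> forall x, List.In x s -> A x.
Proof. exact: List.Forall_forall. Qed.

Lemma In_nth (T : Type) (a x : T) (s : seq T) :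
  List.In x s -> exists2 i, i < size s & nth a s i = x.
Proof.
elim: s => //= y s IH [->|/IH[i il e]]; first by exists 0.
by exists i.+1.
Qed.

Lemma nth_In (T : Type) (a : T) (s : seq T) i : i < size s -> List.In (nth a s i) s.
Proof. by elim: s i => //= y s IH [|i] il; [left|right; apply: IH]. Qed.

Lemma In_cat (T : Type) (x : T) (s t : seq T) :
  List.In x (s ++ t) <-> List.In x s \/ List.In x t.
Proof. exact: List.in_app_iff. Qed.

Lemma In_idx (X : Type) (a0 : X) (s t : seq X) :
  (forall x, List.In x t -> List.In x s) ->
  exists idx, all (fun i => i < size s) idx /\ t = [seq nth a0 s i | i <- idx].
Proof.
elim: t => [|x t IH] h; first by exists [::].
have [i il ei] := In_nth a0 (h x (or_introl erefl)).
have [|idx [h1 h2]] := IH; first by move=> y yt; apply: h; right.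
by exists (i :: idx); rewrite /= il h1 ei -h2.
Qed.

Lemma In_map_iota (X : Type) (f : nat -> X) n y :
  List.In y [seq f i | i <- iota 0 n] <-> exists2 i, i < n & y = f i.
Proof.
rewrite List.in_map_iff; split=> [[i [<- /In_mem]]|[i il ->]].
  by rewrite mem_iota => il; exists i.
by exists i; split=> //; apply/In_mem; rewrite mem_iota.
Qed.

Lemma map_nth_ord (X : Type) (x0 : X) (s : seq X) :
  [seq nth x0 s i | i : 'I_(size s) <- enum 'I_(size s)] = s.
Proof.
rewrite -[RHS](mkseq_nth x0 s) /mkseq -val_enum_ord -map_comp.
exact: eq_map.
Qed.

Lemma Forall_sig (X : Type) (A : set X) c : List.Forall A c ->
  exists cs : seq {x | A x}, map sval cs = c.
Proof.
elim: c => [|x c IH] Ac; first by exists [::].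
have [cs e] := IH (List.Forall_inv_tail Ac).
by exists (exist _ x (List.Forall_inv Ac) :: cs); rewrite /= e.
Qed.

(** * Finite and infinite sets *)

Lemma infinite_inj (T : Type) (A : set T) : infinite_set A ->
  exists f : nat -> T, injective f /\ forall n, A (f n).
Proof.
elim/Ppointed: T => T in A *; first by rewrite emptyE => /(_ (finite_set0 _)).
move=> /infiniteP /pcard_leP[f].
exists f; split; last by move=> n; apply: funS.
by move=> i j /inj; apply; rewrite inE.
Qed.

Lemma inj_infinite (T : Type) (A : set T) (f : nat -> T) :
  injective f -> (forall n, A (f n)) -> infinite_set A.
Proof.
move=> fi fA; apply/infiniteP; apply: (@card_le_trans _ _ _ (f @` setT)).
  have : f @` setT #= [set: nat] by apply: inj_card_eq => ? ? _ _ /fi.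
  by rewrite card_eq_le => /andP[].
by apply: subset_card_le => _ [n _ <-].
Qed.

Lemma finite_list (T : Type) (A : set T) : finite_set A ->
  exists s : seq T, forall x, A x -> List.In x s.
Proof.
elim/Ppointed: T => T in A *; first by rewrite emptyE; exists [::].
move=> [n]; rewrite card_eq_sym => /card_set_bijP[f [_ _ fs]].
exists [seq f i | i <- iota 0 n] => x /fs[i /= ilt <-].
by apply/List.in_map_iff; exists i; split=> //; apply/In_mem; rewrite mem_iota.
Qed.

Lemma list_finite (T : Type) (A : set T) (s : seq T) :
  (forall x, A x -> List.In x s) -> finite_set A.
Proof.
move=> As; pose B := [set x | List.In x s].
have : finite_set B.
  rewrite {}/B; elim: s {As} => [|a s IH] /=.
    by rewrite (_ : [set _ | _] = set0) //; apply/seteqP; split.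
  have -> : [set x | a = x \/ List.In x s] = [set a] `|` [set x | List.In x s].
    by apply/seteqP; split=> x /= [->|]; [left|right|left|right].
  by rewrite finite_setU.
by apply: sub_finite_set => x /As.
Qed.

Lemma infinite_fresh (T : Type) (A : set T) (s : seq T) : infinite_set A ->
  exists x, A x /\ ~ List.In x s.
Proof.
move=> iA; apply: contrapT => H; apply: iA; apply: (@list_finite _ _ s) => x Ax.
by apply: contrapT => xs; apply: H; exists x.
Qed.

Lemma finite_list_exact (T : Type) (A : set T) : finite_set A ->
  exists s : seq T, forall x, A x <-> List.In x s.
Proof.
move=> /finite_list[s hs]; exists (List.filter (fun x => `[< A x >]) s) => x.
rewrite List.filter_In; split=> [Ax|[_ /asboolP//]].
by split; [exact: hs|exact/asboolP].
Qed.

Lemma card_eq_bij (X Y : Type) (A : set X) (B : set Y) (y : Y) :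
  A #= B -> exists f, set_bij A B f.
Proof. by elim/Ppointed: Y => Y in B y * => [|/card_set_bijP //]; case: (no y). Qed.

Lemma inj_surj_bijective (X Y : Type) (f : X -> Y) :
  injective f -> (forall y, exists x, f x = y) -> bijective f.
Proof.
move=> fi /choice[g gK]; exists g => // x; apply: fi; exact: gK.
Qed.

(** An element of [A] outside [B] and [C], together with the [k] elements of
    [A] in [B] and the [t] ones in [C], would make [k + t + 1] elements of
    [A]. *)
Lemma card_eq_cover (X : Type) (A B C : set X) (x0 : X) k t :
  A #= `I_(k + t) -> A `&` B #= `I_k -> A `&` C #= `I_t ->
  (forall x, B x -> ~ C x) -> forall x, A x -> B x \/ C x.
Proof.
move=> hA; rewrite card_eq_sym => /(card_eq_bij x0)[f [fB fi _]].
rewrite card_eq_sym => /(card_eq_bij x0)[g [gC gi _]] dis x Ax.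
apply: contrapT => nx.
pose h i := if i < k then f i else if i < k + t then g (i - k) else x.
have hA' i : A (h i).
  rewrite /h; case: ltnP => ik; first by have [] := fB i ik.
  case: ltnP => // ikt; have [] // := gC (i - k) _.
  by rewrite /= ltn_subLR.
have tag i : i < (k + t).+1 -> [\/ i < k /\ h i = f i, k <= i < k + t /\ h i = g (i - k) | i = k + t /\ h i = x].
  rewrite ltnS /h => il; case: ltnP => ik; first by constructor 1.
  case: ltnP => ikt; first by constructor 2.
  by constructor 3; split=> //; apply/eqP; rewrite eqn_leq il.
have Bf i : i < k -> B (f i) by move=> ik; have [] := fB i ik.
have Cg i : k <= i < k + t -> C (g (i - k)).
  move=> /andP[ki ik]; have [] // := gC (i - k) _.
  by rewrite /= ltn_subLR.
have hi : set_inj `I_(k + t).+1 h.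
  move=> i j /set_mem /= il /set_mem /= jl.
  have [[ik ->]|[ik ->]|[ik ->]] := tag i il;
    have [[jk ->]|[jk ->]|[jk ->]] := tag j jl => e.
  - by apply: fi; rewrite ?inE.
  - by case: (dis (f i)); [exact: Bf|rewrite e; exact: Cg].
  - by case: nx; left; rewrite -e; exact: Bf.
  - by case: (dis (f j)); [exact: Bf|rewrite -e; exact: Cg].
  - have [/andP[ki it] /andP[kj jt]] := (ik, jk).
    rewrite -(subnK ki) -(subnK kj); congr (_ + _).
    by apply: gi; rewrite ?inE //= ltn_subLR.
  - by case: nx; right; rewrite -e; exact: Cg.
  - by case: nx; left; rewrite e; exact: Bf.
  - by case: nx; right; rewrite e; exact: Cg.
  - by rewrite ik jk.
have : `I_(k + t).+1 #<= `I_(k + t).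
  have /card_eqPle[h1 _] : `I_(k + t).+1 #= h @` `I_(k + t).+1.
    by rewrite card_eq_sym; exact: inj_card_eq.
  apply: card_le_trans h1 _.
  have /card_eqPle[h2 _] := hA; apply: card_le_trans h2.
  by apply: subset_card_le => _ [i _ <-].
by rewrite card_le_II ltnn.
Qed.

Lemma inj_countable (T : Type) (U : countType) (f : T -> U) :
  injective f -> countable [set: T].
Proof.
move=> fi; apply/countable_injP; exists (pickle \o f) => x y _ _ /= e.
by apply/fi/(pcan_inj (@pickleK U)).
Qed.

Lemma inj_unbounded (g : nat -> nat) B : injective g -> exists j, B <= g j.
Proof.
move=> gi; apply: contrapT => H.
apply: (@inj_infinite _ `I_B g gi); last exact: finite_II.
by move=> n /=; rewrite ltnNge; apply/negP => h; apply: H; exists n.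
Qed.

Lemma cantor (X : Type) (p : (nat -> bool) -> X) (A : set X) :
  injective p -> (forall b, A (p b)) -> ~ countable A.
Proof.
move=> pi pA /countable_injP[h hi].
pose d n := ~~ `[< exists b, h (p b) = n /\ b n >].
have : h (p d) = h (p d) by [].
case: (boolP (d (h (p d)))) => dn _.
  by move/asboolPn: (dn) => H; apply: H; exists d.
move: (dn); rewrite /d negbK => /asboolP[b [e bn]].
move: dn; suff -> : d = b by rewrite e bn.
by apply: pi; apply: hi; rewrite ?inE.
Qed.

(** ** Relations of finite index *)

(** Finite index, for a relation that need not be an equivalence: finitely many
    colours suffice to make equal colour imply the relation. *)
Definition finite_index (T : Type) (R : T -> T -> Prop) : Prop :=
  exists (F : finType) (kappa : T -> F),
    forall x y, kappa x = kappa y -> R x y.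

Lemma finite_indexI (T : Type) (R S : T -> T -> Prop) :
  finite_index R -> finite_index S -> finite_index (fun x y => R x y /\ S x y).
Proof.
move=> [F [k kP]] [G [h hP]].
by exists (F * G)%type, (fun x => (k x, h x)) => x y [/kP ? /hP ?].
Qed.

Lemma finite_index_sub (T : Type) (R S : T -> T -> Prop) :
  (forall x y, R x y -> S x y) -> finite_index R -> finite_index S.
Proof. by move=> RS [F [k kP]]; exists F, k => x y /kP/RS. Qed.

Lemma finite_index_all (T : Type) (I : finType) (R : I -> T -> T -> Prop) :
  (forall i, finite_index (R i)) -> finite_index (fun x y => forall i, R i x y).
Proof.
move=> H.
pose F i : finType := projT1 (cid (H i)).
pose k i : T -> F i := projT1 (cid (projT2 (cid (H i)))).
have kP i x y : k i x = k i y -> R i x y := projT2 (cid (projT2 (cid (H i)))) x y.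
exists {dffun forall i : I, F i}, (fun x => [ffun i => k i x]) => x y E i.
by apply: kP; move/(congr1 (fun g : {dffun _} => g i)): E; rewrite !ffunE.
Qed.

Lemma finite_index_fiber (T : Type) (F : finType) (kappa : T -> F) (A : set T) :
  infinite_set A -> exists c, infinite_set (A `&` [set x | kappa x = c]).
Proof.
move=> iA; apply: contrapT => H; apply: iA.
have -> : A = \bigcup_(c in [set: F]) (A `&` [set x | kappa x = c]).
  by apply/seteqP; split=> [x Ax|x [c _ []//]]; exists (kappa x).
apply: bigcup_finite; first exact: finite_finset.
by move=> c _; apply: contrapT => h; apply: H; exists c.
Qed.

Lemma monochromatic (T : Type) (R : T -> T -> Prop) (u : nat -> T) :
  finite_index R ->
  exists g : nat -> nat, injective g /\ forall i j, R (u (g i)) (u (g j)).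
Proof.
move=> [F [k kP]].
have [c /infinite_inj[g [gi gc]]] :=
  finite_index_fiber (k \o u) infinite_nat.
exists g; split=> // i j; apply: kP.
by have [_ /= ->] := gc i; have [_ /= ->] := gc j.
Qed.

Lemma finite_index_list (T : Type) (s : seq T) :
  finite_index (fun a b => List.In a s \/ List.In b s -> a = b).
Proof.
case: s => [|a0 s']; first by exists unit, (fun=> tt) => x y _ [].
set s := a0 :: s'.
have /choice[p hp] : forall x, exists i : option 'I_(size s),
    if i is Some i then nth a0 s i = x else ~ List.In x s.
  move=> x; case: (pselect (List.In x s)) => xs; last by exists None.
  by have [i il e] := In_nth a0 xs; exists (Some (Ordinal il)).
exists (option 'I_(size s)), p => x y e.
by have := hp x; have := hp y; rewrite -e; case: (p x) => [i -> ->//|ny nx []].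
Qed.

Lemma finite_index_sets (T : Type) (Q : set (set T)) : finite_set Q ->
  finite_index (fun a b => forall X, Q X -> X a -> X b).
Proof.
move=> /finite_list[s hs].
have : finite_index (fun a b => forall i : 'I_(size s),
    nth set0 s i a -> nth set0 s i b).
  apply: finite_index_all => i.
  exists bool, (fun a => `[< nth set0 s i a >]) => a b e /asboolP.
  by rewrite e => /asboolP.
apply: finite_index_sub => a b h X /hs/(In_nth set0)[i il <-].
exact: (h (Ordinal il)).
Qed.

(** The colours given to finitely many elements are refined, so that each of
    those elements gets a colour of its own. *)
Lemma finite_index_infinite (T : Type) (F : finType) (kappa : T -> F)
    (R : T -> T -> Prop) : (forall x, R x x) ->
  (forall a b, kappa a = kappa b ->
     infinite_set [set x | kappa x = kappa a] -> R a b) ->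
  finite_index R.
Proof.
move=> Rr h.
pose S := \bigcup_(c in [set c | finite_set [set x | kappa x = c]])
             [set x | kappa x = c].
have fS : finite_set S by apply: bigcup_finite => //; exact: finite_finset.
have [s hs] := finite_list fS.
have fk : finite_index (fun x y => kappa x = kappa y) by exists F, kappa.
apply: finite_index_sub (finite_indexI fk (finite_index_list s)) => a b [e k].
case: (pselect (finite_set [set x | kappa x = kappa a])) => fa; last exact: h.
by rewrite -k //; left; apply: hs; exists (kappa a).
Qed.

Lemma finite_index_labels (T : Type) (R : T -> T -> Prop) :
  RelationClasses.Equivalence R -> finite_index R ->
  exists l (lab : T -> 'I_l), (forall i, exists a, lab a = i) /\
    forall a b, lab a = lab b <-> R a b.
Proof.
move=> [Rr Rs Rt] [F [kappa hk]].
(* A class is identified by the set of colours that it meets. *)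
pose C a : {ffun F -> bool} := [ffun c => `[< exists2 b, R a b & kappa b = c >]].
have CP a b : C a = C b <-> R a b.
  split=> [e|ab].
    have : C a (kappa a) by rewrite ffunE; apply/asboolP; exists a.
    rewrite e ffunE => /asboolP[b' bb' /hk ba].
    by apply: Rs; apply: Rt bb' ba.
  apply/ffunP => c; rewrite !ffunE; apply/asbool_equiv_eq; split=> -[b' h e].
    by exists b' => //; apply: Rt (Rs _ _ ab) h.
  by exists b' => //; apply: Rt ab h.
pose I := [pred X : {ffun F -> bool} | `[< exists a, C a = X >]].
have CI a : C a \in I by apply: asboolT; exists a.
have K a x : x \in I -> enum_val (enum_rank_in (CI a) x) = x.
  by move=> xI; rewrite enum_rankK_in.
exists #|I|, (fun a => enum_rank_in (CI a) (C a)); split=> [i|a b].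
  have /asboolW[a ea] : `[< exists a, C a = enum_val i >] := enum_valP i.
  by exists a; apply: enum_val_inj; rewrite K.
rewrite -CP; split=> [e|e]; last by apply: enum_val_inj; rewrite !K.
by have := congr1 enum_val e; rewrite !K.
Qed.

Lemma finite_index_sym (X : Type) (R : X -> X -> Prop) :
  finite_index R -> finite_index (fun a b => R a b /\ R b a).
Proof. by move=> [F [k hk]]; exists F, k => a b e; split; apply: hk. Qed.

(** * First-order syntax and semantics *)

Section Basics.
Variable L : vocabulary.
Implicit Types (M N : structure L) (phi psi : formula L).

Lemma updE M (v : nat -> M) x a y : upd v x a y = if y == x then a else v y.
Proof. by []. Qed.

Lemma sat_ext M phi (v v' : nat -> M) :
  {in fv phi, v =1 v'} -> sat phi v <-> sat phi v'.
Proof.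
elim: phi v v' => [x y|r t|psi IH|psi1 IH1 psi2 IH2|x psi IH] v v' /= E.
- by rewrite !E ?inE ?eqxx ?orbT.
- suff -> : map_tuple v t = map_tuple v' t by [].
  by apply: val_inj => /=; apply/eq_in_map.
- by rewrite (IH v v').
- rewrite (IH1 v v') ?(IH2 v v') // => y yin; apply: E;
    by rewrite mem_cat yin ?orbT.
- have E' a : {in fv psi, upd v x a =1 upd v' x a}.
    move=> y yin; rewrite !updE; case: eqP => // /eqP yx.
    by apply: E; rewrite mem_filter yx.
  by split=> -[a sa]; exists a; apply/(IH _ _ (E' a)).
Qed.

(** The renamed bound variables are even, so that an odd variable outside the
    range of the substitution is not used at all; see [vars_subst]. *)
Fixpoint subst (rho : nat -> nat) phi : formula L :=
  match phi with
  | FEq x y => FEq (rho x) (rho y)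
  | FRel r t => FRel (map_tuple rho t)
  | FNot psi => FNot (subst rho psi)
  | FAnd psi1 psi2 => FAnd (subst rho psi1) (subst rho psi2)
  | FEx x psi =>
      let z := (\sum_(y <- fv psi) rho y).+1.*2 in
      FEx z (subst (fun y => if y == x then z else rho y) psi)
  end.

Lemma fresh_bound (rho : nat -> nat) (s : seq nat) y :
  y \in s -> rho y != (\sum_(x <- s) rho x).+1.*2.
Proof.
move=> ys; rewrite (big_rem y) //= neq_ltn; apply/orP; left.
by rewrite -addnn ltn_addl // ltnS leq_addr.
Qed.

Lemma sat_subst M rho phi (v : nat -> M) :
  sat (subst rho phi) v <-> sat phi (v \o rho).
Proof.
elim: phi rho v => [x y|r t|psi IH|psi1 IH1 psi2 IH2|x psi IH] rho v //=.
- suff -> : map_tuple v (map_tuple rho t) = map_tuple (v \o rho) t by [].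
  by apply: val_inj; rewrite /= -map_comp.
- by rewrite IH.
- by rewrite IH1 IH2.
- set z := (_.+1.*2).
  have E a : {in fv psi, upd v z a \o (fun y => if y == x then z else rho y)
                         =1 upd (v \o rho) x a}.
    move=> y yin /=; rewrite !updE; case: (y == x); first by rewrite eqxx.
    by rewrite (negPf (fresh_bound _ yin)).
  by split=> -[a sa]; exists a; move: sa; rewrite IH (sat_ext (E a)).
Qed.

Lemma fv_subst rho phi : {subset fv (subst rho phi) <= map rho (fv phi)}.
Proof.
elim: phi rho => [x y|r t|psi IH|psi1 IH1 psi2 IH2|x psi IH] rho //=.
- by move=> y; rewrite map_cat !mem_cat => /orP[/IH1|/IH2] ->; rewrite ?orbT.
- set z := (_.+1.*2) => y; rewrite mem_filter => /andP[yz /IH/mapP[u uin e]].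
  move: e; case: eqP => [_ e|ux ->]; first by rewrite e eqxx in yz.
  by apply: map_f; rewrite mem_filter uin andbT; apply/eqP.
Qed.

Fixpoint vars phi : seq nat :=
  match phi with
  | FEq x y => [:: x; y]
  | FRel r t => t
  | FNot psi => vars psi
  | FAnd psi1 psi2 => vars psi1 ++ vars psi2
  | FEx x psi => x :: vars psi
  end.

Lemma vars_subst u rho phi :
  odd u -> (forall x, rho x != u) -> u \notin vars (subst rho phi).
Proof.
move=> ou; elim: phi rho => [x y|r t|psi IH|psi1 IH1 psi2 IH2|x psi IH] rho
  ru //=.
- by rewrite !inE !(eq_sym u) !(negPf (ru _)).
- by apply/mapP => -[x _ e]; move: (ru x); rewrite e eqxx.
- exact: IH.
- by rewrite mem_cat negb_or IH1 ?IH2.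
- set z := (_.+1.*2); have zu : z != u.
    by apply/eqP => e; move: ou; rewrite -e odd_double.
  rewrite inE negb_or eq_sym zu IH // => y; case: ifP => // _; exact: ru.
Qed.

(** ** Satisfaction by finite tuples *)

Lemma holds_sat M phi (s : seq M) (v : nat -> M) :
  scoped (size s) phi -> (forall i, i < size s -> v i = nth (v i) s i) ->
  holds phi s <-> sat phi v.
Proof.
move=> sc E.
have K (w : nat -> M) : sat phi (fun i => nth (w i) s i) <-> sat phi v.
  apply: sat_ext => i /(allP sc) ilt.
  by rewrite E //; apply: set_nth_default.
by split=> [/(_ v)/K|H w] //; apply/K.
Qed.

Lemma holds_nth M phi (s : seq M) (a : M) :
  scoped (size s) phi -> holds phi s <-> sat phi (nth a s).
Proof. by move=> sc; apply: holds_sat => // i ilt; apply: set_nth_default. Qed.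

Lemma holds_not M phi (s : seq M) :
  scoped (size s) phi -> holds (FNot phi) s <-> ~ holds phi s.
Proof.
case: (carrier_inhabited M) => a sc.
by rewrite (holds_nth a) // [X in ~ X](holds_nth a).
Qed.

Lemma holds_and M phi psi (s : seq M) :
  holds (FAnd phi psi) s <-> holds phi s /\ holds psi s.
Proof.
split=> [H|[H K] v]; last by split; [exact: H | exact: K].
by split=> v; case: (H v).
Qed.

Lemma scopedW m n phi : m <= n -> scoped m phi -> scoped n phi.
Proof. by move=> mn /allP h; apply/allP => x /h /leq_trans; apply. Qed.

(** The substitution [nth 0 idx] turns a statement about the entries with
    indices [idx] into one about the whole tuple. *)
Lemma scoped_sub n (idx : seq nat) phi :
  all (fun i => i < n) idx -> scoped (size idx) phi ->
  scoped n (subst (nth 0 idx) phi).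
Proof.
move=> /allP h sc; apply/allP => x /fv_subst/mapP[i /(allP sc) il ->].
exact/h/mem_nth.
Qed.

Lemma holds_sub M phi (s : seq M) (idx : seq nat) (a : M) :
  all (fun i => i < size s) idx -> scoped (size idx) phi ->
  holds (subst (nth 0 idx) phi) s <-> holds phi [seq nth a s i | i <- idx].
Proof.
move=> h sc; rewrite (holds_nth a) ?scoped_sub // sat_subst.
rewrite (@holds_sat _ _ _ (nth a s \o nth 0 idx)) ?size_map // => i il.
by rewrite (nth_map 0).
Qed.

Definition eqtp M N (s : seq M) (s' : seq N) : Prop :=
  size s = size s' /\
  forall phi, scoped (size s) phi -> holds phi s <-> holds phi s'.

Lemma eqtp_refl M (s : seq M) : eqtp s s.
Proof. by []. Qed.

Lemma eqtp_sym M N (s : seq M) (s' : seq N) : eqtp s s' -> eqtp s' s.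
Proof. by move=> [e h]; split=> // phi; rewrite -e => /h ->. Qed.

Lemma eqtp_trans M N (P : structure L) (s : seq M) (t : seq N) (u : seq P) :
  eqtp s t -> eqtp t u -> eqtp s u.
Proof.
move=> [e h] [f k]; split; first by rewrite e.
by move=> phi sc; rewrite h // k // -e.
Qed.

Lemma eqtp_sub M N (s : seq M) (s' : seq N) (a : M) (a' : N) (idx : seq nat) :
  eqtp s s' -> all (fun i => i < size s) idx ->
  eqtp [seq nth a s i | i <- idx] [seq nth a' s' i | i <- idx].
Proof.
move=> [e h] hi; split; first by rewrite !size_map.
move=> phi; rewrite size_map => sc.
rewrite -(holds_sub a) // h ?scoped_sub //.
by rewrite (holds_sub a') // -e.
Qed.

Lemma eqtp_elementary M N (f : M -> N) :
  elementary f <-> forall s, eqtp s (map f s).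
Proof.
by split=> [h s|h phi s]; [split; rewrite ?size_map // => phi /h|
  case: (h s) => _; apply].
Qed.

Lemma eqtp_not M N (s : seq M) (s' : seq N) : size s = size s' ->
  ~ eqtp s s' ->
  exists phi, [/\ scoped (size s) phi, holds phi s & ~ holds phi s'].
Proof.
move=> e ne; apply: contrapT => H; apply: ne; split=> // phi sc; split=> h.
  by apply: contrapT => h'; apply: H; exists phi.
apply: contrapT => h'; apply: H; exists (FNot phi).
split=> //; first exact/holds_not.
by move/holds_not; rewrite -e => /(_ sc); apply.
Qed.

Lemma tp_eqtp M N N' (f : M -> N) (g : M -> N') A (b : seq N) (b' : seq N') :
  size b = size b' ->
  tp f A b = tp g A b' <->
  forall c, List.Forall A c -> eqtp (b ++ map f c) (b' ++ map g c).
Proof.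
move=> e; split=> [h c Ac|h].
  split=> [|phi]; first by rewrite !size_cat !size_map e.
  rewrite size_cat size_map => sc.
  have [h1 h2] : tp f A b (phi, c) <-> tp g A b' (phi, c) by rewrite h.
  split=> hh; first by have [] : tp g A b' (phi, c) by apply: h1.
  by have [] : tp f A b (phi, c) by apply: h2; split; rewrite // -e.
apply/seteqP; split=> -[phi c] [/= Ac sc hc]; have [_ k] := h _ Ac;
  split=> //=; try (by rewrite -e); try (by rewrite e); apply/k => //;
  by rewrite size_cat size_map // e.
Qed.

Lemma same_type_eqtp M (A : set M) (s s' : seq M) : same_type A s s' <->
  size s = size s' /\ forall c, List.Forall A c -> eqtp (s ++ c) (s' ++ c).
Proof.
split=> -[e]; first by move/(tp_eqtp _ _ _ e) => h; split=> // c /h; rewrite map_id.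
by move=> h; split=> //; apply/(tp_eqtp _ _ _ e) => c /h; rewrite map_id.
Qed.

Lemma same_type_eqtp0 M (s s' : seq M) : same_type set0 s s' <-> eqtp s s'.
Proof.
rewrite same_type_eqtp; split=> [[e /(_ [::])]|h]; first by rewrite !cats0; apply.
split; first by case: h.
by case=> [|x c Ac]; rewrite ?cats0 //; case: (List.Forall_inv Ac).
Qed.

(** ** Connectives *)

Definition ftrue : formula L := FEx 0 (FEq 0 0).
Definition fimp phi psi := FNot (FAnd phi (FNot psi)).

Definition fall x phi := FNot (FEx x (FNot phi)).

Lemma sat_true M (v : nat -> M) : sat ftrue v.
Proof. by exists (v 0). Qed.

Lemma sat_all M x phi (v : nat -> M) :
  sat (fall x phi) v <-> forall a, sat phi (upd v x a).
Proof.
split=> [/= h a|h [a]]; last by apply; apply: h.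
by apply: contrapT => k; apply: h; exists a.
Qed.

(** ** Elementary maps *)

Lemma elementary_sat M N (f : M -> N) phi (v : nat -> M) :
  elementary f -> sat phi v <-> sat phi (f \o v).
Proof.
move=> /(_ phi) ef; pose n := (\sum_(y <- fv phi) y).+1.
have sc : scoped n phi.
  apply/allP => x xin; rewrite /n (big_rem x) //= ltnS; exact: leq_addr.
have := ef (mkseq v n); rewrite size_mkseq => /(_ sc).
rewrite (@holds_sat _ _ _ v) ?size_mkseq // => [->|i il]; last first.
  by rewrite nth_mkseq.
apply: holds_sat; rewrite ?size_map ?size_iota // => i il.
by rewrite (nth_map (v i)) ?size_mkseq //= nth_mkseq.
Qed.

Lemma elementary_inj M N (f : M -> N) : elementary f -> injective f.
Proof.
move=> ef a b e; have := (ef (FEq 0 1) [:: a; b] erefl).2.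
by rewrite /= => /(_ _ (fun=> a)); apply=> v /=.
Qed.

Lemma elementary_id M : elementary (@id M).
Proof. by apply/eqtp_elementary => s; rewrite map_id. Qed.

Lemma scoped0_sat M phi (v v' : nat -> M) : scoped 0 phi ->
  sat phi v -> sat phi v'.
Proof. by move=> sc; apply sat_ext => x /(allP sc). Qed.

Lemma elementary_models M N (f : M -> N) T :
  elementary f -> models M T <-> models N T.
Proof.
move=> ef; case: (carrier_inhabited M) => a; split=> h phi Tphi v.
  apply: (scoped0_sat (v := f \o (fun=> a))); first exact: (proj2_sig phi).
  by apply/(elementary_sat _ _ ef); apply: h.
by apply/(elementary_sat _ _ ef); apply: h.
Qed.

Lemma complete_sat T M N phi (v : nat -> M) (w : nat -> N) : complete T ->
  models M T -> models N T -> scoped 0 phi -> sat phi v -> sat phi w.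
Proof.
move=> [_ cT] mM mN sc h; have [|/(_ M mM v)//] := cT _ sc.
by move/(_ N mN w).
Qed.

Lemma isomorphic_elementary M N : isomorphic M N ->
  exists f : M -> N, bijective f /\ elementary f.
Proof.
move=> [f [bf hf]]; exists f; split=> //.
suff K phi (v : nat -> M) : sat phi v <-> sat phi (f \o v).
  move=> phi s sc; case: (carrier_inhabited M) => a.
  rewrite (holds_nth a) // (@holds_sat _ _ _ (f \o nth a s)) ?size_map //.
  by move=> i il; rewrite (nth_map a).
have [g fK gK] := bf.
elim: phi v => [x y|r t|psi IH|psi1 IH1 psi2 IH2|x psi IH] v /=.
- by split=> [->|/(can_inj fK)].
- rewrite hf; suff -> : map_tuple f (map_tuple v t) = map_tuple (f \o v) t by [].
  by apply: val_inj; rewrite /= -map_comp.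
- by rewrite IH.
- by rewrite IH1 IH2.
- have E a : f \o upd v x a =1 upd (f \o v) x (f a).
    by move=> y /=; rewrite !updE; case: ifP.
  split=> [[a]|[b]].
    by rewrite IH => h; exists (f a); move: h; apply sat_ext => y _; rewrite E.
  move=> h; exists (g b); apply/IH; move: h; apply sat_ext => y _.
  by rewrite E gK.
Qed.

Lemma elementary_interp M N (f : M -> N)
    (r : symbol L) (t : (arity r).-tuple M) :
  elementary f -> interp t <-> interp (map_tuple f t).
Proof.
move=> ef; have [a] := carrier_inhabited M.
have si : size (iota 0 (arity r)) == arity r by rewrite size_iota.
have E (K : structure L) (u : nat -> K) (s : (arity r).-tuple K) :
    (forall i, i < arity r -> u i = nth (u i) s i) -> map_tuple u (Tuple si) = s.
  move=> h; apply: val_inj => /=; apply: (@eq_from_nth _ (u 0)).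
    by rewrite size_map size_iota size_tuple.
  move=> i; rewrite size_map size_iota => il.
  rewrite (nth_map 0) ?size_iota // nth_iota // add0n h //.
  by apply: set_nth_default; rewrite size_tuple.
have := elementary_sat (FRel (Tuple si)) (nth a t) ef.
rewrite /= (E _ _ t); last by move=> i il; apply: set_nth_default; rewrite size_tuple.
rewrite (E _ _ (map_tuple f t)) // => i il /=.
by rewrite (nth_map a) ?size_tuple.
Qed.

End Basics.

(** * Formulas are countable *)

Section Countable.
Variable L : vocabulary.

Fixpoint formula_code (phi : formula L) : GenTree.tree (nat + symbol L) :=
  let var x := GenTree.Leaf (inl x) in
  match phi with
  | FEq x y => GenTree.Node 0 [:: var x; var y]
  | FRel r t => GenTree.Node 1 (GenTree.Leaf (inr r) :: map var t)
  | FNot psi => GenTree.Node 2 [:: formula_code psi]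
  | FAnd psi1 psi2 => GenTree.Node 3 [:: formula_code psi1; formula_code psi2]
  | FEx x psi => GenTree.Node 4 [:: var x; formula_code psi]
  end.

Lemma formula_code_inj : injective formula_code.
Proof.
elim=> [x y|r t|psi IH|psi1 IH1 psi2 IH2|x psi IH] [x' y'|r' t'|psi'|psi1' psi2'|x' psi'] //=.
- by case=> -> ->.
- case=> er; subst r' => /inj_map e; congr FRel; apply/val_inj/e.
  by move=> ? ? [].
- by case=> /IH ->.
- by case=> /IH1 -> /IH2 ->.
- by case=> -> /IH ->.
Qed.

Lemma formula_enum : exists e : nat -> formula L, forall phi, exists n, e n = phi.
Proof.
exists (fun n => if pselect (exists phi, pickle (formula_code phi) = n) is left h
  then projT1 (cid h) else ftrue L) => phi.
exists (pickle (formula_code phi)); case: pselect => [h|[]]; last by exists phi.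
by apply/formula_code_inj/(pcan_inj (@pickleK _)); case: (cid h).
Qed.

End Countable.

(** * Ultrapowers *)

Section Ultrapower.
Variables (L : vocabulary) (M : structure L).
Variables (U : set_system nat) (UU : UltraFilter U).

Let UP : ProperFilter U := @ultra_proper _ _ UU.

Lemma ultra_all (A : set nat) : (forall i, A i) -> U A.
Proof. by move=> h; apply: filterS filterT => i _; exact: h. Qed.

Lemma ultra_sub (A B : set nat) : (forall i, A i -> B i) -> U A -> U B.
Proof. exact: filterS. Qed.

Lemma ultra_sub2 (A B C : set nat) :
  (forall i, A i -> B i -> C i) -> U A -> U B -> U C.
Proof. by move=> h a b; apply: ultra_sub (filterI a b) => i []; exact: h. Qed.

Definition ueq (f : nat -> M) : set (nat -> M) := [set g | U [set i | f i = g i]].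

(** The elements are the classes modulo the ultrafilter themselves; relations
    are evaluated at representatives, whose choice is immaterial by [umk_eq].
    *)
Definition ucarrier := {C : set (nat -> M) | exists f, C = ueq f}.

Definition umk (f : nat -> M) : ucarrier := exist _ (ueq f) (ex_intro _ f erefl).

Definition urep (C : ucarrier) : nat -> M := projT1 (cid (svalP C)).

Lemma urepK C : umk (urep C) = C.
Proof.
rewrite /urep; case: cid => f; case: C => C /= h e; subst C.
by congr exist; exact: Prop_irrelevance.
Qed.

Lemma umk_eq f g : umk f = umk g <-> U [set i | f i = g i].
Proof.
split=> [/(congr1 sval)/= e|h].
  have : ueq g g by rewrite /ueq /=; exact: ultra_all.
  by rewrite -e.
have e : ueq f = ueq g.
  apply/seteqP; split=> k /= hk.
    by apply: (ultra_sub2 _ h hk) => i /= -> .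
  by apply: (ultra_sub2 _ h hk) => i /= -> .
rewrite /umk; move: (ex_intro _ _ _) (ex_intro _ _ _); rewrite e => p q.
by congr exist; exact: Prop_irrelevance.
Qed.

Definition ultrapower : structure L :=
  @Structure L ucarrier
    (let: inhabits a := carrier_inhabited M in inhabits (umk (fun=> a)))
    (fun r t => U [set i | interp (map_tuple (fun C => urep C i) t)]).

Lemma ultra_not (A : set nat) : U (~` A) <-> ~ U A.
Proof.
split=> [h k|h]; last by case: (in_ultra_setVsetC A UU).
have : U (A `&` ~` A) by exact: filterI.
by rewrite setICr => hk; case: UP => + _; apply.
Qed.

(** The theorem of Los *)
Lemma los phi (v : nat -> nat -> M) :
  sat (M := ultrapower) phi (fun x => umk (v x)) <->
  U [set i | sat phi (fun x => v x i)].
Proof.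
elim: phi v => [x y|r t|psi IH|psi1 IH1 psi2 IH2|x psi IH] v /=.
- exact: umk_eq.
- have K (s : seq nat) :
      U [set i | forall x, x \in s -> urep (umk (v x)) i = v x i].
    elim: s => [|x s IH]; first exact: ultra_all.
    have h : U [set i | urep (umk (v x)) i = v x i] by apply/umk_eq/urepK.
    apply: (ultra_sub2 _ h IH) => i /= e k y; rewrite inE => /orP[/eqP->//|]; exact: k.
  have E i : (forall x, x \in tval t -> urep (umk (v x)) i = v x i) ->
     map_tuple (fun C => urep C i) (map_tuple (fun x => umk (v x)) t) =
     map_tuple (fun x => v x i) t.
    move=> h; apply: val_inj => /=; rewrite -map_comp; apply/eq_in_map => x xt.
    exact: h.
  by split=> h; apply: (ultra_sub2 _ (K t) h) => i /= /E ->.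
- by rewrite IH -ultra_not.
- rewrite IH1 IH2; split=> [[]|h]; first exact: filterI.
  by split; apply: (ultra_sub _ h) => i [].
- have E (g : nat -> M) : upd (M := ultrapower) (fun x => umk (v x)) x (umk g) =
      (fun y => umk (if y == x then g else v y)).
    by apply/funext => y; rewrite !updE; case: ifP.
  split=> [[C]|h].
    rewrite -(urepK C) E IH; apply: ultra_sub => i /= hi; exists (urep C i).
    move: hi; apply sat_ext => y _; rewrite !updE; by case: ifP.
  have [a] := carrier_inhabited M.
  have /choice[g hg] : forall i, exists b, (exists a, sat psi (upd (fun x => v x i) x a)) ->
      sat psi (upd (fun x => v x i) x b).
    move=> i; case: (pselect (exists a, sat psi (upd (fun x => v x i) x a))).
      by case=> b hb; exists b.
    by move=> nh; exists a.
  exists (umk g); rewrite E IH; apply: (ultra_sub _ h) => i /= /hg.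
  by apply sat_ext => y _; rewrite !updE; case: ifP.
Qed.

Lemma ultrapower_diag : elementary (N := ultrapower) (fun a => umk (fun=> a)).
Proof.
move=> phi s sc; case: (carrier_inhabited M) => a.
rewrite (holds_nth a) // (@holds_sat _ ultrapower _ _ (fun x => umk (fun=> nth a s x)));
  rewrite ?size_map //; last by move=> i il; rewrite (nth_map a).
rewrite los; split=> [h|/filter_ex[]//]; exact: ultra_all.
Qed.

End Ultrapower.

(** In an ultrapower over a nonprincipal ultrafilter, all conditions are
    realised by the sequence whose [m]-th entry realises the first [m] ones.
    *)
Lemma compactness (L : vocabulary) (M : structure L) (n : nat)
    (phi : nat -> formula L) (c : nat -> seq M) :
  (forall i, scoped (n + size (c i)) (phi i)) ->
  (forall m, exists2 s : seq M, size s = n &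
     forall i, i <= m -> holds (phi i) (s ++ c i)) ->
  exists (N : structure L) (f : M -> N) (s : seq N), [/\ elementary f, size s = n &
     forall i, holds (phi i) (s ++ map f (c i))].
Proof.
move=> sc H; have [a0] := carrier_inhabited M.
have /choice[s hs] : forall m, exists s : seq M,
    size s = n /\ forall i, i <= m -> holds (phi i) (s ++ c i).
  by move=> m; have [s] := H m; exists s.
have [U [UU Uoo]] := ultraFilterLemma eventually_filter.
pose mk : (nat -> M) -> ultrapower M U := @umk L M U.
pose b := mkseq (fun j => mk (fun m => nth a0 (s m) j)) n.
exists (ultrapower M U), (fun a => mk (fun=> a)), b; split.
- exact: ultrapower_diag.
- by rewrite size_mkseq.
move=> i; pose v x m := nth a0 (s m ++ c i) x.
rewrite (@holds_sat _ (ultrapower M U) _ _ (fun x => mk (v x))) ?size_cat ?size_map ?size_iota //.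
  rewrite los; apply: (@filterS _ U _ [set m | i <= m]) => [m /= im|].
    have [sm hm] := hs m.
    by move: (hm i im); rewrite (holds_nth a0) ?size_cat ?sm.
  by apply: Uoo; exists i.
move=> j jl; rewrite nth_cat size_mkseq; case: ltnP => jn.
  rewrite nth_mkseq //; congr mk; apply/funext => m.
  by rewrite /v nth_cat (hs m).1 jn.
rewrite (nth_map a0) ?ltn_subLR //; congr mk; apply/funext => m.
by rewrite /v nth_cat (hs m).1 ltnNge jn.
Qed.

(** * Elementary substructures *)

Section Substructure.
Variable L : vocabulary.
Implicit Types (M N : structure L) (phi psi : formula L).

Definition substructure M (S : set M) (S0 : S !=set0) : structure L :=
  @Structure L {x : M | S x}
    (let: ex_intro x Sx := S0 in inhabits (exist _ x Sx))
    (fun r t => interp (map_tuple sval t)).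

Lemma tarski_vaught M (S : set M) (S0 : S !=set0) :
  (forall phi c, List.Forall S c -> scoped (size c).+1 phi ->
     (exists a, holds phi (a :: c)) -> exists a, S a /\ holds phi (a :: c)) ->
  elementary (M := substructure S0) sval.
Proof.
move=> TV.
suff K phi (v : nat -> substructure S0) : sat phi v <-> sat phi (sval \o v).
  move=> phi s sc; case: (carrier_inhabited (substructure S0)) => a.
  rewrite (holds_nth a) // (@holds_sat _ _ _ _ (sval \o nth a s)) ?size_map //.
  by move=> i il; rewrite (nth_map a).
elim: phi v => [x y|r t|psi IH|psi1 IH1 psi2 IH2|x psi IH] v /=.
- split=> [->//|]; case: (v x) (v y) => [a Sa] [b Sb] /= e; subst b.
  by congr exist; exact: Prop_irrelevance.
- suff -> : map_tuple sval (map_tuple v t) = map_tuple (sval \o v) t by [].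
  by apply: val_inj; rewrite /= -map_comp.
- by rewrite IH.
- by rewrite IH1 IH2.
- have E a : sval \o upd v x a =1 upd (sval \o v) x (sval a).
    by move=> y /=; rewrite !updE; case: ifP.
  split=> [[a]|[b hb]].
    by rewrite IH => h; exists (sval a); move: h; apply sat_ext => y _; rewrite E.
  pose n := (\sum_(y <- fv psi) y).+1.
  have nP y : y \in fv psi -> y < n.
    by move=> yin; rewrite /n (big_rem y) //= ltnS leq_addr.
  pose c := mkseq (sval \o v) n.
  pose psi' := subst (fun y => if y == x then 0 else y.+1) psi.
  have sc : scoped (size c).+1 psi'.
    apply/allP => _ /fv_subst/mapP[y yin ->]; rewrite size_mkseq.
    by case: ifP => // _; rewrite ltnS nP.
  have P a : holds psi' (a :: c) <-> sat psi (upd (sval \o v) x a).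
    rewrite (holds_nth a) // sat_subst; apply sat_ext => y yin /=.
    by rewrite updE; case: ifP => //= _; rewrite nth_mkseq ?nP.
  have Sc : List.Forall S c.
    apply/ForallP => y /(In_nth (sval (v 0)))[i]; rewrite size_mkseq => il <-.
    by rewrite nth_mkseq //=; apply: svalP.
  have [|a [Sa /P ha]] := TV psi' c Sc sc; first by exists b; apply/P.
  exists (exist _ a Sa); apply/IH; move: ha; apply sat_ext => y _.
  by rewrite E.
Qed.

(** Tarski-Vaught closure carried out one element at a time, so that a property
    of the finite sets of elements chosen so far can be maintained. *)
Lemma countable_elementary M (I : seq M -> Prop) (s0 : seq M) :
  I s0 ->
  (forall s phi idx (a0 : M), I s -> all (fun i => i < size s) idx ->
     scoped (size idx).+1 phi ->
     (exists a, holds phi (a :: [seq nth a0 s i | i <- idx])) ->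
     exists a, holds phi (a :: [seq nth a0 s i | i <- idx]) /\ I (rcons s a)) ->
  exists (N : structure L) (f : N -> M),
    [/\ elementary f, countable [set: N], exists t, map f t = s0
      & forall t : seq N, exists s, I s /\ forall x, List.In x t -> List.In (f x) s].
Proof.
move=> I0 step; have [a0] := carrier_inhabited M.
pose ok s (t : formula L * seq nat) a :=
  holds t.1 (a :: [seq nth a0 s i | i <- t.2]).
pose legal (s : seq M) (t : formula L * seq nat) :=
  [&& all (fun i => i < size s) t.2 & scoped (size t.2).+1 t.1].
have /choice[nxt hnxt] : forall st, exists s', let: (s, t) := st in I s -> [/\ I s',
    exists w, s' = s ++ w &
    legal s t -> (exists a, ok s t a) -> exists a, List.In a s' /\ ok s t a].
  move=> [s t]; case: (pselect (legal s t /\ exists a, ok s t a)); last first.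
    by move=> nh; exists s => Is; split=> //; [exists [::]; rewrite cats0|
      move=> h1 h2; case: nh].
  case=> /andP[h1 h2] h3; case: (pselect (I s)) => Is; last by exists s.
  have [a [ha Ia]] := step s _ _ a0 Is h1 h2 h3.
  exists (rcons s a) => _; split=> //; first by exists [:: a]; rewrite cats1.
  move=> _ _; exists a; split=> //.
  by rewrite -cats1; apply/In_cat; right; left.
have [e he] := formula_enum L.
pose task k : formula L * seq nat :=
  if (unpickle k : option (nat * seq nat * nat)) is Some (i, idx, _) then (e i, idx) else (e 0, [::]).
pose st := fix st k := if k is k'.+1 then nxt (st k', task k') else s0.
have Ist k : I (st k) by elim: k => //= k /(hnxt (st k, task k))[].
have stS k : exists w, st k.+1 = st k ++ w by case: (hnxt (st k, task k) (Ist k)).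
have mono i j : i <= j -> exists w, st j = st i ++ w.
  move=> /subnKC <-; elim: (j - i) => [|d [w hw]].
    by exists [::]; rewrite addn0 cats0.
  have [w' hw'] := stS (i + d); exists (w ++ w').
  by rewrite addnS hw' hw catA.
pose S := [set x | exists k, List.In x (st k)].
have late (c : seq M) : List.Forall S c -> exists k, forall x, List.In x c -> List.In x (st k).
  elim: c => [|x c IH] Sc; first by exists 0.
  have [k1 h1] := List.Forall_inv Sc.
  have [k2 h2] := IH (List.Forall_inv_tail Sc).
  have [w1 e1] := mono _ _ (leq_maxl k1 k2).
  have [w2 e2] := mono _ _ (leq_maxr k1 k2).
  exists (maxn k1 k2) => y /= [<-|yc]; first by rewrite e1; apply/In_cat; left.
  by rewrite e2; apply/In_cat; left; apply: h2.
have TV phi c : List.Forall S c -> scoped (size c).+1 phi ->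
     (exists a, holds phi (a :: c)) -> exists a, S a /\ holds phi (a :: c).
  move=> Sc sc [a ha]; have [k hk] := late c Sc.
  have [i0 ei0] := he phi.
  have [idx [hidx ec]] : exists idx, all (fun i => i < size (st k)) idx /\
      c = [seq nth a0 (st k) i | i <- idx].
    elim: c hk {Sc sc ha} => [|x c IH] hk; first by exists [::].
    have [i il ei] := In_nth a0 (hk x (or_introl erefl)).
    have [|idx [h1 h2]] := IH; first by move=> y yc; apply: hk; right.
    by exists (i :: idx); rewrite /= il h1 ei -h2.
  (* The third component of a task makes it recur at arbitrarily late stages,
     when the parameters it refers to have been chosen. *)
  have gi : injective (fun j : nat => pickle ((i0, idx, j) : nat * seq nat * nat)).
    move=> x y /= e1; have e2 := pcan_inj (@pickleK (nat * seq nat * nat)%type) e1.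
    by case: e2.
  have [j kj] := inj_unbounded k gi; set l := pickle _ in kj.
  have tl : task l = (phi, idx) by rewrite /task /l pickleK ei0.
  have [w ew] := mono _ _ kj.
  have ec' : [seq nth a0 (st l) i | i <- idx] = c.
    rewrite ec; apply/eq_in_map => i /(allP hidx) il.
    by rewrite ew nth_cat il.
  have [_ _] := hnxt (st l, task l) (Ist l).
  rewrite tl /legal /ok /= ec' => h.
  have [||b [bl hb]] := h; last 1 first.
  - by exists b; split=> //; exists l.+1; rewrite /= tl.
  - apply/andP; split; last by rewrite ec size_map in sc.
    apply/allP => i /(allP hidx) il; rewrite ew size_cat.
    exact: leq_trans il (leq_addr _ _).
  - by exists a.
have S0 : S !=set0.
  have [|a [Sa _]] := TV (ftrue L) [::] (List.Forall_nil _) erefl; last by exists a.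
  by exists a0 => v; apply: sat_true.
exists (substructure S0), sval; split.
- exact: tarski_vaught.
- have /choice[k hk] : forall x : substructure S0, exists ki : nat * nat,
      nth a0 (st ki.1) ki.2 = sval x.
    move=> [x [k kx]]; have [i _ ei] := In_nth a0 kx.
    by exists (k, i).
  apply: (inj_countable (f := k)) => x y exy.
  have : sval x = sval y by rewrite -!hk exy.
  case: x y {exy} => [x Sx] [y Sy] /= exy; subst y.
  by congr exist; exact: Prop_irrelevance.
- have Ss x : List.In x s0 -> S x by move=> xs; exists 0.
  elim: (s0) Ss => [|x s IH] Ss; first by exists [::].
  have [|t <-] := IH; first by move=> y ys; apply: Ss; right.
  by exists (exist _ x (Ss x (or_introl erefl)) :: t).
- move=> t; have [|k hk] := late (map sval t).
    by apply/ForallP => _ /List.in_map_iff[x [<- _]]; exact: svalP.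
  by exists (st k); split=> // x xt; apply/hk/List.in_map.
Qed.

Lemma lowenheim_skolem M (s0 : seq M) :
  exists (N : structure L) (f : N -> M),
    [/\ elementary f, countable [set: N] & exists t, map f t = s0].
Proof.
have [|s phi idx a0 _ _ _ [a ha]|N [f [? ? ? _]]] :=
  @countable_elementary M (fun=> True) s0 => //.
  by exists a.
by exists N, f.
Qed.
End Substructure.

(** * Splitting definable sets *)

(** ** Definable sets with parameters *)

Section DefinableSets.
Variable L : vocabulary.
Implicit Types (M N : structure L) (phi psi : formula L).

Lemma holds_cons M phi (a : M) c (v : nat -> M) : scoped (size c).+1 phi ->
  (forall i, i < size c -> v i.+1 = nth a c i) ->
  holds phi (a :: c) <-> sat phi (upd v 0 a).
Proof.
move=> sc E; apply: holds_sat => // -[|i] //= il; rewrite updE /= E //.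
exact: set_nth_default.
Qed.

Lemma ex_elementary M N (f : M -> N) phi c (u : N) :
  elementary f -> scoped (size c).+1 phi -> holds phi (u :: map f c) ->
  exists a, holds phi (a :: c).
Proof.
move=> ef sc; have [a0] := carrier_inhabited M.
pose v := nth a0 (a0 :: c).
rewrite (@holds_cons _ _ _ _ (f \o v)) ?size_map // => [h|i il]; last first.
  by rewrite /= (nth_map a0).
have /(elementary_sat (FEx 0 phi) v ef)[a ha] : sat (FEx 0 phi) (f \o v) by exists u.
exists a; apply/(holds_cons (v := v)) => // i il; exact: set_nth_default.
Qed.

Definition meetf phi (m : nat) psi (n : nat) : formula L :=
  FAnd phi (subst (nth 0 (0 :: iota m.+1 n)) psi).

Lemma scoped_meetf phi m psi n : scoped m.+1 phi -> scoped n.+1 psi ->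
  scoped (m + n).+1 (meetf phi m psi n).
Proof.
move=> sp sq; rewrite /scoped /= all_cat; apply/andP; split.
  by apply: scopedW sp; rewrite ltnS leq_addr.
apply: scoped_sub; rewrite /= ?size_iota //.
by apply/allP => i; rewrite mem_iota addSn => /andP[].
Qed.

Lemma holds_meetf M phi psi (a : M) c d :
  scoped (size c).+1 phi -> scoped (size d).+1 psi ->
  holds (meetf phi (size c) psi (size d)) (a :: c ++ d) <->
  holds phi (a :: c) /\ holds psi (a :: d).
Proof.
move=> sp sq; rewrite holds_and (@holds_sub _ _ _ _ _ a) /= ?size_iota //; last first.
  by apply/allP => i; rewrite mem_iota size_cat addSn => /andP[].
have -> : [seq nth a (a :: c ++ d) i | i <- iota (size c).+1 (size d)] = d.
  apply: (@eq_from_nth _ a); rewrite size_map size_iota // => i il.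
  rewrite (nth_map 0) ?size_iota // nth_iota //= nth_cat ltnNge leq_addr /=.
  by rewrite addKn.
suff -> : holds phi (a :: c ++ d) <-> holds phi (a :: c) by [].
rewrite (holds_nth a); last first.
  by apply: scopedW sp; rewrite /= ltnS size_cat leq_addr.
symmetry; apply: holds_sat => // -[|i] //= il.
by rewrite nth_cat -ltnS il; apply: set_nth_default.
Qed.

End DefinableSets.

Section Stable.
Variable L : vocabulary.
Implicit Types (M N : structure L) (phi psi : formula L) (T : theory L).

(** A tree of definable sets whose branches are all realised, by compactness,
    would give as many types as there are branches. *)
Lemma no_splitting_tree T M (K : formula L -> seq M -> Prop) :
  omega_stable T -> models M T -> infinite_set [set: M] ->
  (forall phi c, K phi c ->
     scoped (size c).+1 phi /\ exists a, holds phi (a :: c)) ->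
  (forall phi c, K phi c -> exists phi1 c1 phi2 c2,
     [/\ K phi1 c1, K phi2 c2,
         forall a, holds phi1 (a :: c1) -> holds phi (a :: c),
         forall a, holds phi2 (a :: c2) -> holds phi (a :: c)
       & forall a, holds phi1 (a :: c1) -> ~ holds phi2 (a :: c2)]) ->
  forall phi c, ~ K phi c.
Proof.
move=> ws mM iM Kne Ksplit phi0 c0 K0.
have [a0] := carrier_inhabited M.
pose node := (formula L * seq M)%type; pose root : node := (phi0, c0).
pose KK (n : node) := K n.1 n.2; pose H (n : node) a := holds n.1 (a :: n.2).
have /choice[ch hch] : forall n : node, exists f : bool -> node, KK n ->
    [/\ KK (f true), KK (f false), forall b a, H (f b) a -> H n a
      & forall a, H (f true) a -> ~ H (f false) a].
  move=> [phi c]; case: (pselect (K phi c)) => [Kn|]; last by exists (fun=> root).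
  have [phi1 [c1 [phi2 [c2 [k1 k2 h1 h2 h3]]]]] := Ksplit _ _ Kn.
  exists (fun b : bool => if b then (phi1, c1) else (phi2, c2)) => _; split=> //.
  by case=> a; [exact: h1|exact: h2].
pose nodeS s := foldl (fun n b => ch n b) root s.
pose nd (b : nat -> bool) n := nodeS (mkseq b n).
have ndS b n : nd b n.+1 = ch (nd b n) (b n).
  by rewrite /nd /nodeS mkseqS -cats1 foldl_cat.
have Knd b n : KK (nd b n).
  by elim: n => // n IH; rewrite ndS; have [] := hch _ IH; case: (b n).
have Hmono b i j : i <= j -> forall a, H (nd b j) a -> H (nd b i) a.
  move=> /subnKC <-; elim: (j - i) => [|d IH] a; rewrite ?addn0 //.
  rewrite addnS ndS => h; apply: IH.
  by have [_ _ + _] := hch _ (Knd b (i + d)); apply; exact: h.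
(* The set of parameters consists of those of all nodes of the tree; the range
   of [g] is added to make it infinite. *)
have [g [gi _]] := infinite_inj iM.
pose h (x : (seq bool * nat) + nat) : M :=
  match x with inl (s, i) => nth a0 (nodeS s).2 i | inr n => g n end.
pose A := range h.
have Anat : A #= [set: nat].
  apply/eq_card_nat.
    exact: (@card_le_trans _ _ _ [set: (seq bool * nat + nat)%type] _ [set: nat]
              (card_image_le h setT) (countableP _)).
  by apply: (inj_infinite gi) => n; exists (inr n).
have And b n : List.Forall A (nd b n).2.
  by apply/ForallP => x /(In_nth a0)[i _ <-]; exists (inl (mkseq b n, i)).
have /choice[p hp] : forall b, exists p, types A 1 p /\ forall n, p (nd b n).
  move=> b.
  have [||N [f [s [ef ss hs]]]] := @compactness L M 1 (fun n => (nd b n).1)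
     (fun n => (nd b n).2).
  - by move=> n; have [] := Kne _ _ (Knd b n).
  - move=> m; have [_ [a ha]] := Kne _ _ (Knd b m); exists [:: a] => // i im.
    exact: (Hmono b i m im a ha).
  exists (tp f A s); split; first by exists N, f, s.
  move=> n; split; [exact: And| |exact: hs].
  by rewrite ss; have [] := Kne _ _ (Knd b n).
have pinj : injective p.
  move=> b b' e; apply: contrapT => ne.
  have [n [nbn eqn]] : exists n, b n <> b' n /\ forall i, i < n -> b i = b' i.
    have ex : exists n, b n != b' n.
      apply: contrapT => nex; apply: ne; apply/funext => n.
      by apply/eqP/negP => /negP nn; apply: nex; exists n.
    exists (ex_minn ex); case: ex_minnP => m /eqP mn mm; split=> // i im.
    by apply/eqP; apply: contraTT im => /mm; rewrite -leqNgt.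
  have en : nd b n = nd b' n.
    rewrite /nd; congr nodeS; apply/eq_in_map => i; rewrite mem_iota => il.
    by apply: eqn; move: il; rewrite add0n.
  have [[tb hb] [_ hb']] := (hp b, hp b').
  have := hb n.+1; have := hb' n.+1; rewrite -e !ndS -en.
  case: tb => N [f [s [ef ss ->]]] [/= Ac' sc' hc'] [/= Ac sc hc].
  have [_ _ _ dis] := hch _ (Knd b n).
  set n1 := ch (nd b n) (b n) in hc sc; set n2 := ch (nd b n) (b' n) in hc' sc'.
  case: s ss hc hc' sc sc' => [|u [|//]] // _ hc hc' sc sc'.
  have [a] : exists a, holds (meetf n1.1 (size n1.2) n2.1 (size n2.2))
                            (a :: n1.2 ++ n2.2).
    apply: (ex_elementary (f := f) (u := u)) => //.
      by rewrite size_cat; exact: scoped_meetf.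
    rewrite map_cat -(size_map f n1.2) -(size_map f n2.2).
    by apply/holds_meetf; rewrite ?size_map.
  move=> /holds_meetf-/(_ sc sc')[]; rewrite -/(H n1 a) -/(H n2 a) /n1 /n2.
  case: (b n) (b' n) nbn => [] [] // _ h1 h2; first exact: dis h1 h2.
  exact: dis h2 h1.
apply: (cantor pinj (A := types A 1)); first by move=> b; case: (hp b).
have /card_eqPle[//] := ws M A mM Anat 1 erefl.
Qed.

End Stable.

(** * Types in an omega-stable, omega-categorical theory *)

Section Formulas.
Variable L : vocabulary.
Implicit Types (M N : structure L) (phi psi : formula L) (T : theory L).

Lemma sat_exists_vars M (xs : seq nat) phi (v : nat -> M) :
  sat (exists_vars xs phi) v <->
  exists w, (forall y, y \notin xs -> w y = v y) /\ sat phi w.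
Proof.
elim: xs v => [|x xs IH] v /=.
  split=> [h|[w [e]]]; first by exists v.
  by apply sat_ext => y _; rewrite e.
split=> [[a /IH[w [e h]]]|[w [e h]]].
  exists w; split=> // y; rewrite inE negb_or => /andP[yx yxs].
  by rewrite e // updE (negPf yx).
exists (w x); apply/IH; exists w; split=> // y yxs; rewrite updE.
by case: eqP => [->//|/eqP yx]; rewrite e // inE negb_or yx.
Qed.

Lemma fv_exists_vars (xs : seq nat) phi :
  fv (exists_vars xs phi) =i [seq y <- fv phi | y \notin xs].
Proof.
elim: xs => [|x xs IH] y /=; first by rewrite mem_filter.
by rewrite !mem_filter IH mem_filter inE negb_or andbA.
Qed.

Definition fandl (l : seq (formula L)) := foldr (@FAnd L) (ftrue L) l.

Lemma sat_andl M (l : seq (formula L)) (v : nat -> M) :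
  sat (fandl l) v <-> forall phi, List.In phi l -> sat phi v.
Proof.
elim: l => [|phi l IH] /=; first by split=> // _; exists (v 0).
rewrite IH; split=> [[h k] psi [<-//|]|h]; first exact: k.
by split=> [|psi pl]; apply: h; [left|right].
Qed.

Lemma fv_andl (l : seq (formula L)) x :
  x \in fv (fandl l) -> exists2 phi, List.In phi l & x \in fv phi.
Proof.
elim: l => //= phi l IH; rewrite mem_cat => /orP[xp|/IH[psi]].
  by exists phi; [left|].
by exists psi; [right|].
Qed.

(** Quantifies the head of a tuple: see [holds_exf]. *)
Definition exf phi : formula L := subst predn (FEx 0 phi).

Lemma scoped_exf n phi : scoped n.+1 phi -> scoped n (exf phi).
Proof.
move=> sc; apply/allP => x /fv_subst/mapP[[|y]]; rewrite mem_filter //=.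
by move=> /(allP sc) ys ->.
Qed.

Lemma holds_exf M phi (s : seq M) : scoped (size s).+1 phi ->
  holds (exf phi) s <-> exists a, holds phi (a :: s).
Proof.
move=> sc; have [a0] := carrier_inhabited M.
rewrite (holds_nth a0) ?scoped_exf // sat_subst /=.
have E a : holds phi (a :: s) <-> sat phi (upd (nth a0 s \o predn) 0 a).
  by apply: holds_cons => // i il; apply: set_nth_default.
by split=> -[a ha]; exists a; apply/E.
Qed.

Lemma eqtp_ex M N (s : seq M) (s' : seq N) phi : eqtp s s' ->
  scoped (size s).+1 phi ->
  (exists a, holds phi (a :: s)) -> exists a, holds phi (a :: s').
Proof.
move=> [e h] sc; rewrite -!holds_exf -?e //.
by apply: (proj1 (h _ _)); exact: scoped_exf.
Qed.

Definition freshf (n : nat) : formula L :=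
  fandl [seq FNot (FEq 0 i.+1) | i <- iota 0 n].

Lemma scoped_fresh n : scoped n.+1 (freshf n).
Proof.
apply/allP => x /fv_andl[_ /In_map_iota[i il ->]].
by rewrite !inE => /orP[] /eqP->.
Qed.

Lemma holds_fresh M (a : M) s : holds (freshf (size s)) (a :: s) <-> ~ List.In a s.
Proof.
rewrite (holds_nth a) ?scoped_fresh // sat_andl; split=> [h ain|h phi].
  have [i il e] := In_nth a ain.
  apply: (h (FNot (FEq 0 i.+1))) => //.
  by apply/In_map_iota; exists i.
move=> /In_map_iota[i il ->] /= e.
by apply: h; rewrite [X in List.In X]e; exact: nth_In.
Qed.

Lemma elementary_infinite M N (f : M -> N) : elementary f ->
  infinite_set [set: N] -> infinite_set [set: M].
Proof.
move=> ef iN /finite_list[t ht].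
have [u [_ ut]] := infinite_fresh (map f t) iN.
have [||a] := @ex_elementary _ _ _ f (freshf (size t)) t u ef.
- exact: scoped_fresh.
- by rewrite -(size_map f t); apply/holds_fresh.
by move/holds_fresh; apply; apply: ht.
Qed.

Lemma eqtp_In M N (a : M) s (a' : N) s' : eqtp (a :: s) (a' :: s') ->
  List.In a s <-> List.In a' s'.
Proof.
move=> [[e] h]; have := h (freshf (size s)) (scoped_fresh _).
by rewrite holds_fresh e holds_fresh => K; split=> k; apply: contrapT => /K.
Qed.

Lemma eqtp_cons2 M N (x y : M) s (x' y' : N) s' : eqtp (x :: y :: s) (x' :: y' :: s') ->
  [/\ eqtp [:: x; y] [:: x'; y'], eqtp (x :: s) (x' :: s') & eqtp (y :: s) (y' :: s')].
Proof.
move=> h; have [[es] _] := h.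
have sub (idx : seq nat) := eqtp_sub x x' (idx := idx) h.
have tl (X : Type) (z : X) (p q : X) (t : seq X) :
    [seq nth z (p :: q :: t) i | i <- iota 2 (size t)] = t.
  rewrite (iotaDl 2 0) -map_comp; apply: (@eq_from_nth _ z).
    by rewrite size_map size_iota.
  move=> i; rewrite size_map size_iota => il.
  by rewrite (nth_map 0) ?size_iota // nth_iota.
have hi : all (fun i => i < (size s).+2) (iota 2 (size s)).
  by apply/allP => i; rewrite mem_iota add2n => /andP[].
split; first by apply: (sub [:: 0; 1]).
  by have := sub (0 :: iota 2 (size s)); rewrite /= tl es tl -es; apply.
by have := sub (1 :: iota 2 (size s)); rewrite /= tl es tl -es; apply.
Qed.

Lemma eqtp_holds M N phi (s : seq M) (s' : seq N) : eqtp s s' ->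
  scoped (size s) phi -> holds phi s -> holds phi s'.
Proof. by move=> [_ h] /h ->. Qed.

Lemma eqtp_rotate M N (s : seq M) (s' : seq N) x y :
  eqtp (s ++ [:: x]) (s' ++ [:: y]) -> eqtp (x :: s) (y :: s').
Proof.
move=> h; have es : size s = size s'.
  by case: h => + _; rewrite !size_cat => /addIn.
have E (X : Type) (z : X) (t : seq X) :
    [seq nth z (t ++ [:: z]) i | i <- size t :: iota 0 (size t)] = z :: t.
  rewrite /= nth_cat ltnn subnn /=; congr cons.
  apply: (@eq_from_nth _ z); rewrite size_map size_iota // => i il.
  by rewrite (nth_map 0) ?size_iota // nth_iota // add0n nth_cat il.
have := eqtp_sub x y (idx := size s :: iota 0 (size s)) h.
have e1 := E M x s; have e2 := E N y s'; rewrite -es in e2.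
rewrite e1 e2; apply; rewrite /= size_cat addn1 ltnSn /=.
by apply/allP => i; rewrite mem_iota => /andP[_ il]; rewrite ltnW.
Qed.

(** ** Isolated types *)

Definition isolates M phi (s : seq M) : Prop :=
  [/\ scoped (size s) phi, holds phi s &
      forall s' : seq M, size s' = size s -> holds phi s' -> eqtp s' s].

Definition isolated M (s : seq M) : Prop := exists phi, isolates phi s.

(** A subtuple is described by the existence of a tuple that satisfies an
    isolating formula for the larger one. *)
Lemma isolated_sub M (s : seq M) (a : M) (idx : seq nat) :
  isolated s -> all (fun i => i < size s) idx ->
  isolated [seq nth a s i | i <- idx].
Proof.
move=> [phi [sc h iso]] hi; set t := map _ _.
pose m := size idx; pose n := size s.
pose eqs := [seq FEq (m + nth 0 idx j) j : formula L | j <- iota 0 m].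
pose th := exists_vars (iota m n) (FAnd (subst (addn m) phi) (fandl eqs)).
have st : size t = m by rewrite size_map.
have fth : scoped m th.
  apply/allP => x; rewrite fv_exists_vars mem_filter mem_iota => /andP[xn xin].
  suff /allP/(_ x xin) xmn : scoped (m + n) (FAnd (subst (addn m) phi) (fandl eqs)).
    by move: xn; rewrite negb_and xmn orbF -ltnNge.
  rewrite /scoped /= all_cat; apply/andP; split.
    apply/allP => _ /fv_subst/mapP[y /(allP sc) yn ->]; by rewrite ltn_add2l.
  apply/allP => y /fv_andl[_ /In_map_iota[j jm ->]].
  rewrite !inE => /orP[] /eqP->; last exact: leq_trans jm (leq_addr _ _).
  by rewrite ltn_add2l; apply: (allP hi); apply: mem_nth.
have key (t' : seq M) : size t' = m -> holds th t' <->
    exists s', [/\ size s' = n, holds phi s' & t' = [seq nth a s' i | i <- idx]].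
  move=> st'; rewrite (holds_nth a) ?st' // sat_exists_vars; split.
    case=> w [ew [/sat_subst hp /sat_andl he]].
    have wm j : j < m -> w j = nth a t' j.
      by move=> jm; apply: ew; rewrite mem_iota leqNgt jm.
    exists (mkseq (fun i => w (m + i)) n); rewrite size_mkseq; split=> //.
      rewrite (@holds_sat _ _ _ _ (w \o addn m)) ?size_mkseq // => i il.
      by rewrite nth_mkseq.
    apply: (@eq_from_nth _ a); rewrite st' ?size_map // => j jm.
    rewrite (nth_map 0) // nth_mkseq; last by apply: (allP hi); apply: mem_nth.
    have : sat (FEq (m + nth 0 idx j) j) w.
      by apply: he; apply/In_map_iota; exists j.
    by move=> /= ->; rewrite wm.
  case=> s' [ss' hs' et'].
  exists (fun x => if x \in iota m n then nth a s' (x - m) else nth a t' x).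
  split=> [y /negPf -> //|]; split.
    apply/sat_subst; move: hs'; apply holds_sat; rewrite ?ss' // => i il /=.
    rewrite mem_iota leq_addr ltn_add2l il addKn /=.
    by apply: set_nth_default; rewrite ss'.
  apply/sat_andl => _ /In_map_iota[j jm ->].
  have jn : nth 0 idx j < n by apply: (allP hi); apply: mem_nth.
  by rewrite /= !mem_iota leq_addr ltn_add2l jn addKn leqNgt jm /= et' (nth_map 0).
exists th; split; rewrite ?st //.
  by apply/key => //; exists s.
move=> t' st' /key-/(_ st')[s' [ss' hs' ->]].
by apply: eqtp_sub; [exact: iso|rewrite ss'].
Qed.

(** That [psi] determines the type of its solutions over [s] is part of the
    type of [s], hence true over every realisation of that type. *)
Lemma isolated_cons M (s : seq M) psi (a : M) :
  isolated s -> scoped (size s).+1 psi -> holds psi (a :: s) ->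
  (forall b, holds psi (b :: s) -> eqtp (b :: s) (a :: s)) ->
  isolated (a :: s).
Proof.
move=> [phi [sc h iso]] sp ha com.
have sc' : scoped (size s).+1 (subst S phi).
  by apply/allP => _ /fv_subst/mapP[y /(allP sc) ys ->].
have shift b (s' : seq M) : size s' = size s ->
    holds (subst S phi) (b :: s') <-> holds phi s'.
  move=> e; rewrite (holds_nth b) /= ?e // sat_subst.
  by symmetry; apply: holds_sat; rewrite ?e // => i il /=; apply: set_nth_default; rewrite -?e // e.
exists (FAnd (subst S phi) psi); split.
- by rewrite /scoped /= all_cat; apply/andP.
- by apply/holds_and; split=> //; apply/shift.
move=> [|b s'] //= [es] /holds_and[/shift-/(_ es)/(iso _ es) ss hb].
apply: contrapT => /eqtp_not[|chi [schi hchi nchi]]; first by rewrite /= es.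
have [||c /holds_and[/com cs hc]] := @eqtp_ex _ _ s' s (FAnd psi chi) ss.
- by rewrite /scoped /= all_cat es; apply/andP; split=> //; rewrite -es.
- by exists b; apply/holds_and.
apply: nchi.
by case: cs => _ /(_ chi) K; apply/K; rewrite //= -es.
Qed.

Lemma isolated_elementary M N (f : M -> N) (s : seq M) : elementary f ->
  isolated (map f s) -> isolated s.
Proof.
move=> /eqtp_elementary ef [phi []]; rewrite size_map => sc h iso.
have K t : size t = size s -> holds phi t <-> holds phi (map f t).
  by move=> e; have [_ k] := ef t; apply: k; rewrite e.
exists phi; split=> //; first exact/K.
move=> s' e /K-/(_ e) /iso; rewrite !size_map => /(_ e) h'.
by apply: eqtp_trans (ef s') (eqtp_trans h' (eqtp_sym (ef s))).
Qed.

Section RyllNardzewski.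
Variables (T : theory L) (M : structure L).
Hypotheses (ws : omega_stable T) (wc : omega_categorical T).
Hypotheses (mM : models M T) (iM : infinite_set [set: M])
           (cM : countable [set: M]).

(** If no formula below [phi] determined the type of its solutions over [s],
    then [phi] could be split again and again, against [no_splitting_tree]. *)
Lemma isolated_dense (s : seq M) phi : scoped (size s).+1 phi ->
  (exists a, holds phi (a :: s)) ->
  exists psi a, [/\ scoped (size s).+1 psi, holds psi (a :: s),
    holds phi (a :: s) &
    forall b, holds psi (b :: s) -> eqtp (b :: s) (a :: s)].
Proof.
move=> sc ex; apply: contrapT => H.
pose K psi c := [/\ c = s, scoped (size s).+1 psi,
  exists a, holds psi (a :: s) & forall a, holds psi (a :: s) -> holds phi (a :: s)].
apply: (@no_splitting_tree _ T M K ws mM iM _ _ phi s) => //.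
  by move=> psi c [-> ].
move=> psi c [-> sp [a ha] sub].
have [b [hb nab]] : exists b, holds psi (b :: s) /\ ~ eqtp (b :: s) (a :: s).
  apply: contrapT => nb; apply: H; exists psi, a; split=> //; first exact: sub.
  by move=> b hb; apply: contrapT => ne; apply: nb; exists b.
have [//|chi [schi hchi nchi]] := eqtp_not _ nab.
have s1 : scoped (size s).+1 (FAnd psi chi) by rewrite /scoped /= all_cat; apply/andP.
have s2 : scoped (size s).+1 (FAnd psi (FNot chi)) by [].
exists (FAnd psi chi), s, (FAnd psi (FNot chi)), s; split.
- split=> //; first by exists b; apply/holds_and.
  by move=> x /holds_and[/sub].
- split=> //; first by exists a; apply/holds_and; split=> //; apply/holds_not.
  by move=> x /holds_and[/sub].
- by move=> x /holds_and[].
- by move=> x /holds_and[].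
- by move=> x /holds_and[_ h] /holds_and[_ /holds_not-/(_ schi)].
Qed.

(** By [isolated_dense], a countable elementary substructure can be built from
    tuples of isolated type only. It is isomorphic to [M]. *)
Lemma all_isolated (s : seq M) : isolated s.
Proof.
have [|t phi idx a0 it hi sc ex|N [f [ef cN _ hN]]] :=
    @countable_elementary L M (@isolated M) [::].
- exists (ftrue L); split=> // [v|[|//] _ _]; first exact: sat_true.
  exact: eqtp_refl.
- pose idx' := 0 :: map S idx.
  have hi' : all (fun i => i < (size t).+1) idx' by rewrite /= all_map.
  have P a : holds (subst (nth 0 idx') phi) (a :: t) <->
             holds phi (a :: [seq nth a0 t i | i <- idx]).
    by rewrite (@holds_sub _ _ _ _ _ a0) /= ?size_map // -map_comp.
  have [||psi [a [sp ha /P hp com]]] :=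
      @isolated_dense t (subst (nth 0 idx') phi).
  + by apply: scoped_sub => //; rewrite /= size_map.
  + by case: ex => a /P; exists a.
  exists a; split=> //.
  have := @isolated_sub _ _ a (rcons (iota 1 (size t)) 0) (isolated_cons it sp ha com).
  rewrite map_rcons (_ : map _ (iota 1 _) = t); last first.
    rewrite (iotaDl 1 0) -map_comp; apply: (@eq_from_nth _ a0).
      by rewrite size_map size_iota.
    move=> i; rewrite size_map size_iota => il.
    by rewrite (nth_map 0) ?size_iota // nth_iota //=; apply: set_nth_default.
  apply; apply/allP => i; rewrite mem_rcons inE mem_iota => /orP[/eqP->//|].
  by case/andP.
have mN : models N T by apply/(elementary_models T ef).
have [h [_ eh]] := isomorphic_elementary (wc.2 _ _ mM mN cM cN).
apply: (isolated_elementary eh).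
have [t [it ht]] := hN (map h s).
apply: (isolated_elementary ef).
have [a0] := carrier_inhabited M.
have [|idx [hi ->]] := @In_idx M a0 t (map f (map h s)).
  by move=> x /List.in_map_iff[y [<- ys]]; exact: ht.
exact: isolated_sub.
Qed.

(** This is the theorem of Ryll-Nardzewski. If finitely many isolating
    formulas do not cover all tuples, then the negations of all of them are
    jointly realised in some countable model, against [all_isolated]. *)
Lemma finitely_many_types (n : nat) : finite_index
  (fun s s' : seq M => size s = n -> size s' = n -> eqtp s s').
Proof.
have [e he] := formula_enum L.
pose iso phi := scoped n phi /\ forall s s' : seq M, size s = n -> size s' = n ->
  holds phi s -> holds phi s' -> eqtp s s'.
pose cond k := if pselect (iso (e k)) then FNot (e k) else ftrue L.
have sc k : scoped n (cond k) by rewrite /cond; case: (pselect (iso (e k))) => [ik|//]; case: ik.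
case: (pselect (exists m, forall s : seq M, size s = n ->
                  exists k : 'I_m.+1, ~ holds (cond k) s)) => [[m hm]|nm].
  have /choice[kappa hk] : forall s : seq M, exists k : 'I_m.+1,
      size s = n -> iso (e k) /\ holds (e k) s.
    move=> s; case: (pselect (size s = n)) => es; last by exists ord0.
    have [k hk] := hm s es; exists k => _; move: hk.
    rewrite /cond; case: (pselect (iso (e k))) => [ik|nik]; last by case=> v; apply: sat_true.
    rewrite holds_not; last by rewrite es; case: ik.
    by move/contrapT.
  exists 'I_m.+1, kappa => s s' E es es'.
  have [[_ h] hs] := hk s es; have [_ hs'] := hk s' es'.
  by apply: h => //; rewrite E.
exfalso.
have [||N [f [s [ef es hs]]]] := @compactness L M n cond (fun=> [::]).
- by move=> k; rewrite addn0.
- move=> m; apply: contrapT => H; apply: nm; exists m => s es.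
  apply: contrapT => H'; apply: H; exists s => // k km.
  by rewrite cats0; apply: contrapT => nh; apply: H'; exists (inord k); rewrite inordK.
have [N' [g [eg cN' [t et]]]] := lowenheim_skolem s.
have mN' : models N' T by apply/(elementary_models T eg)/(elementary_models T ef).
have [h [_ eh]] := isomorphic_elementary (wc.2 _ _ mN' mM cN' cM).
have [phi [scp hp isop]] := all_isolated (map h t).
have [k ek] := he phi.
have st : size t = n by rewrite -es -et size_map.
rewrite size_map st in scp isop.
have ik : iso (e k).
  rewrite ek; split=> // u u' eu eu' hu hu'.
  by apply: eqtp_trans (isop _ _ hu) (eqtp_sym (isop _ _ hu')).
have : holds (cond k) t.
  by apply/(eg _ _ _); rewrite ?st // et; have := hs k; rewrite cats0.
move/(eh _ _ _); rewrite st => /(_ (sc k)).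
rewrite /cond; case: (pselect (iso (e k))) => // ik'.
by move/holds_not; rewrite size_map st ek => /(_ scp).
Qed.

(** The formula isolating [a :: s] asserts something of [s], namely that it
    has a solution there. *)
Lemma eqtp_extend (s s' : seq M) a : eqtp s s' -> exists a', eqtp (a :: s) (a' :: s').
Proof.
move=> ss; have [phi [sc h iso]] := all_isolated (a :: s).
have [|a' ha'] := eqtp_ex ss sc; first by exists a.
exists a'; apply/eqtp_sym/iso => //=; by case: ss => ->.
Qed.

Lemma eqtp_extend_seq (s s' : seq M) t : eqtp s s' ->
  exists t', eqtp (t ++ s) (t' ++ s').
Proof.
move=> ss; elim: t => [|a t [t' ht']]; first by exists [::].
by have [a'] := eqtp_extend a ht'; exists (a' :: t').
Qed.

End RyllNardzewski.
End Formulas.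

(** * Binary atoms and homogeneous partitions *)

Section Atoms.
Variable L : vocabulary.
Implicit Types (M N : structure L).

(** An atom in two variables: the entry [false] of the tuple stands for the first
    variable and [true] for the second one. *)
Definition atom := {r : symbol L & (arity r).-tuple bool}.

Definition holds_atom (A : atom) M (x y : M) : Prop :=
  interp (map_tuple (fun c : bool => if c then y else x) (tagged A)).

Definition atom_formula (A : atom) (x y : nat) : formula L :=
  FRel (map_tuple (fun c : bool => if c then y else x) (tagged A)).

Lemma sat_atom (A : atom) M x y (v : nat -> M) :
  sat (atom_formula A x y) v <-> holds_atom A (v x) (v y).
Proof.
rewrite /= /holds_atom.
suff -> : map_tuple v (map_tuple (fun c : bool => if c then y else x) (tagged A)) =
  map_tuple (fun c : bool => if c then v y else v x) (tagged A) by [].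
by apply: val_inj; rewrite /= -map_comp; apply: eq_map => -[].
Qed.

Lemma scoped_atom (A : atom) x y n : x < n -> y < n -> scoped n (atom_formula A x y).
Proof. by move=> xn yn; apply/allP => _ /mapP[[] _ ->]. Qed.

Lemma fv_atom (A : atom) x y : {subset fv (atom_formula A x y) <= [:: x; y]}.
Proof. by move=> _ /mapP[[] _ ->]; rewrite !inE eqxx ?orbT. Qed.

Lemma holds_atom_formula A M (x y : M) :
  holds (atom_formula A 0 1) [:: x; y] <-> holds_atom A x y.
Proof.
by rewrite (holds_nth x) ?scoped_atom // sat_atom.
Qed.

Definition flip_atom (A : atom) : atom := Tagged _ (map_tuple negb (tagged A)).

Lemma holds_flip (A : atom) M (x y : M) :
  holds_atom (flip_atom A) x y <-> holds_atom A y x.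
Proof.
rewrite /holds_atom /=.
suff -> : map_tuple (fun c : bool => if c then y else x) (map_tuple negb (tagged A)) =
  map_tuple (fun c : bool => if c then x else y) (tagged A) by [].
by apply: val_inj; rewrite /= -map_comp; apply: eq_map => -[].
Qed.

(** Each of the three conditions of the theorem amounts to the existence of
    such a partition of an infinite model. *)
Definition homogeneous_partition M (xi : formula L) l (lab : M -> 'I_l) : Prop :=
  [/\ scoped 2 xi,
      forall i, exists a, lab a = i,
      forall a b, holds2 xi a b <-> lab a = lab b,
      forall a, infinite_set [set b | lab b = lab a] \/
                forall b, lab b = lab a -> b = a
    & forall a b a' b', a <> b -> a' <> b' -> lab a = lab a' -> lab b = lab b' ->
        forall A : atom, holds_atom A a b <-> holds_atom A a' b'].

(** It suffices to move one coordinate at a time: two moves lead from a pair to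
    any other one with the same labels, except for the transposed pair, which is
    reached through a third element of the class. *)
Lemma homogeneous_of_moves M l (lab : M -> 'I_l) :
  (forall a, infinite_set [set b | lab b = lab a] \/
             forall b, lab b = lab a -> b = a) ->
  (forall a a' b, a <> b -> a' <> b -> lab a = lab a' ->
     forall A : atom, holds_atom A a b <-> holds_atom A a' b) ->
  forall a b a' b', a <> b -> a' <> b' -> lab a = lab a' -> lab b = lab b' ->
     forall A : atom, holds_atom A a b <-> holds_atom A a' b'.
Proof.
move=> dich mv.
have mv2 a b b' : a <> b -> a <> b' -> lab b = lab b' ->
    forall A : atom, holds_atom A a b <-> holds_atom A a b'.
  move=> ab ab' e A; rewrite -!(holds_flip A).
  by apply: mv => // /esym.
move=> a b a' b' ab a'b' ea eb A.
case: (pselect (a' = b)) => [ba'|na'b]; last by rewrite (mv a a' b) // (mv2 a' b b').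
case: (pselect (a = b')) => [ab'|nab']; last by rewrite (mv2 a b b') // (mv a a' b').
subst a' b'; case: (dich a) => [inf|/(_ b (esym ea)) ba]; last by case: ab.
have [c [/= lc nc]] := infinite_fresh [:: a; b] inf.
have ac : a <> c by move=> ac; apply: nc; left.
have bc : b <> c by move=> bc; apply: nc; right; left.
have ba : b <> a by move=> ba; apply: ab.
rewrite (mv2 a b c ab ac); last by rewrite lc.
by rewrite (mv a b c ac bc) // (mv2 b c a bc ba).
Qed.

End Atoms.

(** * Rank one and trivial algebraic closure *)

Section RankOne.
Variable L : vocabulary.
Implicit Types (phi psi theta : formula L).
Variables (T : theory L) (M : structure L).
Hypotheses (ws : omega_stable T) (wc : omega_categorical T)
           (rk : SU_rank_eq T 1) (triv : trivial_pregeometry T).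
Hypotheses (mM : models M T) (iM : infinite_set [set: M])
           (cM : countable [set: M]).

Let E : set M := acl set0.

Lemma acl0P a : E a <-> exists phi,
  [/\ scoped 1 phi, holds phi [:: a] & finite_set [set b : M | holds phi [:: b]]].
Proof.
split=> [[phi [[|x c] [Hc sc h f]]]|[phi [sc h f]]].
- by exists phi.
- by have := List.Forall_inv Hc.
- by exists phi, [::]; split=> //; exact: List.Forall_nil.
Qed.

Lemma acl0_eqtp a a' : eqtp [:: a] [:: a'] -> E a -> E a'.
Proof.
move=> h /acl0P[phi [sc ha f]]; apply/acl0P; exists phi; split=> //.
exact: eqtp_holds ha.
Qed.

(** Elements of the same type are algebraic by virtue of the same formula, and
    there are finitely many types. *)
Lemma finite_acl0 : finite_set E.
Proof.
have [F [k hk]] := finitely_many_types ws wc mM iM cM 1.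
apply: contrapT => /(finite_index_fiber (fun a => k [:: a]))[c inf].
have [a [Ea /= ka]] := infinite_setN0 inf.
move: (Ea) => /acl0P[phi [sc h f]]; apply: inf.
apply: sub_finite_set f => b [_ /= kb] /=.
by apply: eqtp_holds h => //; apply: hk; rewrite // ka kb.
Qed.

(** The form in which triviality of the pregeometry is used *)
Lemma acl_closed phi c a : (forall x, E x -> List.In x c) ->
  scoped (size c).+1 phi -> holds phi (a :: c) -> ~ List.In a c ->
  infinite_set [set x | holds phi (x :: c)].
Proof.
move=> Ec sc ha ac f; have : acl [set x | List.In x c] a.
  by exists phi, c; split=> //; apply/ForallP.
by rewrite (triv mM) => -[|/Ec].
Qed.

(** Otherwise [tp(a/b)] would fork over the empty set, and the type of [a] over
    [b] and [a] would fork over [b] since [a] is not algebraic over [b]: the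
    rank would be at least 2. *)
Lemma not_dividing phi b a (c : nat -> seq M) :
  (forall x, E x -> List.In x b) -> scoped (size b).+1 phi ->
  holds phi (a :: b) -> ~ List.In a b -> (forall i, eqtp (c i) b) ->
  exists i j, i <> j /\ exists x, holds phi (x :: c i) /\ holds phi (x :: c j).
Proof.
move=> Eb sc ha ab ec; apply: contrapT => nc.
apply: (rk.2 M set0 a mM).
pose B := [set x | List.In x b].
exists M, id, B; rewrite image_id; split=> //; first exact: elementary_id.
  exists phi, b; split=> //; first exact/ForallP.
  exists M, id, 1, (fun=> phi), (fun=> b); rewrite image_id map_id; split=> //.
  - exact: elementary_id.
  - by move=> x hx; exists ord0.
  move=> _; exists M, id, c, 2; rewrite image_id map_id; split=> //.
  - exact: elementary_id.
  - by move=> i; apply/same_type_eqtp0.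
  case=> [//|i [//|j [|//]]] + _ [x hx]; rewrite /= inE andbT => /eqP ij.
  apply: nc; exists i, j; split=> //; exists x.
  by split; apply: hx; rewrite !inE eqxx ?orbT.
exists M, id, (B `|` [set a]); rewrite image_id; split=> //; first exact: elementary_id.
exists (FEq 0 1), [:: a]; split=> //.
  by apply/ForallP => x [<-|[]]; right.
exists M, id, 1, (fun=> FEq 0 1), (fun=> [:: a]); rewrite image_id; split=> //.
- exact: elementary_id.
- by move=> x hx; exists ord0.
move=> _.
have [psi [sp hp iso]] := all_isolated ws wc mM iM cM (a :: b).
have /infinite_inj[u [ui hu]] := acl_closed Eb sp hp ab.
exists M, id, (fun i => [:: u i]), 2; rewrite image_id; split=> //.
- exact: elementary_id.
- move=> i; apply/same_type_eqtp; split=> // d Bd.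
  have [|idx [hi ->]] := @In_idx M a b d; first exact/ForallP.
  have := eqtp_sub (u i) a (idx := 0 :: map S idx) (iso (u i :: b) erefl (hu i)).
  rewrite /= -!map_comp all_map => /(_ hi).
  suff -> : [seq nth (u i) (u i :: b) (S j) | j <- idx] = [seq nth a b j | j <- idx] by [].
  by apply/eq_in_map => j /(allP hi) jl /=; apply: set_nth_default.
case=> [//|i [//|j [|//]]] + _ [x hx]; rewrite /= inE andbT => /eqP; apply.
have ei : holds (FEq 0 1) [:: x; u i] by apply: hx; rewrite inE eqxx.
have ej : holds (FEq 0 1) [:: x; u j] by apply: hx; rewrite !inE eqxx orbT.
apply: ui; exact: etrans (esym (ei (fun=> x))) (ej (fun=> x)).
Qed.

End RankOne.

(** ** Traces of unsplit sets *)

Section Separation.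
Variable L : vocabulary.
Implicit Types (phi psi theta : formula L).
Variables (T : theory L) (M : structure L).
Hypotheses (ws : omega_stable T) (wc : omega_categorical T)
           (rk : SU_rank_eq T 1) (triv : trivial_pregeometry T).
Hypotheses (mM : models M T) (iM : infinite_set [set: M])
           (cM : countable [set: M]).

Let extend := eqtp_extend ws wc mM iM cM.
Let extend_seq := eqtp_extend_seq ws wc mM iM cM.
Let acl_inf := acl_closed triv mM.

Definition acl_in (d : seq M) : Prop := forall x, acl set0 x -> List.In x d.

Variable f : formula L.
Hypothesis sf : scoped 2 f.
Let P (x y : M) : Prop := holds f [:: x; y].

(** Elements outside the parameters count as generic: if the parameters
    contain all algebraic elements, this says that the set defined by [theta]
    and [f(x, y) = b] is infinite. *)
Definition meets theta (d : seq M) (y : M) (b : bool) : Prop :=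
  exists x, [/\ ~ List.In x (y :: d), holds theta (x :: d) & P x y <-> b].

Definition generic theta (d : seq M) : Prop :=
  exists x, ~ List.In x d /\ holds theta (x :: d).

Definition unsplit theta (d : seq M) : Prop :=
  [/\ scoped (size d).+1 theta, generic theta d &
      forall y, ~ (meets theta d y true /\ meets theta d y false)].

(** Almost all elements of an unsplit set [theta] satisfy [f(x, y)] if [y] is
    in the trace, and almost none of them otherwise. *)
Definition trace theta (d : seq M) : set M := [set y | meets theta d y true].

Lemma meets_eqtp theta d y d' y' b : scoped (size d).+1 theta ->
  eqtp (y :: d) (y' :: d') -> meets theta d y b -> meets theta d' y' b.
Proof.
move=> st e [x [nx tx pb]]; have [x' ex] := extend x e.
have [e1 e2 e3] := eqtp_cons2 ex.
exists x'; split; first by rewrite -(eqtp_In ex).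
  by apply: eqtp_holds e2 _ _.
have <- : P x y <-> P x' y'.
  by split; apply: eqtp_holds => //; exact: eqtp_sym.
exact: pb.
Qed.

Lemma generic_eqtp theta d d' : scoped (size d).+1 theta ->
  eqtp d d' -> generic theta d -> generic theta d'.
Proof.
move=> st e [x [nx tx]]; have [x' ex] := extend x e.
exists x'; split; first by rewrite -(eqtp_In ex).
exact: eqtp_holds ex _ _.
Qed.

Lemma unsplit_eqtp theta d d' : eqtp d d' -> unsplit theta d -> unsplit theta d'.
Proof.
move=> e [st g m]; have es : size d = size d' by case: e.
split; [by rewrite -es|exact: generic_eqtp g|move=> y' [h1 h2]].
have [y ey] := extend y' (eqtp_sym e).
by apply: (m y); split; apply: meets_eqtp ey _; rewrite -?es.
Qed.

(** Otherwise every infinite set below [theta0] would split into two infinite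
    ones, against [no_splitting_tree]. *)
Lemma unsplit_exists theta0 d0 : scoped (size d0).+1 theta0 ->
  generic theta0 d0 ->
  exists theta m, unsplit theta (m ++ d0) /\
    forall x, holds theta (x :: m ++ d0) -> holds theta0 (x :: d0).
Proof.
move=> s0 g0; apply: contrapT => H.
pose K theta c := exists m, [/\ c = m ++ d0, scoped (size c).+1 theta,
  generic theta c & forall x, holds theta (x :: c) -> holds theta0 (x :: d0)].
apply: (@no_splitting_tree _ T M K ws mM iM _ _ theta0 d0).
- by move=> theta c [m [-> sc [x [_ hx]] _]]; split=> //; exists x.
- move=> theta c [m [ec sc g sub]].
  have [y [[x1 [n1 h1 p1]] [x2 [n2 h2 p2]]]] :
      exists y, meets theta c y true /\ meets theta c y false.
    apply: contrapT => ny; apply: H; exists theta, m; rewrite -ec; split=> //.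
    by split=> // y hy; apply: ny; exists y.
  exists (meetf f 1 theta (size c)), ([:: y] ++ c),
         (meetf (FNot f) 1 theta (size c)), ([:: y] ++ c).
  have e1 x : holds (meetf f 1 theta (size c)) (x :: [:: y] ++ c) <->
      P x y /\ holds theta (x :: c) by apply: (@holds_meetf _ _ f _ _ [:: y]).
  have e2 x : holds (meetf (FNot f) 1 theta (size c)) (x :: [:: y] ++ c) <->
      ~ P x y /\ holds theta (x :: c).
    by rewrite (@holds_meetf _ _ (FNot f) _ _ [:: y]) // holds_not.
  split.
  + exists (y :: m); split; first by rewrite ec.
    * exact: scoped_meetf.
    * by exists x1; split=> //; apply/e1; split=> //; apply/p1.
    * by move=> x /e1[_ /sub].
  + exists (y :: m); split; first by rewrite ec.
    * exact: scoped_meetf.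
    * by exists x2; split=> //; apply/e2; split=> // /p2.
    * by move=> x /e2[_ /sub].
  + by move=> x /e1[].
  + by move=> x /e2[].
  + by move=> x /e1[hp _] /e2[].
- by exists [::].
Qed.

(** Infinite sets with the same defining formula and different traces are almost
    disjoint, so infinitely many traces would make the formula divide. *)
Lemma finite_traces theta d0 : acl_in d0 -> unsplit theta d0 ->
  finite_set [set trace theta d | d in [set d | eqtp d d0 /\ acl_in d]].
Proof.
move=> cl0 u0; apply: contrapT => /infinite_inj[q [qi hq]].
have /choice[D hD] : forall n, exists d, [/\ eqtp d d0, acl_in d & trace theta d = q n].
  by move=> n; have [d [h1 h2] e] := hq n; exists d.
have [st [a [na ta]] _] := u0.
pose th := FAnd theta (freshf L (size d0)).
have sD i : size (D i) = size d0 by have [[e _] _ _] := hD i.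
have thE x i : holds th (x :: D i) <-> holds theta (x :: D i) /\ ~ List.In x (D i).
  by rewrite holds_and -(sD i) holds_fresh.
have [||||i [j [ij [x [/thE[t1 n1] /thE[t2 n2]]]]]] :=
  not_dividing ws wc rk triv mM iM cM (phi := th) (b := d0) (a := a) (c := D) cl0.
- by rewrite /scoped /= all_cat; apply/andP; split; [exact: st|exact: scoped_fresh].
- by apply/holds_and; split=> //; apply/holds_fresh.
- exact: na.
- by move=> i; have [] := hD i.
have wlog_ i' j' y : holds theta (x :: D i') -> holds theta (x :: D j') ->
    ~ List.In x (D i') -> ~ List.In x (D j') -> q i' y -> ~ q j' y -> False.
  move=> ti tj ni nj; have [ei ci <-] := hD i'; have [ej cj <-] := hD j'.
  move=> Qi Qj; have [_ _ mi] := unsplit_eqtp (eqtp_sym ei) u0.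
  have si : scoped (size (D i')).+1 theta by rewrite sD.
  have sj : scoped (size (D j')).+1 theta by rewrite sD.
  have inf : infinite_set [set z | holds
      (meetf theta (size (D i')) theta (size (D j'))) (z :: D i' ++ D j')].
    apply: (acl_inf (a := x)).
    - by move=> z Ez; apply/In_cat; left; apply: ci.
    - by rewrite size_cat; apply: scoped_meetf.
    - by apply/holds_meetf.
    - by move=> /In_cat[].
  have [z [/= /holds_meetf-/(_ si sj)[zi zj] nz]] :=
    infinite_fresh (y :: D i' ++ D j') inf.
  have nzi : ~ List.In z (y :: D i').
    by move=> /= [?|?]; apply: nz; [left|right; apply/In_cat; left].
  have nzj : ~ List.In z (y :: D j').
    by move=> /= [?|?]; apply: nz; [left|right; apply/In_cat; right].
  case: (pselect (P z y)) => Pzy; first by apply: Qj; exists z.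
  by apply: (mi y); split=> //; exists z; split.
apply: ij; apply: qi; apply/seteqP; split=> y hy; apply: contrapT => hy'.
  exact: (wlog_ i j y).
exact: (wlog_ j i y).
Qed.

(** Two elements that [f] distinguishes generically are separated by the trace of
    an unsplit subset of the set on which they differ. Up to types there are
    finitely many such pairs, and finitely many traces for each. *)
Lemma finite_index_generic : finite_index (fun a b : M => forall x,
  ~ List.In x [:: a; b] -> ~ acl set0 x -> P x a -> P x b).
Proof.
have [e he] := finite_list_exact (finite_acl0 ws wc mM iM cM).
have cl m a b : acl_in (m ++ [:: a, b & e]).
  by move=> x /he xe; apply/In_cat; right; right; right.
pose bad a b := exists x, ~ List.In x [:: a, b & e] /\ (P x a /\ ~ P x b).
have [F [k hk]] := finitely_many_types ws wc mM iM cM (size e).+2.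
pose good (c : F) (t : M * M * formula L * seq M) := let: (a, b, theta, m) := t in
  [/\ k [:: a, b & e] = c, unsplit theta (m ++ [:: a, b & e]) &
   forall x, holds theta (x :: m ++ [:: a, b & e]) -> P x a /\ ~ P x b].
have good_ex a b : bad a b -> exists t, good (k [:: a, b & e]) t.
  move=> [x [nx [pa pb]]].
  have E z : holds (meetf f 1 (FNot f) 1) (z :: [:: a] ++ [:: b]) <-> P z a /\ ~ P z b.
    by rewrite (@holds_meetf _ _ f (FNot f) z [:: a] [:: b]) // holds_not.
  pose th := subst (nth 0 [:: 0; 1; 2]) (meetf f 1 (FNot f) 1).
  have sm : scoped 3 (meetf f 1 (FNot f) 1) by apply: (@scoped_meetf _ f 1 (FNot f) 1).
  have thE z : holds th (z :: [:: a, b & e]) <-> P z a /\ ~ P z b.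
    by rewrite -E (@holds_sub _ _ _ _ _ z).
  have [||theta [m [u sub]]] := @unsplit_exists th [:: a, b & e].
  - exact: scoped_sub.
  - by exists x; split=> //; apply/thE.
  by exists (a, b, theta, m); split=> // z /sub/thE.
have /choice[w hw] : forall c, exists t, (exists t', good c t') -> good c t.
  move=> c; case: (pselect (exists t', good c t')) => [[t' h]|nh]; first by exists t'.
  by have [a] := carrier_inhabited M; exists (a, a, f, [::]).
pose QQ := \bigcup_(c in [set c : F | exists t, good c t])
  (let: (a, b, theta, m) := w c in
   [set trace theta d | d in [set d | eqtp d (m ++ [:: a, b & e]) /\ acl_in d]]).
have fQ : finite_set QQ.
  apply: bigcup_finite; first exact: finite_finset.
  move=> c /= /hw; case: (w c) => [[[a b] theta] m] [_ u _].
  by apply: finite_traces u; exact: cl.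
apply: finite_index_sub (finite_index_sets fQ) => a b sep x nx Ex Pa.
apply: contrapT => Pb.
have [|t gt] := good_ex a b.
  exists x; split=> //= -[?|[?|xe]]; [apply: nx; left|apply: nx; right; left|] => //.
  by apply: Ex; apply/he.
set c := k _ in gt; have gc : exists t, good c t by exists t.
have sepc X : (let: (a, b, theta, m) := w c in
    [set trace theta d | d in [set d | eqtp d (m ++ [:: a, b & e]) /\ acl_in d]]) X ->
    X a -> X b by move=> h; apply: sep; exists c.
move: (hw c gc) sepc; case: (w c) => [[[a0 b0] theta] m0] [kc u sub] sepc.
have e0 : eqtp [:: a0, b0 & e] [:: a, b & e] by apply: hk.
have [m em] := extend_seq m0 e0; set d := m ++ _ in em.
have ud := unsplit_eqtp em u.
have [st [z [nz tz]] _] := ud.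
have In_a : List.In a d by apply/In_cat; right; left.
have In_b : List.In b d by apply/In_cat; right; right; left.
have sub' y : holds theta (y :: d) -> P y a /\ ~ P y b.
  move=> ty; have [y0 ey] := extend y (eqtp_sym em).
  have [|pa pb] := sub y0; first by apply: eqtp_holds ey _ _.
  have sm : size m = size m0.
    by case: em => + _; rewrite !size_cat /= => /addIn.
  have pick i : i < 2 -> P y (nth y [:: a; b] i) <-> P y0 (nth y0 [:: a0; b0] i).
    move=> i2; have hi : size m + i < size d.
      by rewrite size_cat ltn_add2l (leq_trans i2).
    have := eqtp_sub y y0 (idx := [:: 0; (size m + i).+1]) ey.
    rewrite /= ltnS hi => /(_ isT).
    rewrite !nth_cat -sm !ltnNge !leq_addr /= !addKn.
    by clear hi; case: i i2 => [|[|]] // _ [_ h]; apply: h.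
  by split; [apply/(pick 0 isT)|move/(pick 1 isT)].
have tr : trace theta d a.
  exists z; split=> //=; last by split=> // _; case: (sub' z tz).
  by case=> [az|//]; apply: nz; rewrite -az.
have [|v [_ tv pv]] := sepc (trace theta d) _ tr.
  by exists d => //; split; [exact: eqtp_sym|exact: cl].
by have [_] := sub' v tv; apply; apply/pv.
Qed.

End Separation.

(** * Twins *)

Section Twins.
Variable L : vocabulary.
Implicit Types (phi psi theta : formula L).

(** In a binary vocabulary this says that the transposition of [a] and [b] is an
    automorphism. *)
Definition twin (M : structure L) (a b : M) : Prop :=
  a = b \/
  (forall z, z <> a -> z <> b -> forall A : atom L, holds_atom A z a <-> holds_atom A z b) /\
  (forall A : atom L, holds_atom A a b <-> holds_atom A b a).

Lemma twin_equiv (M : structure L) : RelationClasses.Equivalence (@twin M).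
Proof.
have sym (a b : M) : twin a b -> twin b a.
  move=> [->|[h k]]; first by left.
  by right; split=> [z zb za A|A]; [rewrite h|rewrite k].
split=> [a|a b|a b c]; [by left|exact: sym|].
case=> [->//|[h1 k1]] [<-|[h2 k2]]; first by right.
case: (pselect (a = c)) => [->|ac]; first by left.
case: (pselect (a = b)) => [->|ab]; first by right.
case: (pselect (b = c)) => [<-|bc]; first by right.
have ca : c <> a by move=> ca; apply: ac.
have cb : c <> b by move=> cb; apply: bc.
have ba : b <> a by move=> ba; apply: ab.
have e1 A : holds_atom A c a <-> holds_atom A c b by apply: h1.
have e2 A : holds_atom A a b <-> holds_atom A a c by apply: h2.
have f1 A : holds_atom A a c <-> holds_atom A b c by rewrite -!(holds_flip A) e1.
have f2 A : holds_atom A b a <-> holds_atom A c a by rewrite -!(holds_flip A) e2.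
right; split=> [z za zc A|A]; last by rewrite -e2 k1 f2.
case: (pselect (z = b)) => [->|zb]; last by rewrite h1 // h2.
by rewrite f2 e1 -k2 -f1 -e2 k1.
Qed.

Variables (T : theory L) (M : structure L).
Hypotheses (ws : omega_stable T) (wc : omega_categorical T)
           (rk : SU_rank_eq T 1) (triv : trivial_pregeometry T).
Hypotheses (mM : models M T) (iM : infinite_set [set: M])
           (cM : countable [set: M]).

(** An element is coloured by its type over the algebraic elements and by its
    behaviour towards generic ones. Two elements of the same colour are then
    indistinguishable by third elements. That they can also be exchanged with
    each other is seen by comparing both with a third element of that colour.
    *)
Lemma finite_index_twin : finite_index (@twin M).
Proof.
have [e he] := finite_list_exact (finite_acl0 ws wc mM iM cM).
have fi1 : finite_index (fun a b : M => eqtp (a :: e) (b :: e)).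
  have [F [k hk]] := finitely_many_types ws wc mM iM cM (size e).+1.
  by exists F, (fun a => k (a :: e)) => a b /hk; apply.
have fi2 : finite_index (fun a b : M => forall A : atom L, forall x,
    ~ List.In x [:: a; b] -> ~ acl set0 x -> holds_atom A x a <-> holds_atom A x b).
  apply: finite_index_all => A.
  have sA : scoped 2 (atom_formula A 0 1) by apply: scoped_atom.
  apply: finite_index_sub (finite_index_sym
    (finite_index_generic ws wc rk triv mM iM cM sA)) => a b [h k] x nx Ex.
  rewrite -!holds_atom_formula; split; first exact: h.
  by apply: k => // -[xb|[xa|//]]; apply: nx; [right; left|left].
have [F [k hk]] := finite_indexI fi1 fi2.
apply: (finite_index_infinite (kappa := k)) => [a|a b kab inf]; first by left.
have key x y z : k x = k y -> z <> x -> z <> y ->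
    forall A : atom L, holds_atom A z x <-> holds_atom A z y.
  move=> /hk[exy h] zx zy A.
  case: (pselect (acl set0 z)) => Ez; last first.
    by apply: h => // -[xz|[yz|//]]; [apply: zx|apply: zy].
  have [i il ei] := In_nth z ((he z).1 Ez).
  have := eqtp_sub z z (idx := [:: i.+1; 0]) exy.
  rewrite /= ltnS il ei => /(_ isT) [_] /(_ (atom_formula A 0 1)).
  by rewrite !holds_atom_formula; apply; apply: scoped_atom.
case: (pselect (a = b)) => [->|ab]; [by left|right].
split=> [z za zb A|A]; first exact: key.
have [c [/= kc nc]] := infinite_fresh [:: a; b] inf.
have ca : c <> a by move=> ca; apply: nc; left.
have cb : c <> b by move=> cb; apply: nc; right; left.
have ba : b <> a by move=> ba; apply: ab.
have e1 : holds_atom A a b <-> holds_atom A a c.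
  by apply: key; rewrite ?kc // => // /esym.
have e3 : holds_atom A b c <-> holds_atom A b a.
  by apply: key; rewrite ?kc // => // /esym.
rewrite e1 -e3 -!(holds_flip A); exact: key.
Qed.

(** There are finitely many types, each isolated by a formula. *)
Lemma invariant_definable n (R : seq M -> Prop) :
  (forall s s', size s = n -> eqtp s s' -> R s -> R s') ->
  exists phi, scoped n phi /\ forall s, size s = n -> holds phi s <-> R s.
Proof.
move=> inv; have [F [k hk]] := finitely_many_types ws wc mM iM cM n.
have /choice[phi hphi] : forall c : F, exists phi, scoped n phi /\
    ((exists s, [/\ size s = n, R s & k s = c]) -> exists s, [/\ size s = n, R s, k s = c & isolates phi s]).
  move=> c; case: (pselect (exists s, [/\ size s = n, R s & k s = c])); last first.
    by move=> ns; exists (ftrue L); split.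
  case=> s [es Rs ks]; have [phi ip] := all_isolated ws wc mM iM cM s.
  exists phi; split; first by case: ip; rewrite es.
  by move=> _; exists s.
pose l := [seq FNot (phi c) | c <- enum F & `[< exists s, [/\ size s = n, R s & k s = c] >]].
have Inl psi : List.In psi l <-> exists2 c, (exists s, [/\ size s = n, R s & k s = c])
      & psi = FNot (phi c).
  rewrite List.in_map_iff; split=> [[c [<- /In_mem]]|[c hc ->]].
    by rewrite mem_filter => /andP[/asboolP hc _]; exists c.
  exists c; split=> //; apply/In_mem; rewrite mem_filter mem_enum andbT.
  exact/asboolP.
exists (FNot (fandl l)); split.
  apply/allP => x /= /fv_andl[psi /Inl[c _ ->]] /=.
  by apply: (allP (hphi c).1).
move=> s es; have [a] := carrier_inhabited M.
have sl : scoped (size s) (fandl l).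
  apply/allP => x /= /fv_andl[psi /Inl[c _ ->]] /=; rewrite es.
  by apply: (allP (hphi c).1).
rewrite holds_not // (holds_nth a) // sat_andl; split=> [h|Rs h].
  apply: contrapT => nR; apply: h => psi /Inl[c hc ->] /= sp.
  have [sc /(_ hc)[s' [es' Rs' _ [_ _ iso]]]] := hphi c.
  apply: nR; apply: inv Rs' => //; apply: eqtp_sym; apply: iso; first by rewrite es es'.
  by apply/(holds_nth a) => //; rewrite es.
have hc : exists s', [/\ size s' = n, R s' & k s' = k s] by exists s.
have [sc /(_ hc)[s' [es' Rs' ks' [_ hs' _]]]] := hphi (k s).
apply: (h (FNot (phi (k s)))); first by apply/Inl; exists (k s).
apply/(holds_nth a); first by rewrite es.
by apply: eqtp_holds hs'; rewrite ?es' //; apply: hk.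
Qed.

(** A class of non-algebraic twins is a singleton or infinite, since a finite one
    would be algebraic over each of its elements. *)
Lemma stable_partition :
  exists xi l (lab : M -> 'I_l), homogeneous_partition xi lab.
Proof.
pose E : set M := acl set0.
pose X (a b : M) := a = b \/ [/\ ~ E a, ~ E b & twin a b].
have [tr ts tt] := twin_equiv M.
have Xe : RelationClasses.Equivalence X.
  split=> [a|a b|a b c]; first by left.
    by case=> [->|[Ea Eb /ts ab]]; [left|right].
  case=> [->//|[Ea Eb ab]] [<-|[_ Ec bc]]; first by right.
  by right; split=> //; apply: tt bc.
have [e he] := finite_list_exact (finite_acl0 ws wc mM iM cM).
have Xi : finite_index X.
  apply: finite_index_sub (finite_indexI finite_index_twin (finite_index_list e)) => a b [h k].
  case: (pselect (E a \/ E b)) => [[/he Ea|/he Eb]|nE].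
  - by left; apply: k; left.
  - by left; apply: k; right.
  - by right; split=> // ?; apply: nE; [left|right].
have Xinv a b a' b' : eqtp [:: a; b] [:: a'; b'] -> X a b -> X a' b'.
  move=> h.
  have e1 : eqtp [:: a] [:: a'] by have [] := eqtp_sub a a' (idx := [:: 0]) h isT.
  have e2 : eqtp [:: b] [:: b'] by have [] := eqtp_sub a a' (idx := [:: 1]) h isT.
  case: (pselect (a = b)) => [ab _|ab [/ab//|[Ea Eb [/ab//|[h1 h2]]]]].
    by left; have [/(_ (or_introl (esym ab)))[->|]] := eqtp_In h.
  right; split; [by move/(acl0_eqtp (eqtp_sym e1))|by move/(acl0_eqtp (eqtp_sym e2))|].
  have atm (A : atom L) (x y x' y' : M) : eqtp [:: x; y] [:: x'; y'] ->
      holds_atom A x y <-> holds_atom A x' y'.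
    by move=> [_ k]; rewrite -(holds_atom_formula A x y) -(holds_atom_formula A x' y');
       apply: k; apply: scoped_atom.
  right; split=> [z' za zb A|A].
    have [z hz] := eqtp_extend ws wc mM iM cM z' (eqtp_sym h).
    have [e3 e4 _] := eqtp_cons2 hz.
    have e5 : eqtp [:: z'; b'] [:: z; b] by have := eqtp_sub a a (idx := [:: 0; 2]) hz isT.
    rewrite (atm A _ _ _ _ e3) (atm A _ _ _ _ e5).
    have nz : ~ List.In z [:: a; b].
      by rewrite -(eqtp_In hz) => -[/esym|[/esym|]].
    by apply: h1 => // ez; apply: nz; [left|right; left].
  rewrite -(atm A _ _ _ _ h).
  have e6 : eqtp [:: b; a] [:: b'; a'] by have := eqtp_sub a a' (idx := [:: 1; 0]) h isT.
  by rewrite -(atm A _ _ _ _ e6).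
have [xi [sxi hxi]] : exists phi, scoped 2 phi /\ forall s : seq M, size s = 2 ->
    holds phi s <-> (fun s => if s is [:: a; b] then X a b else False) s.
  apply: invariant_definable => -[|a [|b []]] //= [|a' [|b' [|c s']]] _ //=;
    by [case|exact: Xinv].
have [l [lab [surj labX]]] := finite_index_labels Xe Xi.
have dich a : infinite_set [set b | lab b = lab a] \/
              forall b, lab b = lab a -> b = a.
  case: (pselect (infinite_set [set b | lab b = lab a])) => inf; [by left|right].
  move=> b lba; apply: contrapT => ba; apply: inf.
  have /labX[//|[Eb Ea _]] := lba.
  have nb : ~ List.In b (a :: e) by move=> /= [/esym//|/he].
  have xiE x : holds xi (x :: a :: e) <-> holds xi [:: x; a].
    rewrite (holds_nth x); last exact: scopedW sxi.
    by symmetry; apply: holds_sat => // -[|[|]].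
  have cle x : E x -> List.In x (a :: e) by move=> /he xe; right.
  have hb : holds xi (b :: a :: e) by apply/xiE/hxi => //; apply/labX.
  have inf := acl_closed triv mM cle (scopedW (n := (size e).+2) _ sxi) hb nb.
  suff -> : [set x | lab x = lab a] = [set x | holds xi (x :: a :: e)] by exact: inf.
  by apply/seteqP; split=> x /=; rewrite labX xiE hxi.
exists xi, l, lab; split=> //.
  by move=> a b; rewrite labX /holds2 hxi.
apply: homogeneous_of_moves => // a a' b ab a'b /labX[->//|[_ _ [->//|[h _]]]] A.
rewrite -!(holds_flip A); apply: h; by move=> /esym.
Qed.

End Twins.

(** * Labelled structures *)

Section Labelled.
Variables (L : vocabulary) (l : nat) (inf : pred 'I_l)
          (D : atom L -> 'I_l -> 'I_l -> bool -> Prop).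
Hypothesis hL : binary L.
Implicit Types (M N : structure L) (phi psi : formula L).

(** The label classes are infinite or singletons, as prescribed by [inf], and the
    atoms satisfied by a pair are read off from the table [D], whose last
    argument tells whether the two elements are equal. *)
Definition labelled M (lab : M -> 'I_l) : Prop :=
  (forall i, if inf i then infinite_set [set b | lab b = i]
             else exists a, forall b, lab b = i <-> b = a) /\
  (forall A a b, holds_atom A a b <-> D A (lab a) (lab b) `[< a = b >]).

Lemma labelled_surj M (lab : M -> 'I_l) i : labelled lab -> exists a, lab a = i.
Proof.
move=> [h _]; have := h i; case: (inf i) => [/infinite_setN0[a]|[a ha]].
  by exists a.
by exists a; apply/ha.
Qed.

Definition agree M N (labM : M -> 'I_l) (labN : N -> 'I_l) (vs : seq nat)
    (v : nat -> M) (w : nat -> N) : Prop :=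
  (forall x, x \in vs -> labM (v x) = labN (w x)) /\
  (forall x y, x \in vs -> y \in vs -> v x = v y <-> w x = w y).

Lemma agree_sym M N (labM : M -> 'I_l) (labN : N -> 'I_l) vs v w :
  agree labM labN vs v w -> agree labN labM vs w v.
Proof. by move=> [h k]; split=> [x /h|x y xs ys]; rewrite ?k. Qed.

Lemma agree_sub M N (labM : M -> 'I_l) (labN : N -> 'I_l) vs vs' v w :
  {subset vs' <= vs} -> agree labM labN vs v w -> agree labM labN vs' v w.
Proof.
move=> s [h k]; split=> [x /s/h //|x y /s xs /s ys]; exact: k.
Qed.

(** An unused element of an infinite class is matched with an unused element
    of the class with the same label. In a singleton class there is no choice,
    but no conflict either. *)
Lemma agree_extend M N (labM : M -> 'I_l) (labN : N -> 'I_l) vs v w x a :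
  labelled labM -> labelled labN ->
  agree labM labN [seq y <- vs | y != x] v w ->
  exists b, agree labM labN vs (upd v x a) (upd w x b).
Proof.
move=> hM hN [h k].
have [b [lb nb]] : exists b, labN b = labM a /\
    forall y, y \in [seq y <- vs | y != x] -> v y = a <-> w y = b.
  case: (pselect (exists2 y, y \in [seq y <- vs | y != x] & v y = a)).
    by move=> [y ys ya]; exists (w y); rewrite -ya h //; split=> // z zs; rewrite k.
  move=> na.
  have nv y : y \in [seq y <- vs | y != x] -> v y <> a.
    by move=> ys ya; apply: na; exists y.
  have := hN.1 (labM a); case: ifP => E.
    move=> ib; have [b [/= lb nb]] := infinite_fresh [seq w y | y <- vs & y != x] ib.
    exists b; split=> // y ys; split=> [/(nv y ys)//|wb].
    by case: nb; apply/List.in_map_iff; exists y; split=> //; apply/In_mem.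
  case=> b hb; exists b; split=> [|y ys]; first exact/hb.
  split=> [/(nv y ys)//|wb].
  have [a0 ha0] : exists a0, forall b, labM b = labM a <-> b = a0.
    by have := hM.1 (labM a); rewrite E.
  have -> : a = a0 by apply/ha0.
  by apply/ha0; rewrite h // wb; apply/hb.
exists b; split=> [y ys|y z ys zs]; rewrite !updE; case: eqP => [_|/eqP yx] //.
- by apply: h; rewrite mem_filter yx.
- case: eqP => [_|/eqP zx] //; split=> [/esym|/esym] e; apply/esym/nb => //;
    by rewrite mem_filter zx.
- case: eqP => [_|/eqP zx]; first by apply: nb; rewrite mem_filter yx.
  by apply: k; rewrite mem_filter ?yx ?zx.
Qed.

(** The arguments of a relation of arity at most 2 form an atom in two of
    them, unless there are none. *)
Lemma small_tuple n (t : n.-tuple nat) : n <= 2 -> tval t = [::] \/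
  exists x y (c : n.-tuple bool), [/\ x \in tval t, y \in tval t &
    t = map_tuple (fun b : bool => if b then y else x) c].
Proof.
case: t => s st; have /esym en := eqP st; subst n.
case: s st => [|x [|y [|z s]]] //= st _; [by left|right|right].
- have sc : size [:: false] == 1 by [].
  exists x, x, (Tuple sc); rewrite inE eqxx; split=> //; exact: val_inj.
- have sc : size [:: false; true] == 2 by [].
  exists x, y, (Tuple sc); rewrite !inE !eqxx orbT; split=> //; exact: val_inj.
Qed.

(** Back and forth between labelled structures *)
Lemma labelled_sat M N (labM : M -> 'I_l) (labN : N -> 'I_l) phi v w :
  labelled labM -> labelled labN -> agree labM labN (fv phi) v w ->
  sat phi v <-> sat phi w.
Proof.
move=> hM hN; elim: phi v w => [x y|r t|psi IH|psi1 IH1 psi2 IH2|x psi IH] v w.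
- by case=> _ k; apply: k; rewrite !inE eqxx ?orbT.
- case=> h k.
  have [a0] := carrier_inhabited M.
  have at2 (A : atom L) (a b : M) (a' b' : N) : labM a = labN a' ->
      labM b = labN b' -> (a = b <-> a' = b') ->
      holds_atom A a b <-> holds_atom A a' b'.
    move=> ea eb e; rewrite hM.2 hN.2 ea eb.
    by have -> : `[< a = b >] = `[< a' = b' >] by apply/asbool_equiv_eq.
  case: (small_tuple t (hL r)) => [t0|[x [y [c [xt yt et]]]]].
    have [b0 lb0] := labelled_surj (labM a0) hN.
    pose A : atom L := existT _ r (map_tuple (fun=> false) t).
    have E (K : structure L) (u : nat -> K) (a : K) :
      map_tuple (fun c : bool => if c then a else a) (map_tuple (fun=> false) t) =
      map_tuple u t by apply: val_inj; rewrite /= t0.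
    have := at2 A a0 a0 b0 b0 (esym lb0) (esym lb0).
    by rewrite /holds_atom /= (E M v) (E N w); apply; split.
  have E (K : structure L) (u : nat -> K) : sat (FRel t) u <->
      holds_atom (existT _ r c : atom L) (u x) (u y).
    by rewrite -(sat_atom (existT _ r c : atom L)) /atom_formula /= {1}et.
  by rewrite !E; apply: at2; [exact: h|exact: h|exact: k].
- by move=> ag; rewrite /= (IH v w).
- move=> ag; rewrite /= (IH1 v w) ?(IH2 v w) //; apply: agree_sub ag => y ys;
    by rewrite /= mem_cat ys ?orbT.
- move=> ag; split=> -[a ha].
    by have [b hb] := agree_extend a hM hN ag; exists b; apply/(IH _ _ hb).
  have [b hb] := agree_extend a hN hM (agree_sym ag); exists b.
  exact/(IH _ _ (agree_sym hb)).
Qed.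

Lemma labelled_eqtp M N (labM : M -> 'I_l) (labN : N -> 'I_l) s s' a b :
  labelled labM -> labelled labN -> size s = size s' ->
  (forall i, i < size s -> labM (nth a s i) = labN (nth b s' i)) ->
  (forall i j, i < size s -> j < size s ->
     nth a s i = nth a s j <-> nth b s' i = nth b s' j) ->
  eqtp s s'.
Proof.
move=> hM hN es h k; split=> // phi sc.
rewrite (holds_nth a) // (holds_nth b) -?es //.
apply: labelled_sat hM hN _; split=> [x /(allP sc)|x y /(allP sc) xs /(allP sc)].
  exact: h.
exact: k.
Qed.

End Labelled.

Lemma labelled_eqtp_map (L : vocabulary) l (inf : pred 'I_l) D (hL : binary L)
    (M N : structure L) (labM : M -> 'I_l) (labN : N -> 'I_l)
    (J : Type) (idx : seq J) (f : J -> M) (g : J -> N) :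
  labelled inf D labM -> labelled inf D labN ->
  (forall j, labM (f j) = labN (g j)) ->
  (forall j j', f j = f j' <-> g j = g j') ->
  eqtp (map f idx) (map g idx).
Proof.
move=> hM hN h k; case: idx => [|j0 idx].
  have [a] := carrier_inhabited M; have [b] := carrier_inhabited N.
  exact: (labelled_eqtp (a := a) (b := b) hL hM hN).
apply: (labelled_eqtp (a := f j0) (b := g j0) hL hM hN).
- by rewrite !size_map.
- by move=> i; rewrite size_map => il; rewrite !(nth_map j0) ?h.
- by move=> i j; rewrite size_map => il jl; rewrite !(nth_map j0) // k.
Qed.

Lemma labelled_eqtp_cons (L : vocabulary) l (inf : pred 'I_l) D (hL : binary L)
    (M N : structure L) (labM : M -> 'I_l) (labN : N -> 'I_l)
    (c : seq M) (d : seq N) (x : M) (y : N) :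
  labelled inf D labM -> labelled inf D labN ->
  size c = size d ->
  (forall i, i < size c -> labM (nth x c i) = labN (nth y d i)) ->
  (forall i j, i < size c -> j < size c ->
     nth x c i = nth x c j <-> nth y d i = nth y d j) ->
  labM x = labN y ->
  (forall i, i < size c -> x = nth x c i <-> y = nth y d i) ->
  eqtp (x :: c) (y :: d).
Proof.
move=> hM hN e h k lxy xy; apply: (labelled_eqtp (a := x) (b := y) hL hM hN).
- by rewrite /= e.
- by case=> [|i] //= il; apply: h.
- case=> [|i] [|j] //= il jl; [exact: xy| |exact: k].
  by split=> /esym/(xy _ il)/esym.
Qed.

Lemma labelled_move (L : vocabulary) l (inf : pred 'I_l) D (hL : binary L)
    (M : structure L) (lab : M -> 'I_l) (c : seq M) (x y : M) :
  labelled inf D lab -> lab x = lab y -> ~ List.In x c -> ~ List.In y c ->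
  eqtp (x :: c) (y :: c).
Proof.
move=> h e nx ny.
have E i : i < size c -> nth x c i = nth y c i by move=> il; apply: set_nth_default.
apply: (labelled_eqtp_cons hL h h) => // [i il|i j il jl|i il].
- by rewrite E.
- by rewrite !E.
- by split=> ex; [case: nx; rewrite ex|case: ny; rewrite ex]; apply: nth_In.
Qed.

(** ** Definability *)

Section Definable.
Variable L : vocabulary.
Implicit Types (phi psi : formula L) (N : structure L).

Definition definable (vs : seq nat) (R : forall N : structure L, (nat -> N) -> Prop) :=
  exists phi, {subset fv phi <= vs} /\ forall N (v : nat -> N), sat phi v <-> R N v.

Lemma definable_ext vs (R S : forall N : structure L, (nat -> N) -> Prop) :
  (forall N v, R N v <-> S N v) -> definable vs R -> definable vs S.
Proof. by move=> RS [phi [h k]]; exists phi; split=> // N v; rewrite k RS. Qed.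

Lemma definable_prop vs (Q : Prop) : definable vs (fun _ _ => Q).
Proof.
case: (pselect Q) => q; [exists (ftrue L)|exists (FNot (ftrue L))]; split=> // N v.
  by split=> // _; apply: sat_true.
by split=> // h; case: h; apply: sat_true.
Qed.

Lemma definable_not vs R : definable vs R -> definable vs (fun N v => ~ R N v).
Proof. by move=> [phi [h k]]; exists (FNot phi); split=> // N v /=; rewrite k. Qed.

Lemma definable_and vs R S : definable vs R -> definable vs S ->
  definable vs (fun N v => R N v /\ S N v).
Proof.
move=> [phi [h k]] [psi [h' k']]; exists (FAnd phi psi); split=> [x|N v] /=.
  by rewrite mem_cat => /orP[/h|/h'].
by rewrite k k'.
Qed.

Lemma definable_imp vs R S : definable vs R -> definable vs S ->
  definable vs (fun N v => R N v -> S N v).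
Proof.
move=> hR hS; apply: definable_ext (definable_not (definable_and hR (definable_not hS))).
move=> N v; split=> [h r|h [r]]; last by apply; apply: h.
by apply: contrapT => s; apply: h.
Qed.

Lemma definable_iff vs R S : definable vs R -> definable vs S ->
  definable vs (fun N v => R N v <-> S N v).
Proof.
move=> hR hS; apply: definable_ext (definable_and (definable_imp hR hS) (definable_imp hS hR)).
by move=> N v; split=> -[].
Qed.

Lemma definable_forall vs (I : finType) R : (forall i : I, definable vs (R i)) ->
  definable vs (fun N v => forall i, R i N v).
Proof.
move=> /choice[phi hphi]; exists (fandl [seq phi i | i <- enum I]); split.
  move=> x /fv_andl[_ /List.in_map_iff[i [<- _]]]; exact: (hphi i).1.
move=> N v; rewrite sat_andl; split=> [h i|h _ /List.in_map_iff[i [<- _]]].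
  apply/(hphi i).2/h/List.in_map_iff; exists i; split=> //.
  by apply/In_mem; rewrite mem_enum.
exact/(hphi i).2.
Qed.

Lemma definable_all z vs (R : forall N : structure L, N -> (nat -> N) -> Prop) :
  (forall N (a : N) v w, {in vs, v =1 w} -> R N a v <-> R N a w) ->
  z \notin vs ->
  definable (z :: vs) (fun N v => R N (v z) v) ->
  definable vs (fun N v => forall a, R N a v).
Proof.
move=> ext zvs [phi [h k]]; exists (fall z phi); split=> [x|N v].
  rewrite /= mem_filter => /andP[xz /h]; rewrite inE; by rewrite (negPf xz).
rewrite sat_all.
have E a : sat phi (upd v z a) <-> R N a v.
  rewrite k updE eqxx; apply: ext => x xvs; rewrite updE.
  by case: eqP => // xz; rewrite -xz xvs in zvs.
by split=> h' a; [rewrite -E|rewrite E].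
Qed.

Lemma definable_eq vs x y : x \in vs -> y \in vs ->
  definable vs (fun N v => v x = v y).
Proof.
move=> xs ys; exists (FEq x y); split=> // z.
by rewrite !inE => /orP[] /eqP->.
Qed.

Lemma definable_atom vs (A : atom L) x y : x \in vs -> y \in vs ->
  definable vs (fun N v => holds_atom A (v x) (v y)).
Proof.
move=> xs ys; exists (atom_formula A x y); split=> [z /fv_atom|N v].
  by rewrite !inE => /orP[] /eqP->.
exact: sat_atom.
Qed.

Definition instance2 (xi : formula L) (x y : nat) : formula L :=
  subst (fun i => if i == 0 then x else y) xi.

Lemma sat_instance2 xi x y (N : structure L) (v : nat -> N) : scoped 2 xi ->
  sat (instance2 xi x y) v <-> holds2 xi (v x) (v y).
Proof.
move=> sc; rewrite sat_subst; symmetry; apply: holds_sat => // -[|[|]] //.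
Qed.

Lemma definable_instance2 vs xi x y : scoped 2 xi -> x \in vs -> y \in vs ->
  definable vs (fun N v => holds2 xi (v x) (v y)).
Proof.
move=> sc xs ys; exists (instance2 xi x y); split=> [z /fv_subst/mapP[i _ ->]|N v].
  by case: ifP.
exact: sat_instance2.
Qed.

End Definable.

(** * Labellings of all models *)

Lemma xvar_inj i j a b : xvar i a = xvar j b -> i = j /\ a = b.
Proof.
move=> [] /double_inj e.
have := pcan_inj (@pickleK (nat * nat)%type) e; by case.
Qed.

Lemma yvar_xvar k i a : (yvar k == xvar i a) = false.
Proof.
apply/negbTE/eqP => e; have := congr1 odd e.
by rewrite /yvar /xvar /= !odd_double.
Qed.

Lemma mem_xvars l (t : 'I_l -> nat) x :
  reflect (exists i a, a < t i /\ x = xvar (val i) a) (x \in xvars t).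
Proof.
apply: (iffP flatten_mapP) => [[i _ /mapP[a]]|[i [a [ai ->]]]].
  by rewrite mem_iota => /= ai ->; exists i, a.
exists i; first exact: mem_enum.
by apply: map_f; rewrite mem_iota.
Qed.

Lemma yvar_xvars k l (t : 'I_l -> nat) : yvar k \notin xvars t.
Proof.
by apply/mem_xvars => -[i [a [_ e]]]; have := yvar_xvar k (val i) a; rewrite e eqxx.
Qed.

Section Transfer.
Variables (L : vocabulary) (T : theory L) (M0 : structure L).
Hypotheses (hL : binary L) (cT : complete T) (mM0 : models M0 T).
Variables (xi : formula L) (l : nat) (lab0 : M0 -> 'I_l).
Hypothesis hp : homogeneous_partition xi lab0.

Definition inflab : pred 'I_l := fun i => `[< infinite_set [set b | lab0 b = i] >].

Definition table (A : atom L) (i j : 'I_l) (e : bool) : Prop :=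
  exists a b, [/\ lab0 a = i, lab0 b = j, a = b <-> e & holds_atom A a b].

Lemma base_labelled : labelled inflab table lab0.
Proof.
have [sxi surj xiE dich hom] := hp; split=> [i|A a b].
  rewrite /inflab; case: asboolP => // fi.
  have [a ea] := surj i; subst i; exists a => b; split=> [lb|->//].
  by case: (dich a) => [/fi|/(_ b lb)].
split=> [h|[a' [b' [ea eb e h]]]].
  by exists a, b; split=> //; split=> /asboolP.
have {}e : a' = b' <-> a = b by rewrite e; split=> /asboolP.
case: (pselect (a = b)) => ab; last first.
  by apply/(hom a' b' a b) => // /e.
have ab' : a' = b' by apply/e.
subst b b'; case: (pselect (a = a')) => [->//|aa'].
case: (dich a) => [ia|/(_ a' ea) e']; last by case: aa'.
have [c [/= lc nc]] := infinite_fresh [:: a; a'] ia.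
have ac : a <> c by move=> ac; apply: nc; left.
have ac' : a' <> c by move=> ac'; apply: nc; right; left.
(* What an atom says of a pair of equal elements is unary, and can be read off
   from a pair of distinct elements of the class. *)
pose U : atom L := existT _ (tag A) (map_tuple (fun=> false) (tagged A)).
have UE x y : holds_atom U x y <-> holds_atom A x x.
  rewrite /holds_atom /=.
  suff -> : map_tuple (fun c : bool => if c then y else x) (map_tuple (fun=> false) (tagged A)) =
    map_tuple (fun c : bool => if c then x else x) (tagged A) by [].
  by apply: val_inj; rewrite /= -map_comp; apply: eq_map => -[].
by apply/(UE M0 a c)/(hom a' c a c) => //; apply/UE.
Qed.

Let inf := inflab.
Let D := table.

(** [X i false] and [X i true] represent the class labelled [i], and are distinct
    if this class is infinite. *)
Definition represents (N : structure L) (X : 'I_l -> bool -> N) : Prop :=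
  [/\ forall i j al be, holds2 xi (X i al) (X j be) <-> i = j,
      forall i, X i false = X i true <-> ~~ inf i,
      (forall z, exists i, holds2 xi (X i false) z) /\
        (forall i z, ~~ inf i -> holds2 xi (X i false) z -> z = X i false),
      forall z z' i j, holds2 xi (X i false) z -> holds2 xi (X j false) z' ->
        (holds2 xi z z' <-> i = j)
    & forall z z' i j, holds2 xi (X i false) z -> holds2 xi (X j false) z' ->
        forall A : atom L, (z = z' -> (holds_atom A z z' <-> D A i j true)) /\
                   (z <> z' -> (holds_atom A z z' <-> D A i j false))].

Definition rep_count : 'I_l -> nat := fun=> 2.

Definition reps (N : structure L) (v : nat -> N) (i : 'I_l) (b : bool) : N :=
  v (xvar i b).

Lemma reps_ext (N : structure L) (v w : nat -> N) :
  {in xvars rep_count, v =1 w} -> reps v = reps w.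
Proof.
move=> e; apply/funext => i; apply/funext => b; apply: e.
by apply/mem_xvars; exists i, b; split=> //; case: b.
Qed.

Lemma represents_definable :
  definable (xvars rep_count) (fun N v => represents (reps v)).
Proof.
have [sxi _ _ _ _] := hp.
have xin (vs : seq nat) (i : 'I_l) (b : bool) :
    {subset xvars rep_count <= vs} -> xvar (val i) b \in vs.
  by apply; apply/mem_xvars; exists i, b; split=> //; case: b.
have sub0 : {subset xvars rep_count <= xvars rep_count} by [].
have sub1 : {subset xvars rep_count <= yvar 0 :: xvars rep_count}.
  by move=> x xs; rewrite inE xs orbT.
have sub2 : {subset xvars rep_count <= yvar 1 :: yvar 0 :: xvars rep_count}.
  by move=> x xs; rewrite !inE xs !orbT.
have ny1 : yvar 1 \notin yvar 0 :: xvars rep_count by rewrite inE negb_or yvar_xvars.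
have ny0 := yvar_xvars 0 rep_count.
pose R1 N (v : nat -> carrier N) := forall i j al be,
  holds2 xi (reps v i al) (reps v j be) <-> i = j.
have d1 : definable (xvars rep_count) R1.
  do 4 apply: definable_forall => ?.
  apply: definable_iff; last exact: definable_prop.
  by apply: definable_instance2; rewrite ?xin.
pose R2 N (v : nat -> carrier N) := forall i,
  reps v i false = reps v i true <-> ~~ inf i.
have d2 : definable (xvars rep_count) R2.
  apply: definable_forall => ?.
  apply: definable_iff; last exact: definable_prop.
  by apply: definable_eq; rewrite (xin _ _ false, xin _ _ true).
pose R3 N (v : nat -> carrier N) := forall z, exists i, holds2 xi (reps v i false) z.
have d3 : definable (xvars rep_count) R3.
  apply: (definable_all (z := yvar 0)
    (R := fun N z v => exists i, holds2 xi (reps v i false) z)) => //.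
    by move=> N a v w /reps_ext ->.
  apply: (definable_ext
    (R := fun N v => ~ forall i, ~ holds2 xi (reps v i false) (v (yvar 0)))).
    move=> N v; split=> [h|[i hi] h]; last exact: h hi.
    by apply: contrapT => h'; apply: h => i hi; apply: h'; exists i.
  apply: definable_not; apply: definable_forall => i; apply: definable_not.
  by apply: definable_instance2; rewrite ?(xin _ _ false) ?inE ?eqxx.
pose R4 N (v : nat -> carrier N) := forall z i, ~~ inf i ->
   holds2 xi (reps v i false) z -> z = reps v i false.
have d4 : definable (xvars rep_count) R4.
  apply: (definable_all (z := yvar 0)
    (R := fun N z v => forall i, ~~ inf i ->
       holds2 xi (reps v i false) z -> z = reps v i false)) => //.
    by move=> N a v w /reps_ext ->.
  apply: definable_forall => i; apply: definable_imp; first exact: definable_prop.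
  apply: definable_imp.
    by apply: definable_instance2; rewrite ?(xin _ _ false) ?inE ?eqxx.
  by apply: definable_eq; rewrite ?(xin _ _ false) ?inE ?eqxx.
pose S5 N (z z' : carrier N) (v : nat -> carrier N) := forall i j,
  holds2 xi (reps v i false) z -> holds2 xi (reps v j false) z' ->
  (holds2 xi z z' <-> i = j) /\
  forall A : atom L, (z = z' -> (holds_atom A z z' <-> D A i j true)) /\
             (z <> z' -> (holds_atom A z z' <-> D A i j false)).
pose R5 N (v : nat -> carrier N) := forall z z', S5 N z z' v.
have d5 : definable (xvars rep_count) R5.
  apply: (definable_all (z := yvar 0) (R := fun N z v => forall z', S5 N z z' v)) => //.
    by move=> N a v w /reps_ext e; rewrite /S5 e.
  apply: (definable_all (z := yvar 1) (R := fun N z' v => S5 N (v (yvar 0)) z' v)) => //.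
    move=> N a v w e; rewrite /S5 (@reps_ext N v w); last by move=> x xs; apply/e/sub1.
    by rewrite e // inE eqxx.
  have y0 : yvar 0 \in yvar 1 :: yvar 0 :: xvars rep_count by rewrite !inE eqxx orbT.
  have y1 : yvar 1 \in yvar 1 :: yvar 0 :: xvars rep_count by rewrite !inE eqxx.
  apply: definable_forall => i; apply: definable_forall => j.
  apply: definable_imp; first by apply: definable_instance2; rewrite ?(xin _ _ false).
  apply: definable_imp; first by apply: definable_instance2; rewrite ?(xin _ _ false).
  apply: definable_and.
    by apply: definable_iff; [exact: definable_instance2|exact: definable_prop].
  apply: definable_forall => A; apply: definable_and; apply: definable_imp.
  - exact: definable_eq.
  - by apply: definable_iff; [exact: definable_atom|exact: definable_prop].
  - by apply: definable_not; exact: definable_eq.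
  - by apply: definable_iff; [exact: definable_atom|exact: definable_prop].
apply: definable_ext (definable_and (definable_and d1 d2)
  (definable_and (definable_and d3 d4) d5)) => N v.
split=> [[[h1 h2] [[h3 h4] h5]]|[h1 h2 [h3 h4] h5 h6]].
  split=> //; first by split=> // i z; exact: h4.
  - by move=> z z' i j k k'; have [] := h5 z z' i j k k'.
  - by move=> z z' i j k k'; have [] := h5 z z' i j k k'.
split=> //; split; first by split=> // z i; exact: h4.
by move=> z z' i j k k'; split; [exact: h5|exact: h6].
Qed.

Lemma tuple_transfer (N1 N2 : structure L) n psi :
  models N1 T -> models N2 T -> scoped n psi ->
  (exists s : seq N1, size s = n /\ holds psi s) ->
  exists s : seq N2, size s = n /\ holds psi s.
Proof.
move=> m1 m2 sc.
have E (N : structure L) : (exists s : seq N, size s = n /\ holds psi s) <->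
    holds (iter n (@exf L) psi) ([::] : seq N).
  elim: n psi sc => [|n IH] psi sc.
    split=> [[s [/size0nil -> //]]|h]; by exists [::].
  rewrite iterSr -IH ?scoped_exf //; split=> [[[|a s] [//]]|[s [es]]].
    move=> [es] h; exists s; split=> //; apply/holds_exf; rewrite ?es //.
    by exists a.
  by move/holds_exf; rewrite es => /(_ sc)[a ha]; exists (a :: s); rewrite /= es.
have sc0 : scoped 0 (iter n (@exf L) psi).
  by elim: n psi sc {E} => // n IH psi sc; rewrite iterSr; apply: IH; exact: scoped_exf.
rewrite !E => h v.
have [a] := carrier_inhabited N1.
apply: (@complete_sat _ _ _ _ _ (fun=> a) _ cT m1 m2 sc0).
by move: (h (fun=> a)); apply sat_ext => x /(allP sc0).
Qed.

Lemma base_represents : exists X, @represents M0 X.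
Proof.
have [sxi surj xiE dich hom] := hp; have [bi bD] := base_labelled.
have /choice[x hx] := surj.
have /choice[y hy] : forall i, exists y, lab0 y = i /\ (x i = y <-> ~~ inf i).
  move=> i; have := bi i; rewrite -/inf; case: ifP => ii.
    move=> /(infinite_fresh [:: x i])[y [/= ly ny]]; exists y; split=> //.
    by split=> // xy; case: ny; left.
  by move=> _; exists (x i).
exists (fun i b => if b then y i else x i).
have lX i (b : bool) : lab0 (if b then y i else x i) = i.
  by case: b; [case: (hy i)|exact: hx].
split.
- by move=> i j al be; rewrite xiE !lX.
- by move=> i; case: (hy i).
- split=> [z|i z ii]; first by exists (lab0 z); rewrite xiE hx.
  rewrite xiE hx => /esym lz; have := bi i; rewrite -/inf (negPf ii) => -[a ha].
  by rewrite ((ha z).1 lz); apply/esym/ha.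
- by move=> z z' i j; rewrite !xiE !hx => -> ->.
- move=> z z' i j; rewrite !xiE !hx => -> -> A; rewrite bD.
  by split=> e; [rewrite asboolT|rewrite asboolF].
Qed.

Lemma model_represents (N : structure L) : models N T ->
  exists v : nat -> N, represents (reps v).
Proof.
move=> mN; have [phi [fphi hphi]] := represents_definable.
have sc : scoped 0 (exists_vars (xvars rep_count) phi).
  apply/allP => x; rewrite fv_exists_vars mem_filter => /andP[nx /fphi xin].
  by rewrite xin in nx.
have [X hX] := base_represents; have [a0] := carrier_inhabited M0.
have [v0 hv0] : exists v0 : nat -> M0, reps v0 = X.
  have /choice[v hv] : forall n, exists a, forall (i : 'I_l) (b : bool),
        n = xvar (val i) b -> a = X i b.
    move=> n; case: (pselect (exists (i : 'I_l) (b : bool), n = xvar (val i) b)).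
      move=> [i [b ->]]; exists (X i b) => j c /xvar_inj[/val_inj -> e].
      by move: e; case: b c => [] [].
    by move=> nn; exists a0 => i b e; case: nn; exists i, b.
  exists v; apply/funext => i; apply/funext => b; exact: hv.
have /(sat_exists_vars _ _ (fun=> a0)) h : exists w : nat -> M0,
    (forall y, y \notin xvars rep_count -> w y = a0) /\ sat phi w.
  exists (fun x => if x \in xvars rep_count then v0 x else a0); split.
    by move=> y /negPf ->.
  apply/hphi; rewrite (_ : reps _ = X) // -hv0; apply: reps_ext => x xs.
  by rewrite xs.
have [a1] := carrier_inhabited N.
have /sat_exists_vars[w [_ hw]] := complete_sat (fun=> a1) cT mM0 mN sc h.
by exists w; apply/hphi.
Qed.

(** That the classes are infinite or singletons is expressed by a scheme: no
    class with two elements is covered by [n] elements. *)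
Lemma class_infinite (N : structure L) (z z' : N) : models N T ->
  z <> z' -> holds2 xi z z' -> infinite_set [set b | holds2 xi z b].
Proof.
have [sxi surj xiE dich hom] := hp => mN zz' hz /finite_list[w hw].
pose n := size w.
pose chi := FAnd (subst (nth 0 [:: 1; 0]) xi) (subst (nth 0 (0 :: iota 3 n)) (freshf L n)).
pose psi := FAnd (FNot (FEq 0 1)) (FAnd xi (FNot (exf chi))).
have s1 : scoped n.+3 (subst (nth 0 [:: 1; 0]) xi) by apply: scoped_sub.
have hi : all (fun i => i < n.+3) (0 :: iota 3 n).
  by apply/allP => i; rewrite inE mem_iota => /orP[/eqP->//|/andP[_]]; rewrite addnC addn3.
have s2 : scoped n.+3 (subst (nth 0 (0 :: iota 3 n)) (freshf L n)).
  by apply: scoped_sub => //; rewrite /= size_iota; exact: scoped_fresh.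
have schi : scoped n.+3 chi by rewrite /scoped /= all_cat; apply/andP.
have spsi : scoped n.+2 psi.
  have sx := scoped_exf schi.
  by rewrite /scoped /= all_cat; apply/andP; split; [exact: scopedW sxi|exact: sx].
have psiE (K : structure L) (a b : K) s : size s = n ->
    holds psi [:: a, b & s] <-> [/\ a <> b, holds2 xi a b &
      forall y, holds2 xi a y -> List.In y s].
  move=> es; rewrite !holds_and !holds_not //; last first.
    by apply: scoped_exf; rewrite /= es.
  rewrite holds_exf /= ?es //.
  have e1 : holds (FEq 0 1) [:: a, b & s] <-> a = b.
    by split=> [/(_ (fun=> a))//|-> v].
  have e2 : holds xi [:: a, b & s] <-> holds2 xi a b.
    rewrite (holds_nth a); last exact: scopedW sxi.
    by symmetry; apply: holds_sat => // -[|[|]].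
  have e3 y : holds chi [:: y, a, b & s] <-> holds2 xi a y /\ ~ List.In y s.
    rewrite holds_and (@holds_sub _ _ _ _ _ a) //=.
    rewrite (@holds_sub _ _ _ _ _ a) /= ?es //; last first.
      by rewrite size_iota; exact: scoped_fresh.
    have -> : [seq nth a [:: y, a, b & s] i | i <- iota 3 n] = s.
      rewrite (iotaDl 3 0) -map_comp; apply: (@eq_from_nth _ a).
        by rewrite size_map size_iota es.
      move=> i; rewrite size_map size_iota => il.
      by rewrite (nth_map 0) ?size_iota // nth_iota.
    by rewrite -{1}es holds_fresh.
  rewrite e1 e2; split=> [[h1 [h2 h3]]|[h1 h2 h3]].
    split=> // y hy; apply: contrapT => ny; apply: h3; exists y; exact/e3.
  by do !split=> //; move=> [y /e3[hy]]; apply; apply: h3.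
have [|s []] := tuple_transfer mN mM0 spsi.
  by exists [:: z, z' & w]; split=> //; apply/psiE.
case: s => [|a [|b s]] //= [es] /psiE-/(_ es)[ab /xiE lab fin].
case: (dich a) => [|/(_ b (esym lab))/esym//]; apply.
by apply: (@list_finite _ _ s) => x lx; apply: fin; apply/xiE.
Qed.

Lemma represents_labelled (N : structure L) (X : 'I_l -> bool -> N) :
  models N T -> represents X ->
  exists lab : N -> 'I_l, [/\ labelled inf D lab,
    forall i b, lab (X i b) = i,
    forall a b, holds2 xi a b <-> lab a = lab b &
    forall i a, holds2 xi (X i false) a <-> lab a = i].
Proof.
move=> mN [h1 h2 [h3 h4] h5 h6]; have /choice[lab hlab] := h3.
have labE a b : holds2 xi a b <-> lab a = lab b by apply: h5.
have repE i a : holds2 xi (X i false) a <-> lab a = i.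
  split=> [ha|<-//]; apply/(h5 _ _ _ _ (hlab a) ha).
  by apply/labE.
have labX i b : lab (X i b) = i by apply/repE/h1.
exists lab; split=> //; split=> [i|A a b].
  case: ifP => ii; last first.
    exists (X i false) => b; split=> [lb|->]; last exact: labX.
    by apply: (h4 i); [rewrite ii|apply/repE].
  have -> : [set b | lab b = i] = [set b | holds2 xi (X i false) b].
    by apply/seteqP; split=> b /= /repE.
  apply: (class_infinite (z' := X i true)) => //; last exact/h1.
  by move/h2; rewrite ii.
have [e1 e2] := h6 a b _ _ (hlab a) (hlab b) A.
by case: asboolP.
Qed.

Lemma represents_elementary (M N : structure L) (f : M -> N) (v : nat -> M) :
  elementary f -> represents (reps v) -> represents (reps (f \o v)).
Proof.
move=> ef; have [phi [_ hphi]] := represents_definable.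
by rewrite -!hphi -elementary_sat.
Qed.

Definition model_labelling (N : structure L) (v : nat -> N) (lab : N -> 'I_l) : Prop :=
  [/\ labelled inf D lab, represents (reps v),
    forall i b, lab (reps v i b) = i,
    forall a b, holds2 xi a b <-> lab a = lab b &
    forall i a, holds2 xi (reps v i false) a <-> lab a = i].

Lemma model_labelling_exists (N : structure L) : models N T ->
  exists v lab, @model_labelling N v lab.
Proof.
move=> mN; have [v hv] := model_represents mN.
by have [lab [h1 h2 h3 h4]] := represents_labelled mN hv; exists v, lab.
Qed.

Lemma labelling_elementary (M N : structure L) (f : M -> N) v lab :
  elementary f -> models M T -> @model_labelling M v lab ->
  exists labN, @model_labelling N (f \o v) labN /\ forall a, labN (f a) = lab a.
Proof.
move=> ef mM [_ rv _ _ repE].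
have rv' := represents_elementary ef rv.
have [labN [h1 h2 h3 h4]] := represents_labelled ((elementary_models T ef).1 mM) rv'.
exists labN; split=> // a; apply/h4.
have [_ hf] := (eqtp_elementary f).1 ef [:: reps v (lab a) false; a].
have [sxi _ _ _ _] := hp.
by apply/(hf xi sxi)/repE.
Qed.

End Transfer.

(** * What a homogeneous partition implies *)

(** If [a] belongs to [A], then one of the dividing formulas that cover the
    type of [a] holds of [a], and the conjugates of its parameters over [A] do
    not affect this. *)
Lemma fork_new (L : vocabulary) (M : structure L) (A B : set M) (a : M) :
  type_forks A B a -> ~ A a.
Proof.
move=> [phi [b [Bb sc ha [N [f [m [psi [c [ef spsi cover div]]]]]]]]] Aa.
have [j hj] : exists j, holds (psi j) (f a :: c j).
  by apply: cover; exact: (ef phi (a :: b) sc).1 ha.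
have [N' [g [c' [k [eg tc' incons]]]]] := div j.
apply: (incons (iota 0 k)); rewrite ?iota_uniq ?size_iota //.
exists (g (f a)) => i _.
have hg : holds (psi j) (g (f a) :: map g (c j)) by exact: (eg (psi j) (f a :: c j) (spsi j)).1 hj.
have [es /(_ [:: g (f a)])] := (same_type_eqtp _ _ _).1 (tc' i).
case=> [|h1 h2]; first by apply/ForallP => x [<-|[]//]; exists (f a) => //; exists a.
have h := eqtp_rotate (conj h1 h2).
by apply: eqtp_holds (eqtp_sym h) _ hg; rewrite /= size_map.
Qed.

Section Consequences.
Variables (L : vocabulary) (T : theory L) (M0 : structure L).
Hypotheses (hL : binary L) (cT : complete T) (mM0 : models M0 T)
           (iM0 : infinite_set [set: M0]).
Variables (xi : formula L) (l : nat) (lab0 : M0 -> 'I_l).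
Hypothesis hp : homogeneous_partition xi lab0.

Let inf := inflab lab0.
Let D := table lab0.
Let labelling := model_labelling_exists cT mM0 hp.

Lemma infinite_label : exists i, inf i.
Proof.
have [i hi] := finite_index_fiber lab0 iM0; exists i; apply/asboolP.
by rewrite setTI in hi.
Qed.

Lemma card_classes (P : pred 'I_l) (M : structure L) v lab :
  @model_labelling _ _ xi _ lab0 M v lab ->
  [set [set b | lab b = i] | i in [set i | P i]] #= `I_#|P|.
Proof.
move=> [hl _ _ _ _].
pose F (i : 'I_#|P|) := [set b | lab b = enum_val i].
have -> : [set [set b | lab b = i] | i in [set i | P i]] = F @` setT.
  apply/seteqP; split=> [_ [i Pi <-]|_ [i _ <-]].
    by exists (enum_rank_in (Pi : i \in P) i) => //; rewrite /F enum_rankK_in.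
  by exists (enum_val i) => //; exact: (enum_valP i).
apply: (@card_eq_trans _ _ _ _ [set: 'I_#|P|]); last by rewrite card_eq_sym card_II.
apply: inj_card_eq => i j _ _ e; apply: enum_val_inj.
have [a ha] := labelled_surj (enum_val i) hl.
have Fja : F j a by rewrite -e; exact: ha.
by rewrite -ha; exact: Fja.
Qed.

Lemma classesE (M : structure L) v lab :
  @model_labelling _ _ xi _ lab0 M v lab ->
  classes xi = [set [set b | lab b = i] | i in [set i | predT i]].
Proof.
move=> [hl _ _ xiE _]; apply/seteqP; split=> [X [a ->]|_ [i _ <-]].
  exists (lab a) => //; apply/seteqP; split=> b /=; rewrite xiE; by move=> ->.
have [a <-] := labelled_surj i hl; exists a.
by apply/seteqP; split=> b /=; rewrite xiE; move=> ->.
Qed.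

Lemma partition_restricted :
  (#|inf| + #|[predC inf]|)%N = l /\
  restricted_equiv_with T xi #|inf| #|[predC inf]|.
Proof.
have el : (#|inf| + #|[predC inf]|)%N = l by rewrite cardC card_ord.
split=> //; have [sxi _ _ _ _] := hp; split=> // M mM.
have [v [lab hlab]] := labelling mM; have [hl _ _ xiE _] := hlab.
have cE := classesE hlab.
have cls (P : pred 'I_l) (Q : set (set M)) :
    (forall i, Q [set b | lab b = i] <-> P i) ->
    @classes L M xi `&` Q = [set [set b | lab b = i] | i in [set i | P i]].
  move=> PQ; rewrite cE; apply/seteqP; split=> [_ [[i _ <-] /PQ Pi]|_ [i /PQ Qi <-]].
    by exists i.
  by split=> //; exists i.
split.
- by split=> [a|a b|a b c]; rewrite !xiE //; move=> ->.
- rewrite cE el -[X in `I_X](card_ord l); exact: card_classes hlab.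
- rewrite (cls inf); first exact: card_classes hlab.
  move=> i; have := hl.1 i; rewrite /= -/inf; case: ifP => // ii [a ha]; split=> // h.
  case: h; apply: (@list_finite _ _ [:: a]) => x /= /ha ->; by left.
- rewrite (cls [predC inf]); first exact: card_classes hlab.
  move=> i; have := hl.1 i; rewrite /= -/inf; case: ifP => ii.
    move=> ni; split=> [h|]; [by case: ni; exists 1|].
    by change (is_true (~~ inf i) -> [set b | lab b = i] #= `I_1); rewrite ii.
  move=> [a ha]; split=> [_|_]; first by change (is_true (~~ inf i)); rewrite ii.
  rewrite (_ : [set b | _] = [set a]); first exact: card_set1.
  by apply/seteqP; split=> x /= /ha.
Qed.

(** Tuples of distinct elements of [X] agree in labels and equalities, also
    over parameters outside [X], so [labelled_eqtp] applies. *)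
Lemma partition_indiscernible (M : structure L) (X : set M) :
  models M T -> classes xi X -> indiscernible_set X (~` X).
Proof.
move=> mM [a0 eX]; have [v [lab [hl _ _ xiE _]]] := labelling mM.
have XE x : X x <-> lab x = lab a0 by rewrite eX /= xiE; split=> ->.
move=> n a b ai bi Xa Xb; apply/same_type_eqtp; split.
  by rewrite !size_codom.
move=> c Xc; rewrite -[c](map_nth_ord a0).
pose f (g : 'I_n -> M) (j : 'I_n + 'I_(size c)) : M :=
  match j with inl i => g i | inr i => nth a0 c i end.
pose idx := map inl (enum 'I_n) ++ map inr (enum 'I_(size c)).
have E g : codom g ++ [seq nth a0 c i | i : 'I_(size c) <- enum 'I_(size c)] =
    map (f g) idx.
  by rewrite /codom /image_mem map_cat -!map_comp.
rewrite !E; apply: (labelled_eqtp_map hL (f := f a) (g := f b) _ hl hl) => [[i|i]|[i|i] [j|j]] //=.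
- by rewrite (XE (a i)).1 // (XE (b i)).1.
- by split=> [/ai|/bi] ->.
- have nX : ~ X (nth a0 c j).
    by apply: (proj1 (ForallP _ _) Xc); exact: nth_In.
  by split=> e; case: nX; rewrite -e.
- have nX : ~ X (nth a0 c i).
    by apply: (proj1 (ForallP _ _) Xc); exact: nth_In.
  by split=> e; case: nX; rewrite e.
Qed.

(** A bijection between two models that respects labels is elementary, and
    countable models have such a bijection because corresponding classes have
    the same size. *)
Lemma partition_categorical : omega_categorical T.
Proof.
split.
  have [N [f [ef cN _]]] := @lowenheim_skolem L M0 [::].
  by exists N; split=> //; apply/(elementary_models T ef).
move=> M N mM mN cM cN.
have [v [labM [hM _ _ _ _]]] := labelling mM.
have [w [labN [hN _ _ _ _]]] := labelling mN.
have [b0] := carrier_inhabited N.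
have /choice[F hF] : forall i, exists F : M -> N,
    set_bij [set a | labM a = i] [set b | labN b = i] F.
  move=> i; apply: card_eq_bij => //; have := hM.1 i; have := hN.1 i.
  case: ifP => _ => [iN iM|[b hb] [a ha]].
    have cn (K : structure L) (A : set K) : countable [set: K] -> infinite_set A ->
        A #= [set: nat].
      by move=> cK iA; apply: eq_card_nat => //; apply: sub_countable cK; exact: card_leT.
    exact: card_eq_trans (cn _ _ cM iM) (card_esym (cn _ _ cN iN)).
  have -> : [set a | labM a = i] = [set a] by apply/seteqP; split=> x /= /ha.
  have -> : [set a | labN a = i] = [set b] by apply/seteqP; split=> x /= /hb.
  exact: card_eq_trans card_set1 (card_esym card_set1).
pose f a := F (labM a) a.
have labf a : labN (f a) = labM a by have [h _ _] := hF (labM a); exact: h.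
have fi : injective f.
  move=> a b e; have lab : labM a = labM b by rewrite -!labf e.
  have [_ h _] := hF (labM a); apply: h; rewrite ?inE //.
  by move: e; rewrite /f lab.
have bf : bijective f.
  apply: inj_surj_bijective fi _ => c.
  have [_ _ h] := hF (labN c); have [a /= la ea] := h c erefl.
  by exists a; rewrite /f la.
exists f; split=> // r t; apply: elementary_interp; apply/eqtp_elementary => s.
rewrite -{1}(map_id s); apply: (labelled_eqtp_map hL (f := id) (g := f) _ hM hN) => [a|a b].
  by rewrite labf.
by split=> [->|/fi].
Qed.

(** The type of a tuple over [A] only depends on its labels, on the equalities
    between its entries and on which entries lie in [A], so countably many codes
    are enough. *)
Lemma partition_stable : omega_stable T.
Proof.
move=> M A mM Anat n n0.
have /card_eqPle[/countable_injP[h hinj] _] := Anat.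
have [v [lab hlab]] := labelling mM.
pose code : countType := ({ffun 'I_n -> 'I_l} * {ffun 'I_n * 'I_n -> bool} *
  {ffun 'I_n -> option nat})%type.
pose spec (p : set (formula L * seq M)) (k : code) :=
  exists (N : structure L) (f : M -> N) (b : 'I_n -> N) (labN : N -> 'I_l),
  [/\ elementary f, p = tp f A (map b (enum 'I_n)),
      labelled inf D labN, forall a, labN (f a) = lab a &
      [/\ forall i, k.1.1 i = labN (b i), forall i j, k.1.2 (i, j) <-> b i = b j &
          forall i, if k.2 i is Some m then exists a, [/\ A a, h a = m & b i = f a]
                    else forall a, A a -> b i <> f a]].
have ex p : types A n p -> exists k, spec p k.
  move=> [N [f [b [ef sb ->]]]].
  have [labN [[hN _ _ _ _] labf]] := labelling_elementary cT mM0 hp ef mM hlab.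
  have [x0] := carrier_inhabited N.
  pose b' (i : 'I_n) := nth x0 b i.
  have /choice[o ho] : forall i, exists m : option nat,
      if m is Some m then exists a, [/\ A a, h a = m & b' i = f a]
      else forall a, A a -> b' i <> f a.
    move=> i; case: (pselect (exists a, A a /\ b' i = f a)) => [[a [Aa ea]]|na].
      by exists (Some (h a)), a.
    by exists None => a Aa ea; apply: na; exists a.
  exists ([ffun i => labN (b' i)], [ffun ij => `[< b' ij.1 = b' ij.2 >]], [ffun i => o i]).
  exists N, f, b', labN; split=> //.
    by rewrite -[in LHS](map_nth_ord x0 b); subst n.
  split=> [i|i j|i] /=; rewrite ffunE //=; first by split=> /asboolP.
  exact: ho.
have un p p' k : spec p k -> spec p' k -> p = p'.
  move=> [N [f [b [labN [ef -> hN lf [k1 k2 k3]]]]]].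
  move=> [N' [f' [b' [labN' [ef' -> hN' lf' [k1' k2' k3']]]]]].
  apply/tp_eqtp; first by rewrite !size_map.
  move=> c /Forall_sig[cs <-]; rewrite -(map_comp f) -(map_comp f').
  pose F (K : structure L) (b : 'I_n -> K) (f : M -> K) (j : 'I_n + {x | A x}) : K :=
    match j with inl i => b i | inr x => f (sval x) end.
  have E K (b0 : 'I_n -> carrier K) f0 : map b0 (enum 'I_n) ++ map (f0 \o sval) cs =
      map (F K b0 f0) (map inl (enum 'I_n) ++ map inr cs).
    by rewrite map_cat -!map_comp.
  have fA (K : structure L) (f0 : M -> K) (b0 : 'I_n -> K) i a : elementary f0 ->
      (forall i, if k.2 i is Some m then exists a, [/\ A a, h a = m & b0 i = f0 a]
                    else forall a, A a -> b0 i <> f0 a) ->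
      A a -> b0 i = f0 a <-> k.2 i = Some (h a).
    move=> ef0 /(_ i) hk Aa; split=> [e|e]; move: hk; last first.
      rewrite e => -[a1 [Aa1 /(hinj _ _ (mem_set Aa1) (mem_set Aa)) -> ]] //.
    case: (k.2 i) => [m [a1 [Aa1 <- e1]]|/(_ a Aa)//].
    by congr Some; congr h; apply: (elementary_inj ef0); rewrite -e1 -e.
  rewrite (E N b f) (E N' b' f'); apply: (labelled_eqtp_map hL (f := F N b f) (g := F N' b' f') _ hN hN').
    by move=> [i|x] /=; rewrite -?k1 -?k1' // lf lf'.
  move=> [i|[x Ax]] [j|[y Ay]] /=.
  - by rewrite -k2 -k2'.
  - by rewrite (fA _ _ _ i y ef k3 Ay) (fA _ _ _ i y ef' k3' Ay).
  - have := fA _ _ _ j x ef k3 Ax; have := fA _ _ _ j x ef' k3' Ax.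
    by move=> h1 h2; split=> /esym e; apply/esym; [apply/h1/h2|apply/h2/h1].
  - by split=> [/(elementary_inj ef)|/(elementary_inj ef')] ->.
apply: eq_card_nat.
  have /choice[F hF] : forall p, exists k : code, types A n p -> spec p k.
    move=> p; case: (pselect (types A n p)) => [/ex[k hk]|np]; first by exists k.
    have [i0 _] := infinite_label.
    by exists ([ffun=> i0], [ffun=> false], [ffun=> None]).
  apply/countable_injP; exists (pickle \o F) => p p' /set_mem tp /set_mem tp' /= e.
  apply: (un _ _ (F p)); first exact: hF.
  have -> : F p = F p' by apply: (pcan_inj (@pickleK code)).
  exact: hF.
have /infinite_inj[u [ui uA]] : infinite_set A.
  by move=> fA; apply: infinite_nat; apply: card_le_finite fA; have /card_eqPle[] := Anat.
apply: (inj_infinite (f := fun k => tp id A (nseq n (u k)))) => [k k' e|k]; last first.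
  exists M, id, (nseq n (u k)); split=> //; [exact: elementary_id|exact: size_nseq].
have sc : scoped (size (nseq n (u k)) + 1) (FEq 0 n : formula L).
  by rewrite size_nseq /scoped /= addn1 ltnS leqnn.
have hk (w : M) : holds (FEq 0 n) (nseq n w ++ [:: u k]) <-> w = u k.
  rewrite (holds_nth w) /=; last by move: sc; rewrite size_cat !size_nseq.
  by rewrite !nth_cat size_nseq n0 ltnn subnn nth_nseq n0.
have : tp id A (nseq n (u k)) (FEq 0 n, [:: u k]).
  by split=> //=; [apply/ForallP => x [<-|[]]|apply/hk].
by rewrite e => -[_ _ /hk /ui].
Qed.

Definition single_formula : formula L :=
  FNot (exf (FAnd (instance2 xi 1 0) (FNot (FEq 0 1)))).

Lemma scoped_single : scoped 1 single_formula.
Proof.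
apply: (@scoped_exf _ 1); rewrite /scoped /= all_cat; apply/andP; split=> //.
by apply/allP => x /fv_subst/mapP[i _ ->]; case: ifP.
Qed.

Lemma holds_single (M : structure L) v lab (x : M) :
  @model_labelling _ _ xi _ lab0 M v lab ->
  holds single_formula [:: x] <-> ~~ inf (lab x).
Proof.
move=> [hl _ _ xiE _]; have [sxi _ _ _ _] := hp.
have sc : scoped 2 (FAnd (instance2 xi 1 0) (FNot (FEq 0 1))).
  rewrite /scoped /= all_cat; apply/andP; split=> //.
  by apply/allP => y /fv_subst/mapP[i _ ->]; case: ifP.
have E y : holds (FAnd (instance2 xi 1 0) (FNot (FEq 0 1))) [:: y; x] <->
    lab x = lab y /\ y <> x.
  rewrite (holds_nth x) //= sat_instance2 //= xiE; by [].
rewrite holds_not ?scoped_exf // holds_exf //.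
have := hl.1 (lab x); rewrite -/inf; case: ifP => _; first move=> ic; last case=> a ha.
  split=> // ny; case: ny; have [y [/= ly ny]] := infinite_fresh [:: x] ic.
  exists y; apply/E; split=> // yx; apply: ny; by left.
split=> // _ [y /E[/esym/ha -> ]]; by case; apply/esym/ha.
Qed.

(** An element of an infinite class that is not among the parameters has
    infinitely many conjugates over them, while those of the finitely many
    singleton classes are algebraic over the empty set. *)
Lemma partition_trivial : trivial_pregeometry T.
Proof.
move=> M mM X; have [v [lab hlab]] := labelling mM.
have [hl _ labX _ _] := hlab.
apply/seteqP; split=> [a [phi [c [Xc sc ha /finite_list[s hs]]]]|a [Xa|]]; last first.
- move=> [phi [[|x c] [Hc sc ha f]]]; last by case: (List.Forall_inv Hc).
  by exists phi, [::]; split=> //; exact: List.Forall_nil.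
- exists (FEq 0 1), [:: a]; split=> //; first by apply/ForallP => x [<-|[]].
  by apply: (@list_finite _ _ [:: a]) => x /(_ (fun=> a)) /= ->; left.
case: (pselect (List.In a c)) => ac.
  by left; apply: (proj1 (ForallP _ _) Xc).
have := hl.1 (lab a); case: ifP => ia => [ic|_].
  have [b [/= lb nb]] := infinite_fresh (s ++ c) ic.
  exfalso; apply: (nb); apply/In_cat; left; apply: hs.
  have nbc : ~ List.In b c by move=> bc; apply: nb; apply/In_cat; right.
  by apply: eqtp_holds ha => //; apply: (labelled_move hL hl).
right; exists single_formula, [::]; split; first exact: List.Forall_nil.
- exact: scoped_single.
- by apply/(holds_single _ hlab); rewrite /inf ia.
apply: (@list_finite _ _ [seq reps v i false | i <- enum 'I_l]) => x.
move=> /(holds_single _ hlab) ix; apply/List.in_map_iff; exists (lab x); split.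
  have := hl.1 (lab x); rewrite -/inf (negPf ix) => -[y hy].
  exact: etrans ((hy _).1 (labX (lab x) false)) (esym ((hy x).1 erefl)).
by apply/In_mem; rewrite mem_enum.
Qed.

(** A formula that holds of some element outside its parameters [c], or of some
    element of a singleton class, does not divide: among infinitely many
    conjugates of [c], infinitely many have the same labels, and those have a
    common solution. *)
Lemma not_divides (N : structure L) (A : set N) psi (c : seq N) (x : N) :
  models N T -> scoped (size c).+1 psi -> holds psi (x :: c) ->
  holds single_formula [:: x] \/ ~ List.In x c ->
  ~ divides A psi c.
Proof.
move=> mN sc hx hxc [N' [g [c' [k [eg tc' incons]]]]].
have mN' : models N' T by apply/(elementary_models T eg).
have [v [lab hlab]] := labelling mN'; have [hl _ _ _ _] := hlab.
pose n := size c.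
have ss : scoped 1 single_formula by exact: scoped_single.
pose chi := FAnd psi (FNot (FAnd (FNot single_formula) (FNot (freshf L n)))).
have s1 : scoped n.+1 single_formula by apply: scopedW ss.
have schi : scoped n.+1 chi.
  by rewrite /scoped /= !all_cat; apply/and3P; split=> //; exact: scoped_fresh.
have chiE (K : structure L) (y : K) d : size d = n ->
    holds chi (y :: d) <-> holds psi (y :: d) /\ (holds single_formula [:: y] \/ ~ List.In y d).
  move=> ed; rewrite holds_and holds_not /=; last first.
    by rewrite ed /scoped /= all_cat; apply/andP; split=> //; exact: scoped_fresh.
  have n1 : holds (FNot single_formula) (y :: d) <-> ~ holds single_formula (y :: d).
    by apply: holds_not; rewrite /= ed.
  have n2 : holds (FNot (freshf L n)) (y :: d) <-> ~ holds (freshf L n) (y :: d).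
    by apply: holds_not; rewrite /= ed; exact: scoped_fresh.
  rewrite holds_and n1 n2 -{1}ed holds_fresh.
  have -> : holds single_formula (y :: d) <-> holds single_formula [:: y].
    rewrite (holds_nth y) /= ?ed //; symmetry; apply: holds_sat => // -[|] //.
  split=> -[h1 h2]; split=> //.
    apply: contrapT => h3; apply: h2; split=> h4; apply: h3; [by left|by right].
  by case: h2 => [h2 [h3 _]|h2 [_ h3]].
have ec' i : eqtp (c' i) (map g c).
  have [e /(_ [::] (List.Forall_nil _))] := (same_type_eqtp _ _ _).1 (tc' i).
  by rewrite !cats0.
have sc' i : size (c' i) = n by case: (ec' i); rewrite size_map.
have /choice[y hy] : forall i, exists y, holds chi (y :: c' i).
  move=> i; apply: (eqtp_ex (eqtp_sym (ec' i))); first by rewrite size_map.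
  by exists (g x); apply: (eg chi (x :: c) schi).1; apply/chiE.
pose kap i : {ffun 'I_n -> 'I_l} := [ffun p : 'I_n => lab (nth (y 0) (c' i) p)].
have fk : finite_index (fun i j => kap i = kap j) by exists _, kap.
have [u [ui hu]] := monochromatic id fk.
have labc i p : p < n -> lab (nth (y 0) (c' (u i)) p) = lab (nth (y 0) (c' (u 0)) p).
  move=> pn; have := hu i 0; move/(congr1 (fun f : {ffun _} => f (Ordinal pn))).
  by rewrite !ffunE.
have eqc i p q : p < n -> q < n -> nth (y 0) (c' (u i)) p = nth (y 0) (c' (u i)) q <->
    nth (y 0) (c' (u 0)) p = nth (y 0) (c' (u 0)) q.
  move=> pn qn.
  have e := eqtp_trans (ec' (u i)) (eqtp_sym (ec' (u 0))).
  have := eqtp_sub (y 0) (y 0) (idx := [:: p; q]) e.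
  rewrite /= sc' pn qn => /(_ isT) /eqtp_In /= [H1 H2].
  by split=> h; [case: (H1 (or_introl (esym h)))|case: (H2 (or_introl (esym h)))].
have /chiE-/(_ (sc' (u 0)))[hz hzc] := hy (u 0); set z := y (u 0) in hz hzc.
have key w i : lab z = lab w ->
    (forall p, p < n -> z = nth (y 0) (c' (u 0)) p <-> w = nth (y 0) (c' (u i)) p) ->
    holds psi (w :: c' (u i)).
  move=> lw hw; apply: eqtp_holds hz; last by rewrite /= sc'.
  have def j t p : p < n -> nth t (c' (u j)) p = nth (y 0) (c' (u j)) p.
    by move=> pn; apply: set_nth_default; rewrite sc'.
  apply: (labelled_eqtp_cons hL hl hl).
  - by rewrite !sc'.
  - by move=> p; rewrite sc' => pn; rewrite !def // labc.
  - by move=> p q; rewrite sc' => pn qn; rewrite !def // (eqc i).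
  - exact: lw.
  - by move=> p; rewrite sc' => pn; rewrite !def // hw.
have /= := hl.1 (lab z); case: ifP => iz.
  move=> ic.
  have nz : ~ List.In z (c' (u 0)).
    by case: hzc => // /(holds_single _ hlab); rewrite /inf iz.
  have [w [/= lw nw]] := infinite_fresh (flatten [seq c' (u i) | i <- iota 0 k]) ic.
  apply: (incons [seq u i | i <- iota 0 k]).
  - by rewrite map_inj_uniq ?iota_uniq.
  - by rewrite size_map size_iota.
  exists w => _ /mapP[i + ->]; rewrite mem_iota => /= ik.
  apply: key => // p pn; split=> e.
    by case: nz; rewrite e; apply: nth_In; rewrite sc'.
  case: nw; rewrite e.
  have : List.In i (iota 0 k) by apply/In_mem; rewrite mem_iota.
  elim: (iota 0 k) => //= j s IH [->|/IH ?]; apply/In_cat; [left|by right].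
  by apply: nth_In; rewrite sc'.
move=> [w hw].
apply: (incons [seq u i | i <- iota 0 k]).
- by rewrite map_inj_uniq ?iota_uniq.
- by rewrite size_map size_iota.
exists z => _ /mapP[i _ ->]; apply: key => // p pn.
have E t : z = t <-> lab t = lab z.
  by split=> [->//|lt]; rewrite ((hw z).1 erefl) ((hw t).1 lt).
by rewrite !E labc.
Qed.

(** Otherwise [a] has a conjugate over [b] outside the parameters of the
    dividing formulas, or belongs to a singleton class; in both cases
    [not_divides] applies. *)
Lemma fork_old (M : structure L) (A B : set M) (a : M) :
  models M T -> type_forks A B a -> B a.
Proof.
move=> mM [phi [b [Bb sc ha [N [f [m [psi [c [ef spsi cover div]]]]]]]]].
apply: contrapT => nB.
have [v [lab hlab]] := labelling mM; have [hl _ _ _ _] := hlab.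
have [labN [hlabN labf]] := labelling_elementary cT mM0 hp ef mM hlab.
have [hN _ _ _ _] := hlabN.
have mN : models N T by apply/(elementary_models T ef).
have nab : ~ List.In a b by move=> ab; apply: nB; exact: (proj1 (ForallP _ _) Bb).
have nfab : ~ List.In (f a) (map f b).
  by move=> /List.in_map_iff[x [/(elementary_inj ef) -> ]].
have hfa : holds phi (f a :: map f b) by exact: (ef phi (a :: b) sc).1 ha.
pose cs := flatten [seq c j | j <- enum 'I_m].
have [x [lx nx hx]] : exists x, [/\ labN x = labN (f a), ~ List.In x (map f b) &
    holds single_formula [:: x] \/ ~ List.In x cs].
  have := hN.1 (labN (f a)); case: ifP => ia => [ic|_].
    have [x [/= lx nx]] := infinite_fresh (map f b ++ cs) ic.
    by exists x; split=> //; [|right] => h; apply: nx; apply/In_cat; [left|right].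
  exists (f a); split=> //; left; apply/(holds_single _ hlabN).
  by rewrite /inf ia.
have [j hj] : exists j, holds (psi j) (x :: c j).
  apply: cover; apply: eqtp_holds hfa; last by rewrite /= size_map.
  exact: (labelled_move hL hN).
apply: (not_divides mN (spsi j) hj _ (div j)).
case: hx => [|nc]; [by left|right => xc; apply: nc].
rewrite /cs; have : List.In j (enum 'I_m) by apply/In_mem; rewrite mem_enum.
elim: (enum 'I_m) => //= i s IH [->|/IH ?]; apply/In_cat; [by left|by right].
Qed.

(** A forking extension of a type makes its realisation a parameter, which can
    be done only once. *)
Lemma partition_rank : SU_rank_eq T 1.
Proof.
split; last first.
  move=> M A a mM [N [f [B [ef _ fk [N' [g [B' [eg _ fk' _]]]]]]]].
  have mN : models N T by apply/(elementary_models T ef).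
  by case: (fork_new fk'); exists (f a) => //; apply: fork_old fk.
have [v [lab hlab]] := labelling mM0; have [hl _ _ _ _] := hlab.
have [i ii] := infinite_label.
have := hl.1 i; rewrite -/inf ii => /infinite_inj[u [ui ul]].
exists M0, set0, (u 0); split=> //.
exists M0, id, [set u 0]; rewrite image_id; split=> //; first exact: elementary_id.
exists (FEq 0 1), [:: u 0]; split=> //; first by apply/ForallP => x [<-|[]].
exists M0, id, 1, (fun=> FEq 0 1), (fun=> [:: u 0]); rewrite image_id; split=> //.
- exact: elementary_id.
- by move=> x hx; exists ord0.
move=> _; exists M0, id, (fun i => [:: u i]), 2; rewrite image_id; split=> //.
- exact: elementary_id.
- move=> n; apply/same_type_eqtp0; apply: (labelled_move hL hl) => //.
  by rewrite /= in ul; rewrite !ul.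
case=> [//|n [//|p [|//]]] + _ [x hx]; rewrite /= inE andbT => /eqP; apply.
have en : holds (FEq 0 1) [:: x; u n] by apply: hx; rewrite inE eqxx.
have ep : holds (FEq 0 1) [:: x; u p] by apply: hx; rewrite !inE eqxx orbT.
apply: ui; exact: etrans (esym (en (fun=> x))) (ep (fun=> x)).
Qed.

End Consequences.

(** * Partitions from conditions (ii) and (iii) *)

Section Converses.
Variables (L : vocabulary) (T : theory L) (M : structure L).
Hypotheses (mM : models M T).
Variable xi : formula L.
Hypothesis hxi : restricted_equiv T xi.

(** The numbers of infinite and of singleton classes add up to the number of
    all classes, so there are no others. *)
Lemma partition_of_moves :
  (forall a a' b : M, a <> b -> a' <> b -> holds2 xi a a' ->
     forall A : atom L, holds_atom A a b <-> holds_atom A a' b) ->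
  exists l (lab : M -> 'I_l), homogeneous_partition xi lab.
Proof.
move=> mv; have [k [t [sxi /(_ M mM)[eqv cl cinf csing]]]] := hxi.
have [rf _ _] := eqv.
have fi : finite_index (@holds2 L M xi).
  have fc : finite_set (@classes L M xi) by exists (k + t)%N.
  apply: finite_index_sub (finite_index_sets fc) => a b h.
  by apply: (h [set c | holds2 xi a c]); [exists a|exact: rf].
have [l [lab [surj labE]]] := finite_index_labels eqv fi.
have dich a : infinite_set [set b | lab b = lab a] \/
              forall b, lab b = lab a -> b = a.
  have e : [set b | lab b = lab a] = [set b | holds2 xi a b].
    by apply/seteqP; split=> b /=; rewrite -labE => ->.
  have dis (X : set M) : infinite_set X -> ~ (X #= `I_1) by move=> iX cX; apply: iX; exists 1.
  have [|i|s] := card_eq_cover set0 cl cinf csing dis (x := [set b | lab b = lab a]).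
  - by rewrite e; exists a.
  - by left.
  right=> b lb; have /(card_eq_bij a)[f [_ _ fs]] := card_esym (s : _ #= `I_1).
  have [i /= i0 <-] := fs b lb; have [j /= j0 <-] := fs a erefl.
  by case: i j i0 j0 => [|i] [|j].
exists l, lab; split=> //; first by move=> a b; rewrite labE.
by apply: homogeneous_of_moves => // a a' b ab a'b /labE; exact: mv.
Qed.

(** A single element of [X] is moved over the parameter [b] if [b] is outside
    [X], and together with [b] otherwise. *)
Lemma partition_of_indiscernible :
  (forall X : set M, classes xi X -> indiscernible_set X (~` X)) ->
  exists l (lab : M -> 'I_l), homogeneous_partition xi lab.
Proof.
move=> ind; have [k [t [sxi /(_ M mM)[eqv _ _ _]]]] := hxi.
have [rf sy tr] := eqv.
apply: partition_of_moves => a a' b ab a'b aa' A.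
pose X := [set x | holds2 xi a x].
have cX : classes xi X by exists a.
have Xa : X a by exact: rf.
have use (s s' c : seq M) : size s = size s' ->
    (forall i j, i < size s -> j < size s -> nth a s i = nth a s j -> i = j) ->
    (forall i j, i < size s' -> j < size s' -> nth a s' i = nth a s' j -> i = j) ->
    List.Forall X s -> List.Forall X s' -> List.Forall (~` X) c -> eqtp (s ++ c) (s' ++ c).
  move=> es us us' Xs Xs' Xc.
  pose f (i : 'I_(size s)) := nth a s i; pose f' (i : 'I_(size s)) := nth a s' i.
  have cf : codom f = s by exact: (map_nth_ord a s).
  have cf' : codom f' = s'.
    by rewrite /f' /codom /image_mem es; exact: (map_nth_ord a s').
  have [||||_] := (same_type_eqtp _ _ _).1 (ind X cX (size s) f f' _ _ _ _).
  - by move=> i j /us e; apply: val_inj; apply: e.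
  - by move=> i j /us' e; apply: val_inj; apply: e; rewrite -es.
  - by move=> i; apply: (proj1 (ForallP _ _) Xs); exact: nth_In.
  - by move=> i; apply: (proj1 (ForallP _ _) Xs'); apply: nth_In; rewrite -es.
  by rewrite cf cf' => /(_ c Xc).
have sA : scoped 2 (atom_formula A 0 1) by exact: scoped_atom.
suff [_ /(_ _ sA)] : eqtp [:: a; b] [:: a'; b] by rewrite !holds_atom_formula.
case: (pselect (X b)) => Xb.
  apply: (use [:: a; b] [:: a'; b] [::]) => //.
  - by move=> [|[|//]] [|[|//]] //= _ _ e; case: ab.
  - by move=> [|[|//]] [|[|//]] //= _ _ e; case: a'b.
  - by apply/ForallP => x [<-|[<-|[]]].
  - by apply/ForallP => x [<-|[<-|[]]].
apply: (use [:: a] [:: a'] [:: b]) => //.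
- by move=> [|//] [|//].
- by move=> [|//] [|//].
- by apply/ForallP => x [<-|[]].
- by apply/ForallP => x [<-|[]].
- by apply/ForallP => x [<-|[]].
Qed.

(** An extension axiom for the triple of [a], [a'] and [b] describes its
    diagram by labels of the three elements, and equivalent elements have the
    same label. *)
Lemma partition_of_extension l (delta : 'I_l -> 'I_l -> set (set (formula L))) :
  diagram_family delta -> xi_extension_properties T xi delta ->
  exists l (lab : M -> 'I_l), homogeneous_partition xi lab.
Proof.
move=> hd [_ [ik [theta [theta' [[t [g0 [gspec _ c3 c4]]] [_ _ _ ext]]]]]].
have [k [t0 [sxi /(_ M mM)[[rf sy tr] _ _ _]]]] := hxi.
apply: partition_of_moves => a a' b ab a'b aa' A.
case: (pselect (a = a')) => [->//|naa'].
pose v n := nth a [:: a; a'; b] n./2.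
have vE (r : nat) : v (yvar r) = nth a [:: a; a'; b] r by rewrite /v /yvar doubleK.
have [sig _ _ _] := ext 3.
have [|i] := sig M mM v.
  move=> [r rl] [s sl]; rewrite /= !vE => e; apply: val_inj => /=.
  by case: r s rl sl e => [|[|[|//]]] [|[|[|//]]] //= _ _ e;
    first [case: naa'; done | case: ab; done | case: a'b; done].
have [_ _ eqv] := c4 3 i; move/eqv/sat_exists_vars => [w [ew [hg ht]]].
have wE r : w (yvar r) = nth a [:: a; a'; b] r by rewrite ew ?vE // yvar_xvars.
have [js [eta [_ spec]]] := c3 3 i.
have [hdg hx] := spec M w ht.
have [_ gs] := gspec; have {}gs := gs M w hg.
have tpos j : 0 < t j.
  have [[d dd] _] := hd j j; move: dd; have [<- _] := gs j j.
  by move=> [al [be [h _ _ _]]]; apply: leq_ltn_trans h.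
have e01 : js ord0 = js (inord 1).
  have [_ h] := gs (js ord0) (js (inord 1)).
  apply/(h 0 0 (tpos _) (tpos _)).
  apply: tr (sy _ _ (hx ord0)) (tr _ _ _ _ (hx (inord 1))).
  by rewrite !wE inordK.
have /(congr1 (fun d => d (atom_formula A 0 1))) :
    atDiag [:: a; b] = atDiag [:: a'; b].
  have := hdg ord0 (inord 2); have := hdg (inord 1) (inord 2).
  rewrite !wE !inordK //= -e01 => h1 h2.
  by rewrite h1 ?h2 // -val_eqE /= ?inordK.
have sA : scoped 2 (atom_formula A 0 1) by exact: scoped_atom.
have E (x y : M) : atDiag [:: x; y] (atom_formula A 0 1) <-> holds_atom A x y.
  by rewrite -holds_atom_formula; split=> [[]|].
by rewrite -!E => ->.
Qed.

End Converses.

(** * Extension axioms for a homogeneous partition *)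

Section Syntax.
Variable L : vocabulary.
Implicit Types (phi psi : formula L) (M N : structure L).

Lemma eqtp_atDiag M N (s : seq M) (s' : seq N) : eqtp s s' -> atDiag s = atDiag s'.
Proof.
move=> [e h]; apply/seteqP; split=> phi [lit sc hp]; split=> //.
- by rewrite -e.
- exact/h.
- by rewrite e.
- by apply/h => //; rewrite e.
Qed.

Lemma atDiag_pair M N (a b : M) (a' b' : N) :
  (a = b <-> a' = b') ->
  (forall A : atom L, holds_atom A a b <-> holds_atom A a' b') ->
  atDiag [:: a; b] = atDiag [:: a'; b'].
Proof.
move=> e hA.
have K phi : atomic phi -> scoped 2 phi -> holds phi [:: a; b] <-> holds phi [:: a'; b'].
  case: phi => // [x y _|r t _] sc.
    rewrite (holds_nth a) // (holds_nth a') //=.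
    move: sc => /and3P[]; case: x => [|[|//]] _; case: y => [|[|//]] _ _ //=.
    by split=> /esym/e/esym.
  pose A : atom L := existT _ r (map_tuple (fun i => i == 1) t).
  have E (K : structure L) (x y : K) : holds (FRel t) [:: x; y] <-> holds_atom A x y.
    rewrite (holds_nth x) //= /holds_atom /=.
    suff -> : map_tuple (nth x [:: x; y]) t =
      map_tuple (fun c : bool => if c then y else x) (map_tuple (fun i => i == 1) t) by [].
    apply: val_inj; rewrite /= -map_comp; apply/eq_in_map => i /(allP sc).
    by case: i => [|[|]].
  by rewrite !E.
apply/seteqP; split=> phi [lit sc hp]; split=> //; move: lit sc hp;
  case: phi => // [x y|r t|psi] at_ sc; try exact: (K _ at_ sc).1; try exact: (K _ at_ sc).2.
  by rewrite !holds_not // => h h'; apply: h; apply/(K _ at_ sc).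
by rewrite !holds_not // => h h'; apply: h; apply/(K _ at_ sc).
Qed.

Lemma vars_andl (l : seq (formula L)) x : x \in vars (fandl l) ->
  x = 0 \/ exists2 phi, List.In phi l & x \in vars phi.
Proof.
elim: l => [|phi l IH] /=; first by rewrite !inE !orbb => /eqP; left.
rewrite mem_cat => /orP[xp|/IH[->|[psi pl xp]]]; [right|by left|right].
  by exists phi; [left|].
by exists psi; [right|].
Qed.

Fixpoint binders (u : nat) phi : nat :=
  match phi with
  | FEq _ _ => 0
  | FRel _ _ => 0
  | FNot psi => binders u psi
  | FAnd psi1 psi2 => binders u psi1 + binders u psi2
  | FEx x psi => (x == u) + binders u psi
  end.

Lemma binders0 u phi : u \notin vars phi -> binders u phi = 0.
Proof.
elim: phi => //= [psi1 IH1 psi2 IH2|x psi IH].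
  by rewrite mem_cat negb_or => /andP[/IH1 -> /IH2 ->].
by rewrite inE negb_or eq_sym => /andP[/negPf -> /IH ->].
Qed.

Lemma binders_sub u phi psi : subformula phi psi -> binders u phi <= binders u psi.
Proof.
elim: psi => [x y|r t|psi IH|psi1 IH1 psi2 IH2|x psi IH] /= [->//|] //.
  by case=> [/IH1 h|/IH2 h]; apply: leq_trans h _; rewrite ?leq_addr ?leq_addl.
by move=> /IH h; apply: leq_trans h _; exact: leq_addl.
Qed.

End Syntax.

Section Extension.
Variables (L : vocabulary) (T : theory L) (M0 : structure L).
Hypotheses (hL : binary L) (cT : complete T) (mM0 : models M0 T)
           (iM0 : infinite_set [set: M0]).
Variables (xi : formula L) (l : nat) (lab0 : M0 -> 'I_l).
Hypothesis hp : homogeneous_partition xi lab0.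

Let inf := inflab lab0.
Let D := table lab0.
Let labelling := model_labelling_exists cT mM0 hp.

Let sxi : scoped 2 xi.
Proof. by case: hp. Qed.

Lemma rep_equal (N : structure L) (X : 'I_l -> bool -> N) i j al be :
  represents xi lab0 X -> (i, al) <> (j, be) ->
  X i al = X j be <-> i = j /\ ~~ inf i.
Proof.
move=> [h1 h2 _ _ _] ne; split=> [e|[ij ii]].
  have ij : i = j by apply/(h1 i j al be); rewrite -e; apply/h1.
  split=> //; subst j; apply/h2.
  by case: al be ne e => [] [].
by subst j; move/(h2 i): ii; case: al be ne => [] [].
Qed.

Lemma rep_diag (M N : structure L) (X : 'I_l -> bool -> M) (Y : 'I_l -> bool -> N)
    i j al be al' be' :
  represents xi lab0 X -> represents xi lab0 Y ->
  (i, al) <> (j, be) -> (i, al') <> (j, be') ->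
  atDiag [:: X i al; X j be] = atDiag [:: Y i al'; Y j be'].
Proof.
move=> hX hY ne ne'.
have e : X i al = X j be <-> Y i al' = Y j be' by rewrite !rep_equal.
apply: atDiag_pair => // A.
have [h1 _ _ _ hA] := hX; have [h1' _ _ _ hA'] := hY.
have [t1 t2] := hA (X i al) (X j be) i j ((h1 i i _ _).2 erefl) ((h1 j j _ _).2 erefl) A.
have [t1' t2'] := hA' (Y i al') (Y j be') i j ((h1' i i _ _).2 erefl) ((h1' j j _ _).2 erefl) A.
case: (pselect (X i al = X j be)) => eX; first by rewrite t1 // t1' //; apply/e.
by rewrite t2 // t2' // => /e.
Qed.

Let v0 : nat -> M0 := projT1 (cid (labelling mM0)).
Let rep0 : represents xi lab0 (reps v0).
Proof. by rewrite /v0; case: cid => v /= [lab []]. Qed.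

Definition pair_diagram (i j : 'I_l) : set (formula L) :=
  atDiag [:: reps v0 i false; reps v0 j true].

Let i0 : 'I_l := projT1 (cid (infinite_label iM0 lab0)).
Let inf_i0 : inf i0.
Proof. by rewrite /i0; case: cid. Qed.

Let gamma0 : formula L := projT1 (cid (represents_definable hp)).

Let fv_gamma0 : {subset fv gamma0 <= xvars (@rep_count l)}.
Proof. by rewrite /gamma0; case: cid => phi []. Qed.

Let sat_gamma0 (N : structure L) (v : nat -> N) :
  sat gamma0 v <-> represents xi lab0 (reps v).
Proof. by rewrite /gamma0; case: cid => phi /= [_ h]; exact: h. Qed.

(** In a singleton class the two representatives coincide, and the diagram is
    that of an equal pair. *)
Lemma pair_diagram_spec :
  gamma0_spec xi (fun i j => [set pair_diagram i j]) (@rep_count l) gamma0.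
Proof.
split=> // M v /sat_gamma0 rv i j.
have two a : a < 2 -> exists b : bool, a = b.
  by case: a => [|[|//]] _; [exists false|exists true].
split; last first.
  move=> al be /two[a ->] /two[b ->]; have [h1 _ _ _ _] := rv; exact: h1.
apply/seteqP; split=> [d [al [be [/two[a ->] /two[b ->] ne ->]]]|_ ->].
  apply: (rep_diag rv rep0) => [[e1 e2]|[_ //]].
  by move: ne; rewrite e1 e2 eqxx.
exists 0, 1; split=> //; first by apply/eqP => -[].
change (pair_diagram i j = atDiag [:: reps v i false; reps v j true]).
by apply: (rep_diag rep0 rv) => -[].
Qed.

(** ** The formulas *)

(** A variable that occurs nowhere but in the tags. Each stage of the
    construction of [theta'] adds one tag, so that counting tags tells which of
    these formulas are subformulas of which. *)
Let u : nat := xvar l 0.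

Definition tag_formula : formula L := FEx u (FEq u u).

Definition table_formula (i j : 'I_l) (x y : nat) : formula L :=
  fandl [seq if `[< D A i j false >] then atom_formula A x y
             else FNot (atom_formula A x y) | A <- enum {: atom L}].

Definition ext_formula (g : nat -> 'I_l) (k : nat) : formula L :=
  FAnd (instance2 xi (yvar k) (xvar (g k) 0))
    (fandl [seq FAnd (FNot (FEq (yvar r) (yvar k)))
              (FAnd (table_formula (g r) (g k) (yvar r) (yvar k))
                    (table_formula (g k) (g r) (yvar k) (yvar r))) | r <- iota 0 k]).

Fixpoint theta_formula (g : nat -> 'I_l) (k : nat) : formula L :=
  if k is k'.+1 then
    FAnd (theta_formula g k') (FAnd tag_formula (ext_formula g k'))
  else tag_formula.

Definition ext_holds (N : structure L) (v : nat -> N) (g : nat -> 'I_l) k : Prop :=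
  holds2 xi (v (yvar k)) (v (xvar (g k) 0)) /\
  forall r, r < k -> v (yvar r) <> v (yvar k) /\
    forall A : atom L,
      (holds_atom A (v (yvar r)) (v (yvar k)) <-> D A (g r) (g k) false) /\
      (holds_atom A (v (yvar k)) (v (yvar r)) <-> D A (g k) (g r) false).

Lemma sat_table (N : structure L) (v : nat -> N) i j x y :
  sat (table_formula i j x y) v <->
  forall A : atom L, holds_atom A (v x) (v y) <-> D A i j false.
Proof.
rewrite sat_andl; split=> [h A|h psi /List.in_map_iff[A [<- _]]].
  have := h (if `[< D A i j false >] then atom_formula A x y else FNot (atom_formula A x y)).
  case: asboolP => DA; rewrite -sat_atom => h'; split=> // hA.
    by apply: h'; apply/List.in_map_iff; exists A; rewrite asboolT //; split=> //;
       apply/In_mem; rewrite mem_enum.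
  exfalso; move: hA; apply: h'; apply/List.in_map_iff; exists A; rewrite asboolF //.
  by split=> //; apply/In_mem; rewrite mem_enum.
by case: asboolP => DA; [apply/sat_atom/h|move/sat_atom/h].
Qed.

Lemma sat_ext_formula (N : structure L) (v : nat -> N) g k :
  sat (ext_formula g k) v <-> ext_holds v g k.
Proof.
have -> : sat (ext_formula g k) v <-> holds2 xi (v (yvar k)) (v (xvar (g k) 0)) /\
    forall phi, List.In phi [seq FAnd (FNot (FEq (yvar r) (yvar k)))
              (FAnd (table_formula (g r) (g k) (yvar r) (yvar k))
                    (table_formula (g k) (g r) (yvar k) (yvar r))) | r <- iota 0 k] ->
    sat phi v.
  by rewrite -sat_andl -sat_instance2.
split=> -[h1 h2]; split=> //; last first.
  move=> _ /In_map_iota[r rk ->]; have [ne h] := h2 r rk; split=> //.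
  by split; apply/sat_table => A; case: (h A).
move=> r rk; have [] := h2 _ ((In_map_iota _ _ _).2 (ex_intro2 _ _ r rk erefl)).
by move=> ne [/sat_table e1 /sat_table e2]; split.
Qed.

Lemma sat_theta (N : structure L) (v : nat -> N) g k :
  sat (theta_formula g k) v <-> forall j, j < k -> ext_holds v g j.
Proof.
elim: k => [|k IH]; first by split=> // _; exists (v 0).
have -> : sat (theta_formula g k.+1) v <-> sat (theta_formula g k) v /\
    ext_holds v g k.
  by rewrite -sat_ext_formula /=; split=> [[h1 [_ h2]]|[h1 h2]]; do !split=> //;
     exists (v 0).
rewrite IH; split=> [[h1 h2] j|h]; last first.
  by split; [move=> j jk; apply: h; exact: ltnW|exact: h].
by rewrite ltnS leq_eqVlt => /orP[/eqP->//|]; exact: h1.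
Qed.

Lemma theta_formula_ext g g' k : (forall r, r < k -> g r = g' r) ->
  theta_formula g k = theta_formula g' k.
Proof.
elim: k => //= k IH h; rewrite IH => [|r rk]; last by apply: h; exact: ltnW.
rewrite /ext_formula h //; congr (FAnd _ (FAnd _ (FAnd _ (fandl _)))).
by apply/List.map_ext_in => r /In_mem; rewrite mem_iota => /andP[_ rk]; rewrite h // ltnW.
Qed.

Lemma yvar_u k : yvar k != u.
Proof. by rewrite yvar_xvar. Qed.

Lemma xvar_u (i : 'I_l) a : xvar i a != u.
Proof.
apply/eqP => /xvar_inj[e _]; by have := ltn_ord i; rewrite e ltnn.
Qed.

Lemma vars_atom A x y z : z \in vars (atom_formula A x y : formula L) -> z = x \/ z = y.
Proof. by case/mapP => -[] _ ->; [right|left]. Qed.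

Lemma u_table i j x y : x != u -> y != u -> u \notin vars (table_formula i j x y).
Proof.
move=> xu yu; apply/negP => /vars_andl[e|[_ /List.in_map_iff[A [<- _]]]].
  by have := yvar_u 0; rewrite e.
by case: asboolP => _ /= /vars_atom[] e; [move: xu|move: yu|move: xu|move: yu];
   rewrite e eqxx.
Qed.

Lemma binders_ext g k : binders u (ext_formula g k) = 0.
Proof.
apply: binders0; rewrite /= mem_cat negb_or; apply/andP; split.
  apply: vars_subst; first by rewrite /u /xvar /= odd_double.
  by move=> x; case: ifP => _; [exact: yvar_u|exact: xvar_u].
apply/negP => /vars_andl[e|[_ /In_map_iota[r rk ->]]].
  by have := yvar_u 0; rewrite e.
rewrite /= !inE !mem_cat; apply/negP.
rewrite !negb_or !(eq_sym u) !yvar_u /=.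
by rewrite !u_table ?yvar_u.
Qed.

Lemma binders_step g k : binders u (FAnd tag_formula (ext_formula g k)) = 1.
Proof.
have -> : binders u (FAnd tag_formula (ext_formula g k)) =
  binders u tag_formula + binders u (ext_formula g k) by [].
by rewrite binders_ext /= eqxx.
Qed.

Lemma binders_theta g k : binders u (theta_formula g k) = k.+1.
Proof.
elim: k => [|k IH]; first by rewrite /= eqxx.
have -> : binders u (theta_formula g k.+1) = binders u (theta_formula g k) +
  binders u (FAnd tag_formula (ext_formula g k)) by [].
by rewrite IH binders_step addn1.
Qed.

Lemma sub_step g g' k n : subformula (theta_formula g k.+1)
  (FAnd tag_formula (ext_formula g' n)) -> False.
Proof. by move/(binders_sub u); rewrite binders_theta binders_step. Qed.

Lemma sub_theta_same g g' k :
  subformula (theta_formula g k) (theta_formula g' k) ->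
  theta_formula g k = theta_formula g' k.
Proof.
case: k => [//|k] [//|[|/sub_step//]].
by move/(binders_sub u); rewrite !binders_theta ltnn.
Qed.

(** A formula of stage [k] has [k + 1] tags, while a new conjunct has a single
    one. *)
Lemma sub_theta_next g g' k :
  subformula (theta_formula g k) (theta_formula g' k.+1) ->
  theta_formula g k = theta_formula g' k.
Proof.
case=> [e|[/sub_theta_same //|]]; last by case: k => [//|k /sub_step].
have {}e : theta_formula g k = theta_formula g' k.+1 := e.
by have /eqP := congr1 (binders u) e; rewrite !binders_theta eqSS ltn_eqF.
Qed.

Lemma fv_table i j x y : {subset fv (table_formula i j x y) <= [:: x; y]}.
Proof.
move=> z /fv_andl[_ /List.in_map_iff[A [<- _]]].
by case: asboolP => _ /= /fv_atom.
Qed.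

Lemma fv_theta g k : {subset fv (theta_formula g k) <= yvars k ++ xvars (@rep_count l)}.
Proof.
elim: k => [|k IH]; first by move=> z; rewrite /= eqxx.
have yk r : r <= k -> yvar r \in yvars k.+1 ++ xvars (@rep_count l).
  by move=> rk; rewrite mem_cat map_f // mem_iota.
have mono : {subset yvars k ++ xvars (@rep_count l) <= yvars k.+1 ++ xvars (@rep_count l)}.
  move=> z; rewrite !mem_cat => /orP[/mapP[r]|->]; last by rewrite orbT.
  by rewrite mem_iota => /andP[_ rk] ->; rewrite map_f // mem_iota /= ltnW.
have xk (i : 'I_l) : xvar i 0 \in yvars k.+1 ++ xvars (@rep_count l).
  by rewrite mem_cat; apply/orP; right; apply/mem_xvars; exists i, 0.
move: (yvars k.+1 ++ _) yk mono xk => V yk mono xk z.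
rewrite /= eqxx /= !mem_cat => /orP[/IH/mono//|/orP[/fv_subst/mapP[x _ ->]|]].
  by case: (x == 0); [exact: yk|exact: xk].
move=> /fv_andl[_ /In_map_iota[r rk ->]].
rewrite /= !inE !mem_cat; have rk' := ltnW rk.
by case/or4P => [/eqP->|/eqP->|/fv_table|/fv_table]; rewrite ?yk // !inE;
   case/orP => /eqP->; rewrite yk.
Qed.

(** ** The extension properties *)

(** Only these sequences of labels are those of a tuple of distinct elements. *)
Definition valid k (s : k.-tuple 'I_l) : bool :=
  [forall r : 'I_k, forall r' : 'I_k,
     (tnth s r == tnth s r') && (r != r') ==> inf (tnth s r)].

Lemma validP k (s : k.-tuple 'I_l) :
  reflect (forall r r', r < k -> r' < k -> nth i0 s r = nth i0 s r' -> r <> r' ->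
             inf (nth i0 s r)) (valid s).
Proof.
apply: (iffP forallP) => [h r r' rk rk' e ne|h r].
  move/forallP: (h (Ordinal rk)) => /(_ (Ordinal rk'))/implyP.
  rewrite !(tnth_nth i0) /= => -> //; rewrite e eqxx /=.
  by apply/eqP => -[].
apply/forallP => r'; apply/implyP; rewrite !(tnth_nth i0) => /andP[/eqP e /eqP ne].
by apply: (h r r') => // e'; apply/ne/val_inj.
Qed.

Definition label_index k := #|{: k.-tuple 'I_l}|.

Definition labels k (i : 'I_(label_index k)) : k.-tuple 'I_l := enum_val i.

Definition false_formula : formula L := FNot (FEq (yvar 0) (yvar 0)).

Definition theta' k (i : 'I_(label_index k)) : formula L :=
  if valid (labels i) then theta_formula (nth i0 (labels i)) k else false_formula.

Definition theta k (i : 'I_(label_index k)) : formula L :=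
  exists_vars (xvars (@rep_count l)) (FAnd gamma0 (theta' i)).

Lemma labels_exist k (s : seq 'I_l) : size s = k ->
  exists i : 'I_(label_index k), labels i = s :> seq 'I_l.
Proof.
by move=> /eqP sk; exists (enum_rank (Tuple sk)); rewrite /labels enum_rankK.
Qed.

Lemma ext_holds_labelled (N : structure L) (w : nat -> N) lab g k :
  model_labelling xi lab0 w lab ->
  (forall r, r <= k -> lab (w (yvar r)) = g r) ->
  (forall r, r < k -> w (yvar r) <> w (yvar k)) ->
  ext_holds w g k.
Proof.
move=> [hl _ labX xiE _] lg dis; split.
  by rewrite xiE lg // (labX (g k) false).
move=> r rk; split=> [|A]; first exact: dis.
have dis' : w (yvar k) <> w (yvar r) by move=> e; apply: (dis r rk).
by rewrite !hl.2 !lg ?(ltnW rk) // !asboolF //; exact: dis.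
Qed.

(** In a model, [theta i] describes the tuples of distinct elements labelled by
    [labels i], up to a renaming of the labels. *)
Lemma sat_theta_model (N : structure L) k (i : 'I_(label_index k)) (v : nat -> N) :
  models N T ->
  sat (theta i) v <->
  (exists w lab, [/\ forall y, y \notin xvars (@rep_count l) -> w y = v y,
     model_labelling xi lab0 w lab &
     forall r, r < k -> lab (v (yvar r)) = nth i0 (labels i) r]) /\
  (forall r r', r < k -> r' < k -> v (yvar r) = v (yvar r') -> r = r').
Proof.
move=> mN; rewrite /theta sat_exists_vars; split.
  move=> [w [ew [/sat_gamma0 rw]]]; rewrite /theta'; case: ifP => vl; last by case.
  move/sat_theta => hw.
  have wy r : w (yvar r) = v (yvar r) by rewrite ew ?yvar_xvars.
  have [lab [h1 h2 h3 h4]] := represents_labelled cT mM0 hp mN rw.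
  split.
    exists w, lab; split=> // r rk; have [hx _] := hw r rk.
    move: hx; rewrite -wy => /h3 ->; exact: (h2 _ false).
  have lt r r' : r < r' -> r' < k -> v (yvar r) <> v (yvar r').
    move=> rr rk; have [_ h] := hw r' rk; have [+ _] := h r rr; by rewrite !wy.
  move=> r r' rk rk' e; case: (ltngtP r r') => // rr; first by case: (lt _ _ rr rk').
  by case: (lt _ _ rr rk).
move=> [[w [lab [ew hw lg]]] inj].
have wy r : w (yvar r) = v (yvar r) by rewrite ew ?yvar_xvars.
have [hl rw _ _ _] := hw.
exists w; split=> //; split; first exact/sat_gamma0.
rewrite /theta' (_ : valid _ = true).
  apply/sat_theta => j jk; apply: (ext_holds_labelled hw) => [r rj|r rj].
    by rewrite wy lg // (leq_ltn_trans rj).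
  rewrite !wy => /inj e; have := ltn_trans rj jk => rk.
  by move: rj; rewrite (e rk jk) ltnn.
apply/validP => r r' rk rk' e ne.
have := hl.1 (nth i0 (labels i) r); case: ifP => // _ [a ha].
case: ne; apply: inj => //.
by rewrite ((ha (v (yvar r))).1 (lg r rk)) ((ha (v (yvar r'))).1 _) // lg.
Qed.

Lemma reps_upd (N : structure L) (w : nat -> N) k z :
  reps (l := l) (upd w (yvar k) z) = reps w.
Proof.
apply: reps_ext => x xs; rewrite updE; case: eqP => // e.
by have := yvar_xvars k (@rep_count l); rewrite -e xs.
Qed.

Lemma yvar_eq r k : (yvar r == yvar k) = (r == k).
Proof. by rewrite /yvar -!muln2 eqn_pmul2r. Qed.

Lemma theta_extend (N : structure L) k (j : 'I_(label_index k.+1))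
    (v w : nat -> N) lab z :
  models N T ->
  (forall y, y \notin xvars (@rep_count l) -> w y = v y) ->
  model_labelling xi lab0 w lab ->
  (forall r, r < k -> lab (v (yvar r)) = nth i0 (labels j) r) ->
  lab z = nth i0 (labels j) k ->
  (forall r r', r < k -> r' < k -> v (yvar r) = v (yvar r') -> r = r') ->
  (forall r, r < k -> z <> v (yvar r)) ->
  sat (theta j) (upd v (yvar k) z).
Proof.
move=> mN ew hw lg lz inj nz; apply/(sat_theta_model _ _ mN); split.
  exists (upd w (yvar k) z), lab; split.
  - by move=> y ys; rewrite !updE ew.
  - by rewrite /model_labelling reps_upd.
  move=> r; rewrite ltnS leq_eqVlt updE yvar_eq; case: eqP => [->//|_ /=].
  exact: lg.
move=> r r'; rewrite !ltnS (leq_eqVlt r) (leq_eqVlt r') !updE !yvar_eq.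
case: (eqVneq r k) => [->|_] /=; case: (eqVneq r' k) => [->|_] //= rk rk'.
- by move=> e; case: (nz _ rk').
- by move=> e; case: (nz _ rk).
- exact: inj.
Qed.

Lemma theta'_rcons k (i : 'I_(label_index k)) (j : 'I_(label_index k.+1)) :
  valid (labels j) ->
  (forall r, r < k -> nth i0 (labels j) r = nth i0 (labels i) r) ->
  subformula (theta' i) (theta' j).
Proof.
move=> vj e; rewrite /theta' vj.
have vi : valid (labels i).
  apply/validP => r r' rk rk'; rewrite -!e // => er ne.
  by move/validP: vj => /(_ r r'); apply=> //; exact: ltnW.
rewrite vi /=; right; left.
rewrite (@theta_formula_ext (nth i0 (labels i)) (nth i0 (labels j))); last first.
  by move=> r /e ->.
by case: (theta_formula _ k) => *; left.
Qed.

Lemma nth_rcons_labels k (i : 'I_(label_index k)) lam (j : 'I_(label_index k.+1)) :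
  labels j = rcons (labels i) lam :> seq 'I_l ->
  (forall r, r < k -> nth i0 (labels j) r = nth i0 (labels i) r) /\
  nth i0 (labels j) k = lam.
Proof.
move=> ->; split=> [r rk|]; first by rewrite nth_rcons size_tuple rk.
by rewrite nth_rcons size_tuple ltnn eqxx.
Qed.

(** A tuple is extended by prescribing the label of the new element. Such an
    element exists unless the label belongs to a singleton class whose element
    has been used, and then the longer sequence of labels is not valid and has
    an unrelated formula. *)
Lemma theta_properties :
  extension_properties T theta (fun k i => [set j | subformula (theta' i) (theta' j)]).
Proof.
have fresh_inj (N : structure L) k (v : nat -> N) :
    injective (fun r : 'I_k => v (yvar r)) ->
    forall r r', r < k -> r' < k -> v (yvar r) = v (yvar r') -> r = r'.
  by move=> inj r r' rk rk' e; have [] := inj (Ordinal rk) (Ordinal rk') e.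
split=> [|k i x|k i|k].
- by rewrite /label_index card_tuple expn0.
- rewrite /theta fv_exists_vars mem_filter /= mem_cat => /andP[nx /orP[/fv_gamma0 h|]].
    by rewrite h in nx.
  rewrite /theta'; case: ifP => vi.
    by move/fv_theta; rewrite mem_cat (negPf nx) orbF.
  have k0 : 0 < k.
    by case: k i vi nx => // i /validP[] r r'; rewrite ltn0.
  rewrite /= !inE orbb => /eqP ->; apply: map_f; by rewrite mem_iota.
- have [|j ej] := @labels_exist k.+1 (rcons (labels i) i0).
    by rewrite size_rcons size_tuple.
  exists j => /=.
  have [e1 e2] := nth_rcons_labels ej.
  case: (boolP (valid (labels j))) => vj; first exact: theta'_rcons.
  rewrite /theta' (negPf vj); case: ifP => vi; last by left.
  move/validP: vj; case=> r r' rk rk' er ne.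
  case: (eqVneq r k) er ne => [->|nrk]; first by rewrite e2.
  have rk1 : r < k by move: rk; rewrite ltnS leq_eqVlt (negPf nrk).
  case: (eqVneq r' k) => [->|nrk']; first by rewrite e2 => ->.
  have rk1' : r' < k by move: rk'; rewrite ltnS leq_eqVlt (negPf nrk').
  by rewrite !e1 // => er ne; move/validP: vi => /(_ r r'); apply.
split.
- move=> N mN v inj; have [w [lab hw]] := labelling mN.
  pose w' x := if x \in xvars (@rep_count l) then w x else v x.
  have hw' : model_labelling xi lab0 w' lab.
    rewrite /model_labelling (_ : reps w' = reps w) //.
    by apply: reps_ext => x xs; rewrite /w' xs.
  have [|i ei] := @labels_exist k [seq lab (v (yvar r)) | r <- iota 0 k].
    by rewrite size_map size_iota.
  exists i; apply/(sat_theta_model _ _ mN); split; last exact: fresh_inj.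
  exists w', lab; split=> // [y ys|r rk]; first by rewrite /w' (negPf ys).
  by rewrite ei (nth_map 0) ?size_iota // nth_iota.
- move=> N mN v i j /= sub hv.
  have [[w [lab [ew hw lg]]] inj] := (sat_theta_model _ _ mN).1 hv.
  have [hl _ labX _ _] := hw.
  have vi : valid (labels i).
    by move: hv => /sat_exists_vars[w0 [_ [_]]]; rewrite /theta'; case: ifP => // _; case.
  move: sub; rewrite /theta' vi; case: (boolP (valid (labels j))) => vj; last first.
    by move/(binders_sub u); rewrite binders_theta.
  move/sub_theta_next => eth.
  have lg' r : r < k -> lab (v (yvar r)) = nth i0 (labels j) r.
    move=> rk.
    have : sat (theta_formula (nth i0 (labels i)) k) w.
      apply/sat_theta => r' rk'; apply: (ext_holds_labelled hw) => [q qr|q qr].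
        by rewrite ew ?yvar_xvars // lg // (leq_ltn_trans qr).
      rewrite !ew ?yvar_xvars // => /inj e.
      by have qk := ltn_trans qr rk'; move: qr; rewrite (e qk rk') ltnn.
    rewrite eth => /sat_theta/(_ r rk)[hx _]; move: hx.
    have [_ _ _ xiE _] := hw.
    by rewrite xiE ew ?yvar_xvars // (labX (nth i0 (labels j) r) false).
  pose lam := nth i0 (labels j) k.
  have [z [lz nz]] : exists z, lab z = lam /\ forall r, r < k -> z <> v (yvar r).
    have := hl.1 lam; case: ifP => il => [ic|_].
      have [z [/= lz nz]] := infinite_fresh [seq v (yvar r) | r <- iota 0 k] ic.
      exists z; split=> // r rk e; apply: nz; apply/In_map_iota; by exists r.
    exists (reps w lam false); split=> // r rk e.
    have : nth i0 (labels j) r = nth i0 (labels j) k by rewrite -lg' // -e labX.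
    move=> er; have nrk : r <> k by move=> rk'; move: rk; rewrite rk' ltnn.
    move/validP: vj => /(_ r k (ltnW rk) (ltnSn k) er nrk).
    by rewrite er -/lam /inf il.
  by exists z; apply: (theta_extend mN ew hw lg').
- move=> N mN v i hv z nz.
  have [[w [lab [ew hw lg]]] inj] := (sat_theta_model _ _ mN).1 hv.
  have [|j ej] := @labels_exist k.+1 (rcons (labels i) (lab z)).
    by rewrite size_rcons size_tuple.
  have [e1 e2] := nth_rcons_labels ej.
  have st : sat (theta j) (upd v (yvar k) z).
    apply: (theta_extend mN ew hw) => // [r rk|r rk]; first by rewrite e1 ?lg.
    exact: (nz (Ordinal rk)).
  exists j => //=; apply: theta'_rcons => //.
  by move: st => /sat_exists_vars[w0 [_ [_]]]; rewrite {1}/theta'; case: ifP => // _; case.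
- move=> i; case: (pselect (exists N (v : nat -> carrier N), models N T /\ sat (theta i) v)).
    move=> [N [v [mN hv]]]; exists (atDiag (map v (yvars k))).
      by exists N, (map v (yvars k)); split=> //; rewrite !size_map size_iota.
    move=> N' mN' v' hv'.
    have [[w [lab [ew hw lg]]] inj] := (sat_theta_model _ _ mN).1 hv.
    have [[w' [lab' [ew' hw' lg']]] inj'] := (sat_theta_model _ _ mN').1 hv'.
    split; first by move=> r r' e; apply: val_inj; exact: inj' (ltn_ord r) (ltn_ord r') e.
    apply: eqtp_atDiag.
    have [hl _ _ _ _] := hw; have [hl' _ _ _ _] := hw'.
    have E (K : structure L) (x : nat -> K) : map x (yvars k) =
        map (fun r : 'I_k => x (yvar r)) (enum 'I_k).
      by rewrite /yvars -map_comp -val_enum_ord -map_comp.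
    rewrite !E; apply: (labelled_eqtp_map hL _ hl' hl) => [r|r r'].
      by rewrite lg ?lg'.
    by split=> e; do 2 congr (_ _); [apply: inj'|apply: inj].
  move=> nh; have [a] := carrier_inhabited M0.
  exists (atDiag (nseq k a)); first by exists M0, (nseq k a); split=> //; exact: size_nseq.
  by move=> N mN v hv; case: nh; exists N, v.
Qed.

Lemma partition_extension : exists (xi : formula L) (l : nat)
    (delta : 'I_l -> 'I_l -> set (set (formula L))),
  [/\ restricted_equiv T xi, diagram_family delta, forall i j, delta i j #= `I_1
    & xi_extension_properties T xi delta].
Proof.
have [el rT] := partition_restricted cT mM0 hp.
exists xi, l, (fun i j => [set pair_diagram i j]); split.
- by exists #|inflab lab0|, #|[predC inflab lab0]|.
- move=> i j; split; first by exists (pair_diagram i j).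
  by move=> _ ->; exists M0, [:: reps v0 i false; reps v0 j true].
- by move=> i j; exact: card_set1.
split; first by exists #|inflab lab0|, #|[predC inflab lab0]|.
exists label_index, theta, theta'; split; last exact: theta_properties.
exists (@rep_count l), gamma0.
have spec k (i : 'I_(label_index k)) (js : 'I_k -> 'I_l) eta :
    (forall r, nth i0 (labels i) (val r) = js r) ->
    (forall r s, eta (js r) (js s) = pair_diagram (js r) (js s)) ->
    theta'_spec xi js eta (theta' i).
  move=> ejs eeta N w; rewrite /theta'; case: ifP => vi; last by case.
  move/sat_theta => hw; split=> [r s rs|r]; last first.
    have [hx _] := hw r (ltn_ord r); move: hx; by rewrite ejs.
  have rs' : (r : nat) <> s by move=> e; move: rs; rewrite -val_eqE /= e eqxx.
  have lt (p q : 'I_k) : p < q -> w (yvar p) <> w (yvar q) /\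
      forall A : atom L, (holds_atom A (w (yvar p)) (w (yvar q)) <->
        D A (js p) (js q) false) /\ (holds_atom A (w (yvar q)) (w (yvar p)) <->
        D A (js q) (js p) false).
    by move=> pq; have [_ /(_ p pq)] := hw q (ltn_ord q); rewrite !ejs.
  have [ne hA] : w (yvar r) <> w (yvar s) /\ forall A : atom L,
      holds_atom A (w (yvar r)) (w (yvar s)) <-> D A (js r) (js s) false.
    case: (ltngtP r s) => // /lt[ne h]; split.
    - exact: ne.
    - by move=> A; case: (h A).
    - by move=> e; apply: ne.
    - by move=> A; case: (h A).
  have nr : reps v0 (js r) false <> reps v0 (js s) true.
    move/(rep_equal rep0); case=> [[_ //]|e ii].
    move/validP: vi => /(_ r s (ltn_ord r) (ltn_ord s)).
    by rewrite !ejs => /(_ e rs'); rewrite (negPf ii).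
  rewrite eeta; apply: atDiag_pair; first by split.
  move=> A; have [h1 _ _ _ h6] := rep0.
  have [_ t2] := h6 _ _ _ _ ((h1 (js r) (js r) false false).2 erefl)
    ((h1 (js s) (js s) false true).2 erefl) A.
  by rewrite hA t2.
have tupE k (js : 'I_k -> 'I_l) (i : 'I_(label_index k)) :
    labels i = map js (enum 'I_k) :> seq 'I_l ->
    forall r : 'I_k, nth i0 (labels i) (val r) = js r.
  move=> e r; have er : nth r (enum 'I_k) r = r by apply: val_inj; rewrite /= nth_enum_ord.
  by rewrite e (nth_map r) ?size_enum_ord //= er.
split.
- exact: pair_diagram_spec.
- move=> k js eta ch.
  have [|i ei] := @labels_exist k (map js (enum 'I_k)).
    by rewrite size_map size_enum_ord.
  by exists i; apply: spec; [exact: tupE|move=> r s; exact: ch].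
- move=> k i; exists (tnth (labels i)), pair_diagram; split=> //.
  by apply: spec => // r; rewrite (tnth_nth i0).
move=> k i; split=> //.
  have [_ + _ _] := theta_properties; exact.
move=> x; rewrite /theta'; case: ifP => vi; first exact: fv_theta.
have k0 : 0 < k.
  by case: k i vi => // i /validP[] r r'; rewrite ltn0.
by rewrite /= !inE orbb mem_cat => /eqP ->; rewrite map_f // mem_iota.
Qed.

End Extension.

(** * The theorem *)

Theorem corollary5p11 (L : vocabulary) (hL : binary L) (T : theory L)
    (hT : complete T) (hinf : has_infinite_model T) :
  let cond_i :=
    [/\ omega_stable T, omega_categorical T, SU_rank_eq T 1
      & trivial_pregeometry T] in
  let cond_ii :=
    exists (xi : formula L) (l : nat)
           (delta : 'I_l -> 'I_l -> set (set (formula L))),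
      [/\ restricted_equiv T xi,
          diagram_family delta,
          forall i j, delta i j #= `I_1
        & xi_extension_properties T xi delta] in
  let cond_iii :=
    exists xi : formula L, restricted_equiv T xi /\
      forall M : structure L, models M T ->
        forall X : set M, classes xi X -> indiscernible_set X (~` X) in
  (cond_i <-> cond_ii) /\ (cond_ii <-> cond_iii).
Proof.
move=> cond_i cond_ii cond_iii.
pose partition := exists (M : structure L) (xi : formula L) (l : nat)
  (lab : M -> 'I_l),
  [/\ models M T, infinite_set [set: M] & homogeneous_partition xi lab].
have [M [mM iM]] := hinf.
have i_part : cond_i -> partition.
  move=> [ws wc rk triv].
  have [N [f [ef cN _]]] := @lowenheim_skolem L M [::].
  have mN : models N T by apply/(elementary_models T ef).
  have iN := elementary_infinite ef iM.
  have [xi [l [lab h]]] := stable_partition ws wc rk triv mN iN cN.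
  by exists N, xi, l, lab.
have ii_part : cond_ii -> partition.
  move=> [xi [l [delta [hxi hd _ ext]]]].
  have [l' [lab h]] := partition_of_extension mM hxi hd ext.
  by exists M, xi, l', lab.
have iii_part : cond_iii -> partition.
  move=> [xi [hxi ind]].
  have [l [lab h]] := partition_of_indiscernible mM hxi (ind M mM).
  by exists M, xi, l, lab.
have part_i : partition -> cond_i.
  move=> [N [xi [l [lab [mN iN h]]]]]; split.
  - exact (partition_stable hL hT mN iN h).
  - exact (partition_categorical hL hT mN h).
  - exact (partition_rank hL hT mN iN h).
  - exact (partition_trivial hL hT mN h).
have part_ii : partition -> cond_ii.
  by move=> [N [xi [l [lab [mN iN h]]]]]; exact (partition_extension hL hT mN iN h).
have part_iii : partition -> cond_iii.
  move=> [N [xi [l [lab [mN iN h]]]]]; exists xi; split.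
    have [_ rT] := partition_restricted hT mN h.
    by exists #|inflab lab|, #|[predC inflab lab]|.
  by move=> K mK X cX; apply: (partition_indiscernible hL hT mN h).
by split; split=> h; auto.
Qed.
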